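(* Let $m=(m_t)_{t\in[0,1]}$ be a standard Brownian meander on $[0,1]$ and let $B$ be a standard Brownian motion independent of $m$. For $c\ge 0$ define the continuous processes \[ u_t:=\begin{cases}\frac{1}{\sqrt2}\,m_{2t}, & t\in[0,1/2],\\[2pt] \frac1{\sqrt2}\,m_1+B_{t-\frac12}, & t\in[1/2,1],\end{cases} \qquad U^c_t:=\begin{cases}u_t, & t\in[0,1/2],\\[2pt] u_t+\bigl(12\,t(2-t)-9\bigr)\Bigl(c-\int_0^1u_r\,dr\Bigr), & t\in[1/2,1].\end{cases} \] Write $\langle m,1\rangle:=\int_0^1 m_r\,dr$. Then for all bounded Borel $\Phi:C([0,1])\to\mathbb R$ and bounded Borel $f:\mathbb R\to\mathbb R$, \[ \mathbb E\bigl[\Phi(m)\,f(\langle m,1\rangle)\bigr]=\int_0^\infty\sqrt{\tfrac{24}{\pi}}\;\mathbb E\Bigl[\Phi(U^c)\,e^{-12\left(\int_0^{1/2}(U^c_r+U^c_{1/2})\,dr-c\right)^2}\,1_{\{U^c_t\ge0,\ \forall t\in[0,1]\}}\Bigr]\,f(c)\,dc. \]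
   Context: The Brownian meander is a Brownian motion on $[0,1]$ conditioned to stay non-negative on $[0,1]$ (obtained as the weak limit as $\varepsilon\to0$ of $B$ conditioned on $\{B_t\ge-\varepsilon\ \forall t\in[0,1]\}$). Note $\int_0^1U^c_t\,dt=c$. *)

(* Defs.v *)
From HB Require Import structures.
From mathcomp Require Import all_boot all_order all_algebra.
From mathcomp Require Import all_classical all_reals all_analysis.
From mathcomp Require Import normal_distribution.
Set Implicit Arguments. Unset Strict Implicit. Unset Printing Implicit Defensive.
Import Order.TTheory GRing.Theory Num.Theory.
Import numFieldNormedType.Exports.
Local Open Scope classical_set_scope.
Local Open Scope ring_scope.

Section Defs.
Context {R : realType} {d : measure_display} {Omega : measurableType d}.

(* A real process indexed by time t : R (only the relevant times matter). *)
Definition process := R -> Omega -> R.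

Definition traj (X : process) (w : Omega) : R -> R := fun t => X t w.

(* Cylinder sigma-algebra on paths R -> R generated by evaluations at
   times t in [0,1].  Its trace on C([0,1]) is the Borel sigma-algebra of
   C([0,1]) (sup norm). *)
Definition cyl01 : set (set (R -> R)) :=
  [set S | exists t : R, exists A : set R,
     0 <= t <= 1 /\ measurable A /\ S = (fun x => x t) @^-1` A].

Definition path_borel (Phi : (R -> R) -> R) : Prop :=
  forall B : set R, measurable B -> <<s cyl01 >> (Phi @^-1` B).

Definition bounded_fun_on {T} (F : T -> R) : Prop :=
  exists M : R, forall x, `|F x| <= M.

Definition depends_on_01 (Phi : (R -> R) -> R) : Prop :=
  forall x y : R -> R, (forall t, 0 <= t <= 1 -> x t = y t) -> Phi x = Phi y.

Definition cont01 (x : R -> R) : Prop := {within `[0, 1], continuous x}.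

Definition sup_continuous (Phi : (R -> R) -> R) : Prop :=
  forall x, cont01 x -> forall e : R, 0 < e -> exists2 delta : R, 0 < delta &
    forall y, cont01 y -> (forall t, 0 <= t <= 1 -> `|x t - y t| <= delta) ->
      `|Phi x - Phi y| < e.

Definition gen_sigma (X : process) (I : set R) : set (set Omega) :=
  <<s [set S | exists t, exists A : set R,
        I t /\ measurable A /\ S = X t @^-1` A] >>.

Variable P : probability Omega R.

Definition indep_processes (X : process) (IX : set R) (Y : process) (IY : set R)
  : Prop :=
  forall A C, gen_sigma X IX A -> gen_sigma Y IY C ->
    P (A `&` C) = (P A * P C)%E.

Definition is_BM (W : process) : Prop :=
  [/\ (forall t, 0 <= t -> measurable_fun setT (W t)),
      (forall w, W 0 w = 0),
      (forall w, {within `[0, +oo[, continuous (traj W w)}) &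
      (forall (n : nat) (t : nat -> R) (A : nat -> set R),
         t 0%N = 0 -> (forall i, (i < n)%N -> t i < t i.+1) ->
         (forall i, measurable (A i)) ->
         (P (\bigcap_(i in `I_n) [set w | A i (W (t i.+1) w - W (t i) w)]))
         = (\prod_(i < n) normal_prob 0 (Num.sqrt (t i.+1 - t i)) (A i))%E)].

Definition above (W : process) (eps : R) : set Omega :=
  [set w | forall t, 0 <= t <= 1 -> - eps <= W t w].

(* Brownian meander on [0,1]: a process with continuous paths on [0,1] whose law
   is the weak limit (eps -> 0+) of the law of a Brownian motion W conditioned
   on {W_t >= -eps, t in [0,1]}. *)
Definition is_meander (m : process) : Prop :=
  [/\ (forall t, 0 <= t <= 1 -> measurable_fun setT (m t)),
      (forall w, cont01 (traj m w)) &
      forall W, is_BM W ->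
      forall Phi : (R -> R) -> R, bounded_fun_on Phi -> sup_continuous Phi ->
        depends_on_01 Phi ->
        (fun eps : R =>
           fine (\int[P]_w ((Phi (traj W w)) * \1_(above W eps) w)%:E)
           / fine (P (above W eps)))
          @ 0^'+ --> fine (\int[P]_w (Phi (traj m w))%:E)].

End Defs.

Section Processes.
Context {R : realType} {d : measure_display} {Omega : measurableType d}.

Definition pint (x : R -> R) (a b : R) : R :=
  fine (\int[lebesgue_measure]_(r in `[a, b]) (x r)%:E)%E.

Definition u_proc (m B : @process R d Omega) : process :=
  fun t w => if t <= 1/2 then (Num.sqrt 2)^-1 * m (2 * t) w
             else (Num.sqrt 2)^-1 * m 1 w + B (t - 1/2) w.

Definition U_proc (m B : @process R d Omega) (c : R) : process :=
  fun t w => if t <= 1/2 then u_proc m B t w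
             else u_proc m B t w
                  + (12 * t * (2 - t) - 9) * (c - pint (traj (u_proc m B) w) 0 1).

End Processes.

(* Main.v *)
Require Import Defs.
From HB Require Import structures.
From mathcomp Require Import all_boot all_order all_algebra.
From mathcomp Require Import all_classical all_reals all_analysis.
From mathcomp Require Import measurable_realfun normal_distribution.
From mathcomp Require Import ring lra.
Set Implicit Arguments. Unset Strict Implicit. Unset Printing Implicit Defensive.
Import Order.TTheory GRing.Theory Num.Theory.
Import numFieldNormedType.Exports.
Local Open Scope classical_set_scope.
Local Open Scope ring_scope.

(** Let [b] be the Brownian motion [s |-> sqrt 2 B (s / 2)] and let [u] be the splice of [m] and
    [b]. A Brownian motion kept above [- e] on [0,1] is, by scaling at time 1/2, a Brownian
    motion kept above [- sqrt 2 e] followed by an independent one kept above a level fixed by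
    the endpoint. By the reflection principle the probability of staying above [- e] is
    Lipschitz in [e] and equivalent to a multiple of [e], so letting [e] tend to 0 yields
    E[H(m)] = sqrt 2 E[H(u); u >= 0]. Next, with G the integral of B over [0,1/2], one inserts
    the Gaussian density sqrt (12 / pi) exp (- 12 (x - G)^2) of total mass 1 in x. The
    Cameron-Martin shift of [b] along 2 s - s^2 turns this weight into exp (- 12 (x + G)^2) and adds x
    to the integral of [u]; the translation c = x + int u (for fixed path) then replaces the
    shifted path by U^c and x + G by c - A, A being the integral that appears in the exponent of
    the formula. *)

(** * Image measures and densities *)

(** The definition of the meander gives limits only for bounded sup-continuous functionals, whereas
    the positivity constraint after time 1/2 is a discontinuous indicator. Averaging that indicator
    over the independent second half makes it continuous, because the survival probability is
    Lipschitz in the level. The functional H is therefore uniformly continuous at first, and a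
    pi-system argument extends the result to all events. The direction [2 s - s^2] is twice the
    covariance of [b] at time [s] with the integral of [b] over [0,1]. A shift along it has a
    density that sees the path only through this integral, which is why a Gaussian kernel in the
    same variable absorbs it. The variance of G is (1/2)^3 / 3 = 1/24, whence the 12, and sqrt 24 =
    sqrt 2 sqrt 12. The Cameron-Martin density itself is the limit of its dyadic versions, which
    summation by parts turns into Riemann sums of the path. The integral over c first runs over all
    reals; a negative c contributes nothing, since a nonnegative path has a nonnegative integral. *)

Section Law.
Context d1 d2 (T1 : measurableType d1) (T2 : measurableType d2) (R : realType).
Variables (mu : {measure set T1 -> \bar R}) (X : T1 -> T2).

(** The measurability proof is an argument so that the measure structure can be attached to the
    term; [dens] takes its hypotheses as arguments for the same reason. *)
Definition law (mX : measurable_fun setT X) : set T2 -> \bar R :=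
  pushforward mu X.

Variable mX : measurable_fun setT X.

Let law0 : law mX set0 = 0%E.
Proof. by rewrite /law /pushforward preimage_set0 measure0. Qed.

Let law_ge0 A : (0 <= law mX A)%E.
Proof. exact: measure_ge0. Qed.

Let law_sigma_additive : semi_sigma_additive (law mX).
Proof.
move=> F mF tF mUF; rewrite /law /pushforward preimage_bigcup.
apply: measure_semi_sigma_additive.
- by move=> n; rewrite -[X in measurable X]setTI; exact: mX.
- apply/trivIsetP => /= i j _ _ ij; rewrite -preimage_setI.
  by move/trivIsetP : tF => /(_ _ _ _ _ ij) ->//; rewrite preimage_set0.
- by rewrite -preimage_bigcup -[X in measurable X]setTI; exact: mX.
Qed.

HB.instance Definition _ := isMeasure.Build _ _ _
  (law mX) law0 law_ge0 law_sigma_additive.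

Lemma ge0_integral_law (f : T2 -> \bar R) : measurable_fun setT f ->
  (forall y, (0 <= f y)%E) ->
  (\int[law mX]_y f y = \int[mu]_x f (X x))%E.
Proof.
by move=> mf f0; rewrite ge0_integral_pushforward// preimage_setT.
Qed.

End Law.

Section Density.
Context d (T : measurableType d) (R : realType).
Variables (mu : {measure set T -> \bar R}) (w : T -> R).

Definition dens (mw : measurable_fun setT w) (w0 : forall x, 0 <= w x) :
  set T -> \bar R := fun A => (\int[mu]_(x in A) (w x)%:E)%E.

Variables (mw : measurable_fun setT w) (w0 : forall x, 0 <= w x).

Let dens0 : dens mw w0 set0 = 0%E.
Proof. by rewrite /dens integral_set0. Qed.

Let dens_ge0 A : (0 <= dens mw w0 A)%E.
Proof. by apply: integral_ge0 => x _; rewrite lee_fin. Qed.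

Let dens_sigma_additive : semi_sigma_additive (dens mw w0).
Proof.
move=> F mF tF mUF; rewrite /dens ge0_integral_bigcup//=.
- by apply: is_cvg_ereal_nneg_natsum_cond => n _ _; exact: dens_ge0.
- by apply: measurable_funTS; exact/measurable_EFinP.
- by move=> x _; rewrite lee_fin.
Qed.

HB.instance Definition _ := isMeasure.Build _ _ _
  (dens mw w0) dens0 dens_ge0 dens_sigma_additive.

Lemma densE A : dens mw w0 A = (\int[mu]_(x in A) (w x)%:E)%E.
Proof. by []. Qed.

Import HBNNSimple.

(** For an indicator this is the definition of [dens]; simple functions follow by linearity and a
    general [f] by monotone convergence. *)
Lemma ge0_integral_dens (f : T -> \bar R) : measurable_fun setT f ->
  (forall x, (0 <= f x)%E) ->
  (\int[dens mw w0]_x f x = \int[mu]_x (f x * (w x)%:E))%E.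
Proof.
move=> mf f0.
have mwE : measurable_fun setT (EFin \o w) by exact/measurable_EFinP.
pose f_ := nnsfun_approx measurableT mf.
have cf x : EFin \o f_ ^~ x @ \oo --> f x.
  by apply: cvg_nnsfun_approx => // *.
transitivity (limn (fun n => \int[dens mw w0]_x (f_ n x)%:E))%E.
  rewrite -monotone_convergence//.
  - by apply: eq_integral => y _; apply/esym/cvg_lim => //; exact: cf.
  - by move=> n; exact/measurable_EFinP/measurable_funP.
  - by move=> n y _; rewrite lee_fin.
  - by move=> y _ m n mn; rewrite lee_fin; exact/lefP/nd_nnsfun_approx.
transitivity (limn (fun n => \int[mu]_x ((f_ n x)%:E * (w x)%:E)))%E; last first.
  rewrite -monotone_convergence//.
  - apply: eq_integral => y _; apply/cvg_lim => //.
    apply: cvgeZr => //; exact: cf.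
  - by move=> n; apply: emeasurable_funM => //; exact/measurable_EFinP/measurable_funP.
  - by move=> n y _; rewrite mule_ge0// lee_fin.
  - move=> y _ m n mn; apply: lee_wpmul2r; first by rewrite lee_fin.
    by rewrite lee_fin; exact/lefP/nd_nnsfun_approx.
congr (limn _); apply/funext => n.
rewrite integralT_nnsfun sintegralE.
rewrite [RHS](_ : _ = \int[mu]_x (\sum_(r \in range (f_ n))
    ((r * \1_(f_ n @^-1` [set r]) x)%:E * (w x)%:E)))%E; last first.
  apply: eq_integral => x _; rewrite {1}(fimfunE (f_ n) x) -fsumEFin//.
  by rewrite ge0_mule_fsuml// => y; exact: nnfun_muleindic_ge0.
rewrite ge0_integral_fsum//; last 2 first.
  - move=> y; apply: emeasurable_funM => //.
    exact/measurable_EFinP/measurable_funM.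
  - by move=> y x _; rewrite mule_ge0 ?lee_fin//; exact: nnfun_muleindic_ge0.
apply: eq_fsbigr => r; rewrite inE => -[x0 _ <-].
have mr : measurable (f_ n @^-1` [set f_ n x0]) by [].
under eq_integral do rewrite EFinM -muleA.
rewrite ge0_integralZl//; last 3 first.
  - apply: emeasurable_funM => //.
    by apply/measurable_EFinP; exact: measurable_indic.
  - by move=> x _; rewrite mule_ge0// lee_fin.
  - by rewrite lee_fin.
congr (_ * _)%E.
rewrite /= /dens [LHS]integral_mkcond.
apply: eq_integral => x _; rewrite patchE indicE.
by case: ifPn => _; rewrite ?mul1e ?mul0e.
Qed.

End Density.

Lemma ge0_le_integral_fin d (T : measurableType d) (R : realType)
    (mu : {measure set T -> \bar R}) (D : set T) (f g : T -> R) :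
  measurable D -> measurable_fun [set: T] f -> (forall x, 0 <= f x) ->
  measurable_fun [set: T] g -> (forall x, D x -> f x <= g x) ->
  (\int[mu]_(x in D) (f x)%:E <= \int[mu]_(x in D) (g x)%:E)%E.
Proof.
move=> mD mf f0 mg fg; apply: ge0_le_integral => //.
- by move=> x _; rewrite lee_fin.
- by apply: measurable_funTS; apply/measurable_EFinP.
- by apply: measurable_funTS; apply/measurable_EFinP.
Qed.

Section BoundedConvergence.
Context d (Om : measurableType d) (R : realType) (P : probability Om R).

Lemma bounded_integrable (D : set Om) (f : Om -> R) (M : R) : measurable D ->
  measurable_fun [set: Om] f -> (forall w, `|f w| <= M) ->
  P.-integrable D (EFin \o f).
Proof.
move=> mD mf fM; apply: measurable_bounded_integrable => //.
- by rewrite (le_lt_trans (probability_le1 P mD))// ltry.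
- exact: measurable_funTS.
- by exists M; split; [exact: num_real|move=> x Mx w _; exact: le_trans (fM w) (ltW Mx)].
Qed.

Lemma bounded_cvg_integral (D : set Om) (f_ : nat -> Om -> R) (f : Om -> R) (M : R) :
  measurable D -> (forall n, measurable_fun [set: Om] (f_ n)) ->
  measurable_fun [set: Om] f -> (forall n w, `|f_ n w| <= M) ->
  (forall w, f_ n w @[n --> \oo] --> f w) ->
  (\int[P]_(w in D) (f_ n w)%:E)%E @[n --> \oo] --> (\int[P]_(w in D) (f w)%:E)%E.
Proof.
move=> mD mf_ mf fM cf.
have [] := @dominated_convergence _ _ _ P D mD (fun n w => (f_ n w)%:E)
  (fun w => (f w)%:E) (cst M%:E).
- by move=> n; apply: measurable_funTS; apply/measurable_EFinP.
- by apply: measurable_funTS; apply/measurable_EFinP.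
- by apply: aeW => w _; apply: cvg_EFin; [exact: nearW|exact: cf].
- exact: (finite_measure_integrable_cst P M).
- by apply: aeW => w n _; rewrite lee_fin.
by [].
Qed.

End BoundedConvergence.

(** * Lebesgue measure and Gaussian laws under affine maps *)

Section Affine.
Context {R : realType}.
Notation leb := (@lebesgue_measure R).
Implicit Types a b c : R.

Lemma measurable_affine a b : measurable_fun [set: R] (fun x => a * x + b).
Proof. by apply: measurable_funD => //; exact: measurable_funM. Qed.

(** By uniqueness of Lebesgue measure, intervals []c, d]] suffice. A negative [a] reverses the
    interval, which moves the closed end but keeps the length. *)
Lemma lebesgue_affine a b (A : set R) : a != 0 -> measurable A ->
  leb A = (`|a|%:E * leb ((fun x => a * x + b)%R @^-1` A))%E.
Proof.
move=> a0 mA.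
have an0 : 0 <= `|a| by [].
pose nu : {measure set (measurableTypeR R) -> \bar R} := mscale (NngNum an0)
  (@law _ _ (measurableTypeR R) (measurableTypeR R) R leb _ (measurable_affine a b)).
rewrite (@lebesgue_measure_unique R nu)//.
move=> X [[c d] /= cd <-{X}].
rewrite /nu /mscale/=.
have [cd0|cd0] := leP d c.
  rewrite set_itv_ge ?preimage_set0 ?measure0 ?mule0//.
  by rewrite bnd_simp -leNgt.
move: a0; rewrite neq_lt => /orP[a0|a0].
- have -> : (fun x => a * x + b)%R @^-1` `]c, d] = `[(d - b) / a, (c - b) / a[%classic.
    apply/seteqP; split => x /=; rewrite !in_itv/= => /andP[h1 h2]; apply/andP; split.
    + by rewrite ler_ndivrMr//; lra.
    + by rewrite ltr_ndivlMr//; lra.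
    + by move: h2; rewrite ltr_ndivlMr//; lra.
    + by move: h1; rewrite ler_ndivrMr//; lra.
  rewrite !lebesgue_measure_itv/= !lte_fin cd0.
  have -> : (d - b) / a < (c - b) / a by rewrite ltr_nM2r ?invr_lt0//; lra.
  rewrite -!EFinB -EFinM; congr EFin; rewrite ltr0_norm//.
  by field; lra.
- have -> : (fun x => a * x + b)%R @^-1` `]c, d] = `](c - b) / a, (d - b) / a]%classic.
    apply/seteqP; split => x /=; rewrite !in_itv/= => /andP[h1 h2]; apply/andP; split.
    + by rewrite ltr_pdivrMr//; lra.
    + by rewrite ler_pdivlMr//; lra.
    + by move: h1; rewrite ltr_pdivrMr//; lra.
    + by move: h2; rewrite ler_pdivlMr//; lra.
  rewrite !lebesgue_measure_itv/= !lte_fin cd0.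
  have -> : (c - b) / a < (d - b) / a by rewrite ltr_pM2r ?invr_gt0//; lra.
  rewrite -!EFinB -EFinM; congr EFin; rewrite gtr0_norm//.
  by field; lra.
Qed.

Lemma ge0_integral_affine a b (f : R -> \bar R) : a != 0 ->
  measurable_fun [set: R] f -> (forall x, (0 <= f x)%E) ->
  (\int[leb]_x f x = `|a|%:E * \int[leb]_x f (a * x + b)%R)%E.
Proof.
move=> a0 mf f0.
have an0 : 0 <= `|a| by [].
pose nu : {measure set (measurableTypeR R) -> \bar R} := mscale (NngNum an0)
  (@law _ _ (measurableTypeR R) (measurableTypeR R) R leb _ (measurable_affine a b)).
transitivity (\int[nu]_x f x)%E.
  apply: eq_measure_integral => A mA _.
  exact: (lebesgue_affine b a0 mA).
rewrite ge0_integral_mscale//= ge0_integral_law//.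
Qed.

End Affine.

Section Normal.
Context {R : realType}.
Notation leb := (@lebesgue_measure R).

Lemma normal_probE (s : R) A : measurable A ->
  normal_prob 0 s A = (\int[leb]_x (normal_pdf 0 s x * \1_A x)%:E)%E.
Proof.
move=> mA; rewrite /normal_prob integral_mkcond; apply: eq_integral => x _.
by rewrite patchE indicE; case: ifPn => _; rewrite ?mulr1 ?mulr0.
Qed.

(** Gives a meaning to the negative scales that [normal_prob_scale] produces from a negative factor:
    the density depends on the square of [s] only. *)
Lemma normal_probN (s : R) : normal_prob 0 (- s) = normal_prob 0 s.
Proof.
apply/funext => A; rewrite /normal_prob; apply: eq_integral => x _.
by rewrite /normal_pdf oppr_eq0 /normal_peak /normal_fun sqrrN.
Qed.

Lemma normal_prob_scale (s a : R) A : s != 0 -> a != 0 -> measurable A ->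
  normal_prob 0 s ((fun x => a * x)%R @^-1` A) = normal_prob 0 (a * s) A.
Proof.
move=> s0 a0 mA.
have mA' : measurable ((fun x => a * x)%R @^-1` A).
  by rewrite -[X in measurable X]setTI; apply: mulrl_measurable.
have mi (B : set R) : measurable B -> measurable_fun [set: R] (\1_B : R -> R).
  by move=> mB; exact: measurable_indic.
rewrite !normal_probE// [RHS](ge0_integral_affine 0 a0)//; last 2 first.
- apply/measurable_EFinP; apply: measurable_funM; first exact: measurable_normal_pdf.
  exact: mi.
- by move=> x; rewrite lee_fin mulr_ge0// normal_pdf_ge0.
rewrite -ge0_integralZl//; last 2 first.
- apply/measurable_EFinP; apply: measurable_funM.
    apply: measurableT_comp; first exact: measurable_normal_pdf.
    exact: measurable_affine.
  apply: measurableT_comp; first exact: mi.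
  exact: measurable_affine.
- by move=> x _; rewrite lee_fin mulr_ge0// normal_pdf_ge0.
apply: eq_integral => x _; rewrite -EFinM; congr EFin.
rewrite addr0 mulrA; congr (_ * _).
rewrite !normal_pdfE ?mulf_neq0// mulrA; congr (_ * _).
  rewrite /normal_peak.
  have -> : (a * s) ^+ 2 * pi *+ 2 = a ^+ 2 * (s ^+ 2 * pi *+ 2) :> R by ring.
  rewrite (sqrtrM (s ^+ 2 * pi *+ 2) (sqr_ge0 a)) sqrtr_sqr.
  by rewrite invfM mulVKf// normr_eq0.
rewrite /normal_fun; congr expR; rewrite !subr0.
by field; rewrite a0 s0.
Qed.

Lemma normal_prob_opp (s : R) (A : set R) : s != 0 -> measurable A ->
  normal_prob 0 s ((fun x => - x) @^-1` A) = normal_prob 0 s A.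
Proof.
move=> s0 mA; have n1 : -1 != 0 :> R by rewrite oppr_eq0 oner_eq0.
rewrite -(normal_probN s) -[in RHS](mulN1r s) normal_probN.
apply: etrans (normal_prob_scale s0 n1 mA).
by congr normal_prob; apply/seteqP; split=> x /=; rewrite mulN1r.
Qed.

Lemma normal_pdf_tilt (h t y : R) : 0 < h ->
  normal_pdf 0 (Num.sqrt h) (y + t * h) * expR (t * (y + t * h) - t ^+ 2 * h / 2) =
  normal_pdf 0 (Num.sqrt h) y.
Proof.
move=> h0; have s0 : Num.sqrt h != 0 by rewrite gt_eqF// sqrtr_gt0.
rewrite !normal_pdfE//= /normal_fun -[LHS]mulrA -expRD; congr (_ * expR _).
rewrite !subr0 sqr_sqrtr ?ltW//; field; lra.
Qed.

(** Cameron-Martin formula for a single increment of variance [h]: completing the square, as in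
    [normal_pdf_tilt], the exponential weight moves the mean from 0 to [t * h], and the argument
    [y - t * h] moves it back. *)
Lemma normal_prob_tilt (h t : R) (A : set R) : 0 < h -> measurable A ->
  (\int[leb]_y (normal_pdf 0 (Num.sqrt h) y * (expR (t * y - t ^+ 2 * h / 2) *
      \1_A (y - t * h)))%:E)%E = normal_prob 0 (Num.sqrt h) A.
Proof.
move=> h0 mA; have s0 : Num.sqrt h != 0 by rewrite gt_eqF// sqrtr_gt0.
rewrite (ge0_integral_affine (t * h) (oner_neq0 _))//; last 2 first.
- rewrite /=; apply/measurable_EFinP; apply: measurable_funM.
    exact: measurable_normal_pdf.
  apply: measurable_funM.
    apply: measurableT_comp; first exact: measurable_expR.
    by apply: measurable_funB => //; exact: measurable_funM.
  apply: measurableT_comp; first exact: measurable_indic.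
  exact: measurable_funB.
- by move=> y; rewrite lee_fin mulr_ge0 ?normal_pdf_ge0// mulr_ge0// expR_ge0.
rewrite normr1 mul1e normal_probE//; apply: eq_integral => y _.
by rewrite mulrA mul1r normal_pdf_tilt// addrK.
Qed.

Lemma ge0_integral_normal_prob (s : R) (f : R -> \bar R) :
  measurable_fun [set: R] f -> (forall x, (0 <= f x)%E) ->
  (\int[normal_prob 0 s]_x f x = \int[leb]_x (f x * (normal_pdf 0 s x)%:E))%E.
Proof.
move=> mf f0.
rewrite -(ge0_integral_dens leb (measurable_normal_pdf 0 s) (normal_pdf_ge0 0 s) mf f0).
by apply: eq_measure_integral.
Qed.

End Normal.

(** * Path space and dyadic increments *)

Section Continuity.
Context {R : realType}.
Implicit Types x y : R -> R.

Lemma within_continuousP (D : set R) x :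
  {within D, continuous x} <->
  (forall t, D t -> forall e, 0 < e -> exists2 dl : R, 0 < dl &
    forall s, D s -> `|t - s| < dl -> `|x t - x s| < e).
Proof.
split.
  move=> /subspace_continuousP cx t t01 e e0.
  have /cvgrPdist_lt /(_ _ e0) := cx t t01.
  rewrite near_withinE => /nbhs_ballP [dl /= dl0 H].
  by exists dl => // s s01 ts; apply: H.
move=> H; apply/subspace_continuousP => t t01.
apply/cvgrPdist_lt => e e0; have [dl dl0 K] := H t t01 e e0.
rewrite near_withinE; apply/nbhs_ballP; exists dl => //= s ts s01.
exact: K.
Qed.

Lemma eq_within_continuous (D : set R) x y : (forall t, D t -> x t = y t) ->
  {within D, continuous x} -> {within D, continuous y}.
Proof.
move=> xy /within_continuousP cx; apply/within_continuousP => t Dt e e0.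
have [dl dl0 K] := cx t Dt e e0; exists dl => // s Ds ts.
by rewrite -!xy//; exact: K.
Qed.

Lemma within_continuous_affine (D D' : set R) (a b : R) x :
  {within D', continuous x} -> (forall t, D t -> D' (a * t + b)) ->
  {within D, continuous (fun t => x (a * t + b))}.
Proof.
move=> /within_continuousP cx DD'; apply/within_continuousP => t Dt e e0.
have [dl dl0 K] := cx _ (DD' t Dt) e e0.
have a1 : 0 < `|a| + 1 by have := normr_ge0 a; lra.
exists (dl / (`|a| + 1)); first exact: divr_gt0.
move=> s Ds ts; apply: K; first exact: DD'.
have -> : a * t + b - (a * s + b) = a * (t - s) by ring.
rewrite normrM (le_lt_trans (y := (`|a| + 1) * `|t - s|))//.
  by rewrite ler_wpM2r//; lra.
by rewrite mulrC -ltr_pdivlMr.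
Qed.

(** Heine-Cantor: continuity gives a suitable [d] near each point, and compactness of the segment,
    in its near-covering form, makes the choice uniform. *)
Lemma unif_continuous_itv (a b : R) (x : R -> R) :
  {within `[a, b], continuous x} ->
  forall e, 0 < e -> exists2 dl : R, 0 < dl &
    forall s t, a <= s <= b -> a <= t <= b -> `|s - t| < dl -> `|x s - x t| < e.
Proof.
move=> /within_continuousP cx e e0.
pose Q d s := forall t, a <= s <= b -> a <= t <= b -> `|s - t| < d ->
  `|x s - x t| < e.
have : \forall d \near 0^'+, `[a, b]%classic `<=` Q d.
  have /compact_near_coveringP := @segment_compact R a b.
  apply => s0 /= s01; have e20 : 0 < e / 2 by lra.
  have [dl dl0 /= K0] := cx s0 s01 _ e20.
  have K s : a <= s <= b -> `|s0 - s| < dl -> `|x s0 - x s| < e / 2.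
    by move=> ?; apply: K0; rewrite in_itv.
  exists (ball s0 (dl / 2), [set d : R | d < dl / 2]).
    split; first by apply: nbhsx_ballx; lra.
    by apply: nbhs_right_lt; lra.
  move=> [s d] /= [s0s ddl] t s01' t01 st.
  have {}s0s : `|s0 - s| < dl / 2 by exact: s0s.
  have d2 : dl / 2 < dl by lra.
  have h1 : `|x s0 - x s| < e / 2 by apply: K => //; exact: lt_trans d2.
  have h2 : `|x s0 - x t| < e / 2.
    apply: K => //; have := ler_distD s s0 t; lra.
  have := ler_distD (x s0) (x s) (x t); rewrite (distrC (x s) (x s0)); lra.
move=> H; have : \forall d \near 0^'+, (0 < d /\ `[a, b]%classic `<=` Q d).
  by near=> d; split=> //; near: d.
move=> /filter_ex [d [d0 K]]; exists d => // s t s01 t01 st.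
by apply: (K s) => //=; rewrite in_itv.
Unshelve. all: end_near. Qed.

End Continuity.

Section PathSpace.
Context {R : realType}.

(** Continuity is not built into the space: [path_borel] then is measurability on [pathT], and
    continuity on [0,1] travels separately as [cont01]. *)
Definition pathT : Type := g_sigma_algebraType (@cyl01 R).
HB.instance Definition _ := Measurable.on pathT.

End PathSpace.
Arguments pathT : clear implicits.

Section PathMeasurable.
Context {R : realType}.

Lemma measurable_ev (t : R) : 0 <= t <= 1 ->
  measurable_fun [set: pathT R] (fun x : pathT R => x t).
Proof.
move=> t01 _ A mA; rewrite setTI; apply: sub_sigma_algebra.
by exists t, A.
Qed.

Lemma measurable_pathP d (Om : measurableType d) (X : Om -> pathT R) :
  (forall t, 0 <= t <= 1 -> measurable_fun [set: Om] (fun w => X w t)) ->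
  measurable_fun [set: Om] X.
Proof.
move=> mX; apply: (@measurability _ _ Om (pathT R) setT X (@cyl01 R)).
  by [].
move=> _ [_ [t [A [t01 [mA ->]]]] <-].
by rewrite setTI; rewrite -[X in measurable X]setTI; exact: mX.
Qed.

Lemma path_borel_measurable (Phi : (R -> R) -> R) :
  path_borel Phi -> measurable_fun [set: pathT R] (Phi : pathT R -> R).
Proof. by move=> bPhi _ B mB; rewrite setTI; exact: bPhi. Qed.

End PathMeasurable.

Section Grid.
Context {R : realType}.
Implicit Types (x : R -> R) (n i j : nat).

Definition gp n i : R := i%:R / 2 ^+ n.

Lemma gp0 n : gp n 0 = 0. Proof. by rewrite /gp mul0r. Qed.

Lemma gpS n i : gp n.+1 i.*2 = gp n i.
Proof.
rewrite /gp -mul2n natrM exprS invfM mulrACA divff ?mul1r//.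
Qed.

Lemma gp_full n : gp n (2 ^ n) = 1.
Proof. by rewrite /gp natrX divff// expf_neq0. Qed.

Lemma gp_lt n i j : (gp n i < gp n j) = (i < j)%N.
Proof. by rewrite /gp ltr_pM2r ?ltr_nat// invr_gt0 exprn_gt0. Qed.

Lemma gp_le n i j : (gp n i <= gp n j) = (i <= j)%N.
Proof. by rewrite leNgt gp_lt -leqNgt. Qed.

Lemma gp01 n i : (i <= 2 ^ n)%N -> 0 <= gp n i <= 1.
Proof. by move=> i2; rewrite -{1}(gp0 n) -(gp_full n) !gp_le. Qed.

Lemma gp_step n i : gp n i.+1 - gp n i = (2 ^+ n)^-1.
Proof. by rewrite /gp -mulrBl -natrB// subSnn mul1r. Qed.

Definition inc n i x : R := x (gp n i.+1) - x (gp n i).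

Definition inc_box n (A : nat -> set R) : set (R -> R) :=
  [set x | forall i, (i < 2 ^ n)%N -> A i (inc n i x)].

Definition Inc n : set (set (R -> R)) :=
  [set S | exists2 A : nat -> set R, (forall i, measurable (A i)) &
    S = inc_box n A].

Lemma inc_boxE n A : inc_box n A = \bigcap_(i in `I_(2 ^ n)) inc n i @^-1` A i.
Proof. by []. Qed.

Lemma measurable_inc n i : (i < 2 ^ n)%N ->
  measurable_fun [set: pathT R] (inc n i : pathT R -> R).
Proof.
move=> i2; apply: measurable_funB; apply: measurable_ev; apply: gp01 => //.
exact: ltnW.
Qed.

Lemma measurable_inc_box n A : (forall i, measurable (A i)) ->
  measurable (inc_box n A : set (pathT R)).
Proof.
move=> mA; rewrite inc_boxE; apply: fin_bigcap_measurable.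
  exact: finite_II.
move=> i i2; rewrite -[X in measurable X]setTI.
exact: (measurable_inc i2).
Qed.

Lemma Inc_setI n : setI_closed (Inc n).
Proof.
move=> _ _ [A mA ->] [A' mA' ->]; exists (fun i => A i `&` A' i).
  by move=> i; exact: measurableI.
apply/seteqP; split=> [x [h h'] i i2|x h].
  by split; [exact: h|exact: h'].
by split=> i i2; have [] := h i i2.
Qed.

Lemma Inc_setT n : Inc n setT.
Proof. by exists (fun=> setT) => //; apply/seteqP; split. Qed.

Lemma measurable_incS n i : (i < 2 ^ n)%N ->
  measurable_fun [set: g_sigma_algebraType (Inc n)] (inc n i).
Proof.
move=> i2 _ A mA; rewrite setTI; apply: sub_sigma_algebra.
exists (fun j => if j == i then A else setT); first by move=> j; case: ifP.
apply/seteqP; split=> [x Ax j j2|x Ax]; first by case: eqP => // ->.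
by have := Ax i i2; rewrite eqxx.
Qed.

Lemma inc_split n i x : inc n i x = inc n.+1 i.*2 x + inc n.+1 i.*2.+1 x.
Proof. by rewrite /inc -doubleS !gpS; ring. Qed.

(** By [inc_split] each increment is the sum of two increments of the next level, hence measurable
    for the finer sigma-algebra. *)
Lemma sub_sigma_Inc n m : (n <= m)%N -> <<s Inc n >> `<=` <<s Inc m >>.
Proof.
elim: m => [|m IH]; first by rewrite leqn0 => /eqP ->.
rewrite leq_eqVlt => /predU1P[->//|/IH nm]; apply: subset_trans nm _.
apply: smallest_sub; first exact: smallest_sigma_algebra.
move=> _ [A mA ->]; rewrite inc_boxE.
rewrite (_ : <<s Inc m.+1 >> = @measurable _ (g_sigma_algebraType (Inc m.+1)))//.
apply: fin_bigcap_measurable; first exact: finite_II.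
move=> i /= i2; rewrite -[X in measurable X]setTI.
rewrite (_ : inc m i = inc m.+1 i.*2 \+ inc m.+1 i.*2.+1); last first.
  by apply/funext => x; exact: inc_split.
have h : (i.*2.+1 < 2 ^ m.+1)%N by rewrite expnS mul2n -doubleS leq_double.
apply: (measurable_funD (measurable_incS (ltnW h)) (measurable_incS h)) => //.
Qed.

Lemma measurable_value_inc n j : (j <= 2 ^ n)%N ->
  measurable_fun [set: g_sigma_algebraType (Inc n)]
    (fun x : R -> R => x (gp n j) - x 0).
Proof.
elim: j => [|j IH] j2.
  rewrite (_ : (fun x : R -> R => x (gp n 0) - x 0) = cst 0)//.
  by apply/funext => x; rewrite gp0 subrr.
rewrite (_ : (fun x : R -> R => x (gp n j.+1) - x 0) =
      (fun x : R -> R => x (gp n j) - x 0) \+ inc n j).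
  by apply: (measurable_funD (IH (ltnW j2)) (measurable_incS j2)).
by apply/funext => x /=; rewrite /inc; ring.
Qed.

(** The least level [n0] is there because some processes have the right increments only on fine
    grids: a path reflected at [gp n k] from level [n] on, a splice from level 1 on. *)
Definition IncU n0 : set (set (R -> R)) := \bigcup_(n in [set n | (n0 <= n)%N]) <<s Inc n >>.

Lemma IncU_setI n0 : setI_closed (IncU n0).
Proof.
move=> A B [n n0n An] [m n0m Bm]; exists (maxn n m) => /=.
  by rewrite leq_max n0n.
apply: (@measurableI _ (g_sigma_algebraType (Inc (maxn n m)))).
  exact: (sub_sigma_Inc (leq_maxl n m)).
exact: (sub_sigma_Inc (leq_maxr n m)).
Qed.

Lemma sub_Inc_measurable n : <<s Inc n >> `<=` @measurable _ (pathT R).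
Proof.
apply: smallest_sub; first exact: sigma_algebra_measurable.
by move=> _ [A mA ->]; exact: measurable_inc_box.
Qed.

Lemma IncU_measurable n0 : IncU n0 `<=` @measurable _ (pathT R).
Proof. by move=> A [n _]; exact: sub_Inc_measurable. Qed.

Lemma IncU_setT n0 : IncU n0 setT.
Proof.
exists n0 => //=; apply: sub_sigma_algebra; exact: Inc_setT.
Qed.

(** Stated for a bare set function [mu], so that it applies to product measures and to measures with
    a density as well as to [P]. *)
Definition grid_law d (Om : measurableType d) (mu : set Om -> \bar R)
    (X : Om -> R -> R) n :=
  forall A : nat -> set R, (forall i, measurable (A i)) ->
    (mu (X @^-1` inc_box n A) =
      \prod_(i < 2 ^ n) normal_prob 0 (Num.sqrt (2 ^+ n)^-1) (A i))%E.

Section EqLaw.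
Context d1 d2 (O1 : measurableType d1) (O2 : measurableType d2).
Variables (mu1 : {measure set O1 -> \bar R}) (mu2 : {measure set O2 -> \bar R}).
Variables (X1 : O1 -> R -> R) (X2 : O2 -> R -> R).
Hypothesis mX1 : measurable_fun [set: O1] (X1 : O1 -> pathT R).
Hypothesis mX2 : measurable_fun [set: O2] (X2 : O2 -> pathT R).

(** Every side of the box is the whole line. For a measure with a density this is how its total mass
    turns out to be 1. *)
Lemma grid_lawT d (Om : measurableType d) (mu : set Om -> \bar R) X n :
  grid_law mu X n -> mu setT = 1%E.
Proof.
move=> /(_ (fun=> setT)); rewrite (_ : inc_box n (fun=> setT) = setT); last first.
  by apply/seteqP; split.
rewrite preimage_setT => -> //.
by rewrite big1// => i _; rewrite probability_setT.
Qed.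

Lemma eq_law_Inc n : grid_law mu1 X1 n -> grid_law mu2 X2 n ->
  forall E, <<s Inc n >> E -> mu1 (X1 @^-1` E) = mu2 (X2 @^-1` E).
Proof.
move=> g1 g2 E sE.
apply: (@g_sigma_algebra_measure_unique _ R (pathT R) (Inc n) _ (fun=> setT) _ _
  (law mu1 mX1) (law mu2 mX2)) => //.
- by apply: subset_trans (@sub_Inc_measurable n); exact: sub_sigma_algebra.
- by move=> _; exact: Inc_setT.
- exact: bigcup_const.
- exact: Inc_setI.
- by move=> _ [A mA ->]; rewrite /= /law /pushforward g1// g2.
- by move=> _; rewrite /= /law /pushforward preimage_setT (grid_lawT g1) ltry.
Qed.

Lemma eq_law_IncU n0 : (forall n, (n0 <= n)%N -> grid_law mu1 X1 n) ->
  (forall n, (n0 <= n)%N -> grid_law mu2 X2 n) ->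
  forall E, <<s IncU n0 >> E -> mu1 (X1 @^-1` E) = mu2 (X2 @^-1` E).
Proof.
move=> g1 g2 E sE.
apply: (@g_sigma_algebra_measure_unique _ R (pathT R) (IncU n0) _ (fun=> setT) _ _
  (law mu1 mX1) (law mu2 mX2)) => //.
- exact: IncU_measurable.
- by move=> _; exact: IncU_setT.
- exact: bigcup_const.
- exact: IncU_setI.
- by move=> A [n n0n An]; rewrite /= /law /pushforward; apply: (eq_law_Inc (g1 n n0n) (g2 n n0n)).
- by move=> _; rewrite /= /law /pushforward preimage_setT (grid_lawT (g1 n0 _))// ltry.
Qed.

End EqLaw.

Lemma near_expV2_lt (e : R) : 0 < e -> \forall n \near \oo, (2 ^+ n)^-1 < e.
Proof.
move=> e0; have h : `|2^-1 : R| < 1 by rewrite ger0_norm; lra.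
have /cvgrPdist_lt /(_ _ e0) := cvg_expr h.
apply: filterS => n; by rewrite sub0r normrN -exprVn ger0_norm.
Qed.

Lemma gp_truncn n (t : R) : 0 <= t <= 1 ->
  (Num.truncn (t * 2 ^+ n) <= 2 ^ n)%N /\
  `|t - gp n (Num.truncn (t * 2 ^+ n))| < (2 ^+ n)^-1.
Proof.
move=> /andP[t0 t1]; have n0 : 0 < 2 ^+ n :> R by rewrite exprn_gt0.
have [h1 h2] : (Num.truncn (t * 2 ^+ n))%:R <= t * 2 ^+ n /\
    t * 2 ^+ n < (Num.truncn (t * 2 ^+ n)).+1%:R.
  by apply/andP; apply: truncn_itv; rewrite mulr_ge0// ltW.
split.
  by rewrite -(ler_nat R) natrX (le_trans h1)// ler_piMl// ltW.
rewrite -(@ltr_pM2r _ (2 ^+ n))// mulVf ?gt_eqF// -{2}(gtr0_norm n0) -normrM.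
rewrite mulrBl /gp divfK ?gt_eqF// ger0_norm ?subr_ge0//.
by rewrite ltrBlDr addrC natr1.
Qed.

Lemma cont01_dyadic (x : R -> R) (t : R) : cont01 x -> 0 <= t <= 1 ->
  x (gp n (Num.truncn (t * 2 ^+ n))) @[n --> \oo] --> x t.
Proof.
move=> cx t01; apply/cvgrPdist_lt => e e0.
have [dl dl0 K] := unif_continuous_itv cx e0.
near=> n; have [h1 h2] := gp_truncn n t01.
apply: K => //; first exact: gp01.
by apply: lt_trans h2 _; near: n; exact: near_expV2_lt.
Unshelve. all: end_near. Qed.

(** The events that agree, on continuous paths from 0, with an event of the dyadic sigma-algebra
    form a sigma-algebra. It contains the evaluations because a value at [t] is the limit of values
    at dyadic times. *)
Lemma cyl01_IncU n0 (E : set (R -> R)) : <<s cyl01 >> E ->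
  exists2 E', <<s IncU n0 >> E' &
    forall x, cont01 x -> x 0 = 0 -> E x <-> E' x.
Proof.
pose C := [set E : set (R -> R) | exists2 E', <<s IncU n0 >> E' &
    forall x, cont01 x -> x 0 = 0 -> E x <-> E' x].
suff : <<s cyl01 >> `<=` C by apply.
pose TI : measurableType _ := g_sigma_algebraType (IncU n0).
apply: smallest_sub.
  split.
  - exists set0 => //; exact: (@measurable0 _ TI).
  - move=> A [A' mA' AA']; exists (~` A').
      exact: (@measurableC _ TI).
    by move=> x cx x0; rewrite setTD /setC /=; have := AA' x cx x0; tauto.
  - move=> A HA.
    have /choice[A' HA'] : forall n, exists E', <<s IncU n0 >> E' /\
        forall x, cont01 x -> x 0 = 0 -> A n x <-> E' x.
      by move=> n; have [E' ? ?] := HA n; exists E'.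
    exists (\bigcup_n A' n).
      by apply: (@bigcupT_measurable _ TI) => n; have [] := HA' n.
    move=> x cx x0; split=> -[n _ An]; exists n => //.
      by have [_ /(_ x cx x0)[h _]] := HA' n; exact: h.
    by have [_ /(_ x cx x0)[_ h]] := HA' n; exact: h.
move=> _ [t [A [t01 [mA ->]]]].
(* Increments only show [x t - x 0], which is the value for a path from 0. The upper limit of these
   is measurable on the whole space, whether or not the sequence converges. *)
pose f (n : nat) (x : TI) : \bar R :=
  (x (gp (n0 + n) (Num.truncn (t * 2 ^+ (n0 + n)))) - x 0)%:E.
have mf n : measurable_fun [set: TI] (f n).
  apply/measurable_EFinP => _ B mB; rewrite setTI; apply: sub_sigma_algebra.
  exists (n0 + n)%N; first exact: leq_addr.
  have [h _] := gp_truncn (n0 + n) t01.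
  by rewrite -[X in _ X]setTI; exact: (measurable_value_inc h).
have mh := measurable_fun_limn_esup mf.
exists ((fun x : TI => limn_esup (f ^~ x)) @^-1` (EFin @` A)).
  rewrite -[X in _ X]setTI; apply: mh => //; exact: measurable_image_EFin.
move=> x cx x0.
have cf : f ^~ x @ \oo --> (x t)%:E.
  apply: cvg_EFin; first by near=> n.
  rewrite /comp /f /= x0; under eq_fun do rewrite subr0.
  have := cont01_dyadic cx t01.
  rewrite -(cvg_shiftn n0); under eq_fun do rewrite addnC.
  exact.
have [_ limE] := cvg_limn_einf_sup cf.
rewrite /preimage /= limE; split=> [Ax|[y Ay [<-//]]].
by exists (x t).
Unshelve. all: end_near. Qed.

(** Uniqueness of Wiener measure on [0,1]: [cyl01_IncU] reduces each event to dyadic increments,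
    where both laws are the same Gaussian product. *)
Lemma eq_law_path n0 d1 d2 (O1 : measurableType d1) (O2 : measurableType d2)
    (mu1 : {measure set O1 -> \bar R}) (mu2 : {measure set O2 -> \bar R})
    (X1 : O1 -> R -> R) (X2 : O2 -> R -> R) :
  measurable_fun [set: O1] (X1 : O1 -> pathT R) ->
  measurable_fun [set: O2] (X2 : O2 -> pathT R) ->
  (forall w, cont01 (X1 w)) -> (forall w, cont01 (X2 w)) ->
  (forall w, X1 w 0 = 0) -> (forall w, X2 w 0 = 0) ->
  (forall n, (n0 <= n)%N -> grid_law mu1 X1 n) ->
  (forall n, (n0 <= n)%N -> grid_law mu2 X2 n) ->
  forall E : set (pathT R), measurable E -> mu1 (X1 @^-1` E) = mu2 (X2 @^-1` E).
Proof.
move=> mX1 mX2 cX1 cX2 X10 X20 g1 g2 E /(@cyl01_IncU n0)[E' sE' EE'].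
rewrite (_ : X1 @^-1` E = X1 @^-1` E').
  rewrite (_ : X2 @^-1` E = X2 @^-1` E').
    exact: (eq_law_IncU mX1 mX2 g1 g2).
  by apply/seteqP; split=> w /=; have [h h'] := EE' _ (cX2 w) (X20 w).
by apply/seteqP; split=> w /=; have [h h'] := EE' _ (cX1 w) (X10 w).
Qed.

End Grid.

(** * Scaling and splicing of Brownian paths *)

Section GridLaws.
Context {R : realType}.

(** Holds because centred Gaussians are symmetric. With the signs flipped from some index on, it is
    reflection at a fixed grid time. *)
Lemma grid_law_sign d (Om : measurableType d) (mu : set Om -> \bar R)
    (X Y : Om -> R -> R) n (sg : nat -> bool) :
  (forall w i, (i < 2 ^ n)%N -> inc n i (Y w) = (-1) ^+ (sg i) * inc n i (X w)) ->
  grid_law mu X n -> grid_law mu Y n.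
Proof.
move=> XY gX A mA.
pose A' i := if sg i then (fun x : R => - x) @^-1` A i else A i.
have mA' i : measurable (A' i).
  rewrite /A'; case: ifP => _ //.
  by rewrite -[X in measurable X]setTI; exact: oppr_measurable.
rewrite (_ : Y @^-1` inc_box n A = X @^-1` inc_box n A'); last first.
  apply/seteqP; split => w /= h i i2; have := h i i2; rewrite (XY w i i2) /A';
    by case: (sg i); rewrite ?expr1 ?expr0 ?mul1r ?mulN1r.
rewrite gX//; apply: eq_bigr => i _; rewrite /A'; case: ifP => _ //.
by rewrite normal_prob_opp// gt_eqF// sqrtr_gt0 invr_gt0 exprn_gt0.
Qed.

Section BM.
Context d (Om : measurableType d) (P : probability Om R).
Variable W : @process R d Om.
Hypothesis BM : is_BM P W.

Definition bm_scale (a : R) (w : Om) : R -> R := fun s => a * W (s / a ^+ 2) w.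

Lemma bm_scale0 a w : bm_scale a w 0 = 0.
Proof. by case: BM => _ W0 _ _; rewrite /bm_scale mul0r W0 mulr0. Qed.

Lemma measurable_bm_scale a : measurable_fun [set: Om] (bm_scale a : Om -> pathT R).
Proof.
case: BM => mW _ _ _; apply: measurable_pathP => t /andP[t0 _].
apply: measurable_funM => //; apply: mW.
by rewrite divr_ge0// sqr_ge0.
Qed.

Lemma cont_bm_scale a w : {within `[0, +oo[, continuous (bm_scale a w)}.
Proof.
case: BM => _ _ cW _.
have h : {within `[0, +oo[, continuous (fun s => traj W w (s / a ^+ 2))}.
  rewrite (_ : (fun s => _) = (fun s => traj W w ((a ^+ 2)^-1 * s + 0))); last first.
    by apply/funext => s; rewrite addr0 mulrC.
  apply: within_continuous_affine (cW w) _ => t /=; rewrite !in_itv/= !andbT => t0.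
  by rewrite addr0 mulr_ge0// invr_ge0 sqr_ge0.
by move=> t; apply: cvgMr; exact: h.
Qed.

Lemma cont01_bm_scale a w : cont01 (bm_scale a w).
Proof.
apply: continuous_subspaceW (@cont_bm_scale a w).
by move=> t /=; rewrite !in_itv/= andbT => /andP[].
Qed.

Lemma grid_law_bm_scale a n : 0 < a -> grid_law P (bm_scale a) n.
Proof.
move=> a0 A mA; case: BM => _ _ _ /(_ (2 ^ n)%N (fun i => gp n i / a ^+ 2)
  (fun i => (fun x : R => a * x) @^-1` A i)) H.
have aa : a != 0 by rewrite gt_eqF.
have a2 : 0 < (a ^+ 2)^-1 by rewrite invr_gt0 exprn_gt0.
have p0 : 0 < 2 ^+ n :> R by rewrite exprn_gt0.
have mA' i : measurable ((fun x : R => a * x) @^-1` A i).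
  by rewrite -[X in measurable X]setTI; apply: mulrl_measurable.
transitivity (P (\bigcap_(i in `I_(2 ^ n)) [set w | ((fun x : R => a * x) @^-1` A i)
    (W (gp n i.+1 / a ^+ 2) w - W (gp n i / a ^+ 2) w)])).
  congr (P _); apply/seteqP; split=> w /= h i i2; have := h i i2;
  by rewrite /= /inc /bm_scale mulrBr.
etransitivity; first apply: H.
- by rewrite gp0 mul0r.
- by move=> i i2; rewrite ltr_pM2r// gp_lt.
- exact: mA'.
apply: eq_bigr => i _; rewrite -mulrBl gp_step.
have s0 : Num.sqrt ((2 ^+ n)^-1 / a ^+ 2) != 0.
  by rewrite gt_eqF// sqrtr_gt0 mulr_gt0// invr_gt0.
rewrite (normal_prob_scale s0 aa (mA i)); congr (normal_prob 0 _ (A i)).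
rewrite -[X in X * _](ger0_norm (ltW a0)) -sqrtr_sqr -sqrtrM ?sqr_ge0//.
by rewrite mulrC divfK// gt_eqF// exprn_gt0.
Qed.

End BM.

(* The factor [(sqrt 2)^-1] is the Brownian scaling that makes the splice of two
   independent Brownian motions a Brownian motion on [0,1]. *)
Definition splice (x y : R -> R) : R -> R := fun t =>
  if t <= 1/2 then (Num.sqrt 2)^-1 * x (2 * t)
  else (Num.sqrt 2)^-1 * x 1 + (Num.sqrt 2)^-1 * y (2 * t - 1).

Lemma spliceE2 x y t : y 0 = 0 -> 1/2 <= t ->
  splice x y t = (Num.sqrt 2)^-1 * x 1 + (Num.sqrt 2)^-1 * y (2 * t - 1).
Proof.
move=> y0; rewrite /splice; case: ifPn => // h1 h2.
have -> : t = 1/2 by apply/eqP; rewrite eq_le h1.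
have -> : 2 * (1/2) = 1 :> R by field.
by rewrite subrr y0 mulr0 addr0.
Qed.

Lemma cont01_splice x y : cont01 x -> cont01 y -> y 0 = 0 -> cont01 (splice x y).
Proof.
move=> cx cy y0.
rewrite /cont01 (_ : `[0, 1]%classic = `[0, 1/2] `|` `[1/2, 1] :> set R); last first.
  apply/seteqP; split=> t /=; rewrite !in_itv/=.
    by have [h|h] := leP t (1/2); [left|right]; lra.
  by case; lra.
apply: withinU_continuous; [exact: interval_closed|exact: interval_closed| |].
- apply: (@eq_within_continuous _ _ (fun t => (Num.sqrt 2)^-1 * x (2 * t + 0))).
    move=> t /=; rewrite in_itv/= => /andP[_ t2].
    by rewrite /splice t2 addr0.
  move=> t; apply: cvgMr; apply: (within_continuous_affine cx).
  by move=> s /=; rewrite !in_itv/=; lra.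
- apply: (@eq_within_continuous _ _ (fun t => (Num.sqrt 2)^-1 * x 1 +
     (Num.sqrt 2)^-1 * y (2 * t + - 1))).
    move=> t /=; rewrite in_itv/= => /andP[t2 _].
    by rewrite spliceE2.
  move=> t; apply: cvgD; first exact: cvg_cst.
  apply: cvgMr; apply: (within_continuous_affine cy).
  by move=> s /=; rewrite !in_itv/=; lra.
Qed.

Lemma gp_half n i : 2 * gp n.+1 i = gp n i :> R.
Proof. by rewrite /gp exprS invfM mulrCA mulVKf. Qed.

Lemma gp_shift n i : 2 * gp n.+1 (2 ^ n + i) - 1 = gp n i :> R.
Proof.
by rewrite gp_half -(gp_full n) /gp natrD mulrDl addrC addKr.
Qed.

Lemma inc_splice1 n i x y : (i < 2 ^ n)%N ->
  inc n.+1 i (splice x y) = (Num.sqrt 2)^-1 * inc n i x.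
Proof.
move=> i2; have h k : (k <= 2 ^ n)%N -> gp n.+1 k <= 1/2 :> R.
  move=> /gp01 => /(_ R); rewrite -gp_half; lra.
by rewrite /inc /splice !h ?(ltnW i2)// !gp_half mulrBr.
Qed.

Lemma inc_splice2 n i x y : y 0 = 0 ->
  inc n.+1 (2 ^ n + i) (splice x y) = (Num.sqrt 2)^-1 * inc n i y.
Proof.
move=> y0; have h k : 1/2 <= gp n.+1 (2 ^ n + k) :> R.
  have := gp_shift n k; have : 0 <= gp n k :> R.
    by rewrite /gp divr_ge0// exprn_ge0.
  lra.
rewrite /inc -addnS !spliceE2// !gp_shift; ring.
Qed.

Lemma prod_half (F : nat -> \bar R) (k m : nat) : k = (m + m)%N ->
  (\prod_(i < k) F i = \prod_(i < m) F i * \prod_(i < m) F (m + i)%N)%E.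
Proof. by move=> ->; rewrite big_split_ord. Qed.

(** The two halves of the grid of level [n.+1] are mapped onto the grid of level [n], so a box of
    increments of the splice is a product of two boxes; the factor [(Num.sqrt 2)^-1] halves the
    variance, as the finer grid demands. *)
Lemma grid_law_splice d1 d2 (O1 : measurableType d1) (O2 : measurableType d2)
    (P1 : probability O1 R) (P2 : probability O2 R)
    (X : O1 -> R -> R) (Y : O2 -> R -> R) n :
  (forall w, Y w 0 = 0) ->
  measurable_fun [set: O1] (X : O1 -> pathT R) ->
  measurable_fun [set: O2] (Y : O2 -> pathT R) ->
  grid_law P1 X n -> grid_law P2 Y n ->
  grid_law (P1 \x P2)%E (fun w => splice (X w.1) (Y w.2)) n.+1.
Proof.
move=> Y0 mX mY gX gY A mA.
pose r : R := (Num.sqrt 2)^-1.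
have r0 : r != 0 by rewrite invr_eq0 gt_eqF// sqrtr_gt0.
pose A' i := (fun x : R => r * x) @^-1` A i.
have mA' i : measurable (A' i).
  by rewrite -[X in measurable X]setTI; apply: mulrl_measurable.
transitivity ((P1 \x P2)%E ((X @^-1` inc_box n A') `*`
    (Y @^-1` inc_box n (fun i => A' (2 ^ n + i)%N)))).
  congr ((P1 \x P2)%E _); apply/seteqP; split=> -[w1 w2] /=.
    move=> h; split=> i i2 /=.
      have /h : (i < 2 ^ n.+1)%N by rewrite expnS mul2n -addnn ltn_addr.
      by rewrite inc_splice1.
    have /h : (2 ^ n + i < 2 ^ n.+1)%N by rewrite expnS mul2n -addnn ltn_add2l.
    by rewrite inc_splice2.
  move=> [h1 h2] i i2; have [ni|ni] := ltnP i (2 ^ n).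
    by rewrite inc_splice1//; exact: h1.
  rewrite -(subnKC ni) inc_splice2//; apply: h2.
  by rewrite ltn_subLR// addnn -mul2n -expnS.
have mB (B : nat -> set R) : (forall i, measurable (B i)) ->
    measurable (X @^-1` inc_box n B) /\ measurable (Y @^-1` inc_box n B).
  move=> mB; split; rewrite -[X in measurable X]setTI.
    by apply: mX => //; exact: measurable_inc_box.
  by apply: mY => //; exact: measurable_inc_box.
rewrite product_measure1E; [|exact: (mB _ mA').1|exact: (mB _ (fun i => mA' _)).2].
etransitivity; first by apply: congr2; [exact: (gX _ mA')|exact: (gY _ (fun i => mA' _))].
have E : (2 ^ n.+1 = 2 ^ n + 2 ^ n)%N by rewrite expnS mul2n -addnn.
have p0 : 0 < 2 ^+ n :> R by rewrite exprn_gt0.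
have s0 : Num.sqrt (2 ^+ n)^-1 != 0 :> R by rewrite gt_eqF// sqrtr_gt0 invr_gt0.
have rE : r * Num.sqrt (2 ^+ n)^-1 = Num.sqrt (2 ^+ n.+1)^-1.
  by rewrite /r -sqrtrV// -sqrtrM ?invr_ge0// -invfM -exprS.
etransitivity; last exact: esym (prod_half
  (fun i => normal_prob 0 (Num.sqrt (2 ^+ n.+1)^-1) (A i)) E).
by apply: congr2; apply: eq_bigr => i _; rewrite (normal_prob_scale s0 r0 (mA _)) rE.
Qed.

End GridLaws.

(** * Reflection principle *)

Section ProbTools.
Context d (Om : measurableType d) (R : realType) (P : probability Om R).
Implicit Types A B : set Om.

Lemma prob_fineK A : measurable A -> (fine (P A))%:E = P A.
Proof. by move=> mA; rewrite fineK// fin_num_measure. Qed.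

Lemma le_prob A B : measurable A -> measurable B -> A `<=` B ->
  fine (P A) <= fine (P B).
Proof. by move=> mA mB AB; rewrite -lee_fin !prob_fineK// le_measure ?inE. Qed.

Lemma prob_setU_le A B : measurable A -> measurable B ->
  fine (P (A `|` B)) <= fine (P A) + fine (P B).
Proof.
move=> mA mB; rewrite -lee_fin EFinD !prob_fineK//; last exact: measurableU.
exact: measureU2.
Qed.

Lemma cvg_prob_nd (F : (set Om)^nat) : (forall i, measurable (F i)) ->
  nondecreasing_seq F -> fine (P (F n)) @[n --> \oo] --> fine (P (\bigcup_n F n)).
Proof.
move=> mF ndF; apply: fine_cvg; rewrite prob_fineK; last exact: bigcupT_measurable.
by apply: nondecreasing_cvg_mu => //; exact: bigcupT_measurable.
Qed.

(** The probability of [F n] is at most that of the union of all later sets, which decreases to the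
    probability of the upper limit of the sets, here empty. *)
Lemma cvg_prob_limsup0 (F : (set Om)^nat) : (forall i, measurable (F i)) ->
  (forall w, \forall n \near \oo, ~ F n w) -> fine (P (F n)) @[n --> \oo] --> 0.
Proof.
move=> mF F0.
have mU n : measurable (\bigcup_(j in [set j | (n <= j)%N]) F j).
  exact: bigcup_measurable.
have h : fine (P (\bigcup_(j in [set j | (n <= j)%N]) F j)) @[n --> \oo] --> 0.
  apply: fine_cvg; rewrite (_ : 0%:E = P (lim_sup_set F)).
    apply: lim_sup_set_cvg => //; rewrite (le_lt_trans (probability_le1 _ _))//.
    by rewrite ltry.
  rewrite (_ : lim_sup_set F = set0) ?measure0//.
  apply/seteqP; split=> // w /= h; have [n _ nF] := F0 w.
  by have [j nj Fj] := h n I; exact: (nF j).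
apply: (squeeze_cvgr _ (cvg_cst 0) h); near=> n.
rewrite fine_ge0//= le_prob//; last by apply: bigcup_sup => /=.
Unshelve. all: end_near. Qed.

End ProbTools.

Section PathBM.
Context {R : realType}.

(** Brownian motion on [0,1] known only through its dyadic increments, which by [eq_law_path]
    determine the law. Leaving [mu] a set function lets a tilted measure qualify. *)
Definition path_bm d (Om : measurableType d) (mu : set Om -> \bar R)
    (X : Om -> R -> R) :=
  [/\ measurable_fun [set: Om] (X : Om -> pathT R),
      (forall w, cont01 (X w)), (forall w, X w 0 = 0) &
      forall n, grid_law mu X n].

Lemma path_bm_scale d (Om : measurableType d) (P : probability Om R)
    (W : @process R d Om) a : is_BM P W -> 0 < a -> path_bm P (bm_scale W a).
Proof.
move=> BM a0; split.
- exact: (measurable_bm_scale BM).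
- exact: (cont01_bm_scale BM).
- exact: (bm_scale0 BM).
- by move=> n; exact: (grid_law_bm_scale BM).
Qed.

Definition below_grid (a : R) n : set (R -> R) :=
  [set x | exists2 k, (k <= 2 ^ n)%N & x (gp n k) < - a].

(* Only dyadic times are tested, which makes the set measurable for [cyl01]; on paths
   continuous on [0,1] it is the event of staying above [- a]. *)
Definition above_dy (a : R) : set (R -> R) := ~` \bigcup_n below_grid a n.

Lemma measurable_below_grid a n : measurable (below_grid a n : set (pathT R)).
Proof.
rewrite (_ : below_grid a n = \bigcup_(k in `I_(2 ^ n).+1)
   (fun x : pathT R => x (gp n k)) @^-1` `]-oo, - a[).
  apply: bigcup_measurable => k /= k2; rewrite -[X in measurable X]setTI.
  by apply: measurable_ev => //; exact: gp01.
apply/seteqP; split=> [x [k k2 xk]|x [k /= k2]]; exists k => //.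
Qed.

Lemma measurable_above_dy a : measurable (above_dy a : set (pathT R)).
Proof.
by apply: measurableC; apply: bigcupT_measurable => n; exact: measurable_below_grid.
Qed.

Lemma above_dyP a (x : R -> R) : cont01 x ->
  above_dy a x <-> (forall t, 0 <= t <= 1 -> - a <= x t).
Proof.
move=> cx; split=> [xa t t01|h [n _ [k k2]]]; last first.
  by rewrite ltNge h// gp01.
rewrite leNgt; apply/negP => xt; apply: xa.
have /cvgrPdist_lt /(_ (- a - x t)) := cont01_dyadic cx t01.
rewrite subr_gt0 => /(_ xt) [n _ /(_ n (leqnn n)) /= H].
have [h _] := gp_truncn n t01.
exists n => //; eexists; first exact: h.
by move: H; rewrite ltr_norml; lra.
Qed.

Lemma below_grid_nd a : nondecreasing_seq (below_grid a).
Proof.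
apply/nondecreasing_seqP => n; apply/subsetPset => x [k k2 xk].
exists k.*2; first by rewrite expnS mul2n leq_double.
by rewrite gpS.
Qed.

Definition reflect_path (s : R) (x : R -> R) : R -> R := fun t =>
  if t <= s then x t else 2 * x s - x t.

Lemma reflect_pathE2 s x t : s <= t -> reflect_path s x t = 2 * x s - x t.
Proof.
move=> st; rewrite /reflect_path; case: ifPn => // ts.
have -> : t = s by apply/eqP; rewrite eq_le ts.
ring.
Qed.

Lemma cont01_reflect_path s x : 0 <= s <= 1 -> cont01 x ->
  cont01 (reflect_path s x).
Proof.
move=> s01 cx.
rewrite /cont01 (_ : `[0, 1]%classic = `[0, s] `|` `[s, 1] :> set R); last first.
  apply/seteqP; split=> t /=; rewrite !in_itv/=.
    by have [h|h] := leP t s; [left|right]; lra.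
  by case; lra.
have c1 (D : set R) : D `<=` `[0, 1] -> {within D, continuous x}.
  by move=> D01; exact: continuous_subspaceW cx.
apply: withinU_continuous; [exact: interval_closed|exact: interval_closed| |].
- apply: (@eq_within_continuous _ _ x).
    by move=> t /=; rewrite in_itv/= /reflect_path => /andP[_ ->].
  by apply: c1 => t /=; rewrite !in_itv/=; lra.
- apply: (@eq_within_continuous _ _ (fun t => 2 * x s - x t)).
    by move=> t /=; rewrite in_itv/= => /andP[? _]; rewrite reflect_pathE2.
  have cx1 : {within `[s, 1], continuous x}.
    by apply: c1 => t /=; rewrite !in_itv/=; lra.
  by move=> t; apply: cvgB; [exact: cvg_cst|exact: cx1].
Qed.

Lemma gp_refine n m k : (n <= m)%N -> gp m (k * 2 ^ (m - n)) = gp n k :> R.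
Proof.
move=> nm; rewrite /gp natrM natrX -[in 2 ^+ m](subnKC nm) exprD.
by rewrite invfM mulrACA divff ?mulr1// expf_neq0.
Qed.

Section Reflection.
Context d (Om : measurableType d) (P : probability Om R).
Variable X : Om -> R -> R.
Hypothesis bmX : path_bm P X.

Let mX : measurable_fun [set: Om] (X : Om -> pathT R). Proof. by case: bmX. Qed.
Let cX w : cont01 (X w). Proof. by case: bmX. Qed.
Let X0 w : X w 0 = 0. Proof. by case: bmX. Qed.

Let pr (E : set (pathT R)) : R := fine (P (X @^-1` E)).

Let mpre (E : set (pathT R)) : measurable E -> measurable (X @^-1` E).
Proof. by move=> mE; rewrite -[X in measurable X]setTI; exact: mX. Qed.

Let mreflect n k : (k <= 2 ^ n)%N ->
  measurable_fun [set: Om] ((fun w => reflect_path (gp n k) (X w)) : Om -> pathT R).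
Proof.
move=> k2; have s01 : 0 <= (gp n k : R) <= 1 by exact: gp01.
apply: measurable_pathP => t t01; rewrite /reflect_path.
have mXt u : 0 <= u <= 1 -> measurable_fun [set: Om] (fun w => X w u).
  by move=> u01; exact: (measurableT_comp (measurable_ev u01) mX).
have [ts|ts] := boolP (t <= gp n k); first exact: mXt.
by apply: measurable_funB; [apply: measurable_funM => //; exact: mXt|exact: mXt].
Qed.

Let mreflect_pre n k (E : set (pathT R)) : (k <= 2 ^ n)%N -> measurable E ->
  measurable ((fun w => reflect_path (gp n k) (X w)) @^-1` E).
Proof.
by move=> k2 mE; rewrite -[X in measurable X]setTI; exact: mreflect.
Qed.

(** On every grid finer than level [n] the reflection time is again a grid point, so reflecting
    flips the signs of all increments from there on and [grid_law_sign] applies. *)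
Lemma reflect_path_law n k (E : set (pathT R)) : (k <= 2 ^ n)%N -> measurable E ->
  P (X @^-1` E) = P ((fun w => reflect_path (gp n k) (X w)) @^-1` E).
Proof.
move=> k2 mE.
have s01 : 0 <= (gp n k : R) <= 1 by exact: gp01.
apply: (@eq_law_path _ n _ _ _ _ P P X (fun w => reflect_path (gp n k) (X w)) mX) => //.
- exact: mreflect.
- by move=> w; exact: cont01_reflect_path.
- move=> w; rewrite /reflect_path; case: ifPn; first by rewrite X0.
  by move: s01; lra.
- by move=> m _; case: bmX.
- move=> m nm; apply: (@grid_law_sign _ _ _ _ X _ _ (fun i => (k * 2 ^ (m - n) <= i)%N)).
    move=> w i i2; rewrite /inc -(gp_refine k nm).
    case: leqP => ki; last by rewrite /reflect_path !gp_le ki (ltnW ki) expr0 mul1r.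
    by rewrite !reflect_pathE2 ?gp_le ?(leqW ki)// expr1; ring.
  by case: bmX.
Qed.

(** First passage below [- a] at grid index [k]. It is decided by times up to [gp n k], so
    reflection at that time does not change it. *)
Let fp (a : R) n k : set (pathT R) :=
  [set x | (forall j, (j < k)%N -> - a <= x (gp n j)) /\ x (gp n k) < - a].

Let mfp a n k : (k <= 2 ^ n)%N -> measurable (fp a n k).
Proof.
move=> k2.
rewrite (_ : fp a n k = (\bigcap_(j in `I_k)
   (fun x : pathT R => x (gp n j)) @^-1` `[- a, +oo[) `&`
   (fun x : pathT R => x (gp n k)) @^-1` `]-oo, - a[); last first.
  apply/seteqP; split=> x /= [h1 h2]; split.
  - by move=> j jk; rewrite /= in_itv/= andbT; exact: h1.
  - by rewrite /= in_itv.
  - by move=> j jk; have := h1 j jk; rewrite /= in_itv/= andbT.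
  - by move: h2; rewrite /= in_itv.
have mg j : (j <= k)%N -> measurable_fun [set: pathT R] (fun x : pathT R => x (gp n j)).
  by move=> jk; apply: measurable_ev; apply: gp01; exact: leq_trans k2.
apply: measurableI.
  apply: fin_bigcap_measurable; first exact: finite_II.
  move=> j /= jk; rewrite -[X in measurable X]setTI.
  by apply: mg => //; exact: ltnW.
rewrite -[X in measurable X]setTI.
by apply: mg.
Qed.

Let fp_sum a n (D : set (pathT R)) : measurable D ->
  pr (below_grid a n `&` D) = \sum_(k < (2 ^ n).+1) pr (fp a n k `&` D).
Proof.
move=> mD; rewrite /pr.
have -> : X @^-1` (below_grid a n `&` D) = \big[setU/set0]_(k < (2 ^ n).+1)
    (X @^-1` (fp a n k `&` D)).
  rewrite -(bigcup_mkord _ (fun k => X @^-1` (fp a n k `&` D))).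
  apply/seteqP; split=> w /=.
    move=> [[k k2 xk] Dw].
    have ex : exists k, (k <= 2 ^ n)%N && (X w (gp n k) < - a).
      by exists k; rewrite k2.
    have [k' /andP[k'2 xk'] mink'] := ex_minnP ex.
    exists k' => //=; split=> //; split=> // j jk'.
    rewrite leNgt; apply/negP => xj; have /mink' : (j <= 2 ^ n)%N && (X w (gp n j) < - a).
      by rewrite xj (leq_trans (ltnW jk')).
    by rewrite leqNgt jk'.
  by move=> [k /= k2 [[_ xk] Dw]]; split=> //; exists k.
have mF (k : 'I_(2 ^ n).+1) : measurable (X @^-1` (fp a n k `&` D)).
  by apply: mpre; apply: measurableI => //; apply: mfp; rewrite -ltnS.
apply/EFin_inj; rewrite prob_fineK; last exact: bigsetU_measurable.
rewrite measure_bigsetU_ord//.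
  by rewrite -sumEFin; apply: eq_bigr => k _; rewrite prob_fineK.
have tri k j : (k < j)%N -> fp a n k `&` fp a n j = set0.
  move=> kj; apply/seteqP; split=> // x [[_ h1] [/(_ _ kj) h2 _]].
  by move: h2; rewrite leNgt h1.
apply/trivIsetP => k j _ _ kj /=.
apply/seteqP; split=> // w /= [[h1 _] [h2 _]].
move: kj; rewrite neq_ltn => /orP[kj|kj].
  by have : set0 (X w) by rewrite -(tri _ _ kj).
by have : set0 (X w) by rewrite -(tri _ _ kj).
Qed.

Let le_pr (E F : set (pathT R)) : measurable E -> measurable F ->
  (forall w, E (X w) -> F (X w)) -> pr E <= pr F.
Proof.
by move=> mE mF EF; apply: le_prob; [exact: mpre|exact: mpre|exact: EF].
Qed.

Let measurable_one (i : interval R) :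
  measurable ([set x | x 1 \in i] : set (pathT R)).
Proof.
have t1 : 0 <= (1 : R) <= 1 by rewrite lexx ler01.
by have := measurable_ev t1 measurableT (measurable_itv i); rewrite setTI.
Qed.

Let D a : set (pathT R) := [set x | x 1 < - a].
Let mD a : measurable (D a).
Proof.
have := measurable_one `]-oo, (- a)[; congr measurable.
Qed.

Let reflect_fp a n k x : (k <= 2 ^ n)%N ->
  fp a n k (reflect_path (gp n k) x) -> fp a n k x.
Proof.
move=> k2 [h1 h2]; split=> [j jk|].
  by have := h1 j jk; rewrite /reflect_path gp_le (ltnW jk).
by move: h2; rewrite /reflect_path lexx.
Qed.

Let prD a (E : set (pathT R)) : measurable E ->
  pr E = pr (E `&` D a) + pr (E `&` ~` D a).
Proof.
move=> mE; apply/EFin_inj; rewrite EFinD /pr !prob_fineK; last 3 first.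
- by apply: mpre; apply: measurableI => //; apply: measurableC; exact: mD.
- by apply: mpre; apply: measurableI => //; exact: mD.
- exact: mpre.
rewrite (measureDI P (mpre mE) (mpre (mD a))) addeC; congr (_ + _)%E.
Qed.

(** At a first passage the path is below [- a], so reflecting there a path that ends at or above
    [- a] gives one that ends below. Hence the paths that cross and come back are at most as likely
    as those that end below. *)
Let below_upper a n : pr (below_grid a n) <= 2 * pr (D a).
Proof.
have mB := measurable_below_grid a n.
rewrite (prD a mB).
have h1 : pr (below_grid a n `&` ~` D a) <= pr (below_grid a n `&` D a).
  rewrite !fp_sum//; [|exact: measurableC].
  apply: ler_sum => k _; have k2 : (k <= 2 ^ n)%N by rewrite -ltnS.
  rewrite /pr (reflect_path_law k2); last first.
    by apply: measurableI; [exact: mfp|exact: measurableC].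
  have mE : measurable (fp a n k `&` D a) by apply: measurableI; [exact: mfp|].
  have s1 : gp n k <= 1 :> R by case/andP: (gp01 (R := R) k2).
  apply: le_prob; [|exact: mpre|].
    by apply: mreflect_pre => //; apply: measurableI; [exact: mfp|exact: measurableC].
  move=> w /= [/(reflect_fp k2) h]; rewrite /D /= reflect_pathE2// => h'.
  split=> //=; case: h => _ h; move/negP : h'; rewrite -leNgt; lra.
have h2 : pr (below_grid a n `&` D a) <= pr (D a).
  by apply: le_pr => //; [exact: measurableI|move=> w []].
lra.
Qed.

(** A downward grid step larger than [e]. Outside this event, first passage in discrete time
    overshoots [- a] by at most [e]. *)
Let osc e n : set (pathT R) := [set x | exists2 k, (k < 2 ^ n)%N & inc n k x < - e].

Let mosc e n : measurable (osc e n).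
Proof.
rewrite (_ : osc e n = \bigcup_(k in `I_(2 ^ n)) inc n k @^-1` `]-oo, (- e)[); last first.
  by apply/seteqP; split=> x [k /= k2 xk]; exists k => //; move: xk; rewrite /= in_itv.
apply: bigcup_measurable => k /= k2; rewrite -[X in measurable X]setTI.
exact: (measurable_inc k2).
Qed.

(** The reverse reflection has to allow for the overshoot: a passage value of at least [- a - e] and
    an end below [- a - 2 e] reflect to an end above [- a], which is where [2 * e] comes from. *)
Let below_lower a n e : 0 <= a -> 0 < e ->
  pr (D (a + 2 * e)) + pr (D a) <= pr (below_grid a n) + pr (osc e n).
Proof.
move=> a0 e0; have mB := measurable_below_grid a n.
have mO := mosc e n.
pose D2 := D (a + 2 * e) `&` ~` osc e n.
have mD2 : measurable D2 by apply: measurableI => //; exact: measurableC.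
have h0 : pr (D (a + 2 * e)) <= pr (below_grid a n `&` D2) + pr (osc e n).
  apply: le_trans (prob_setU_le _ _ _); [|exact/mpre/measurableI|exact: mpre].
  apply: le_prob; [exact: mpre|apply: measurableU; [exact/mpre/measurableI|exact: mpre]|].
  move=> w /= Dw; have [ow|ow] := pselect (osc e n (X w)); [by right|left].
  split=> //=; exists (2 ^ n)%N => //; rewrite gp_full.
  by apply: lt_trans Dw _; lra.
have h1 : pr (below_grid a n `&` D2) <= pr (below_grid a n `&` ~` D a).
  rewrite !fp_sum//; [|exact: measurableC].
  apply: ler_sum => k _; have k2 : (k <= 2 ^ n)%N by rewrite -ltnS.
  have k01 := gp01 (R := R) k2; have s1 : gp n k <= 1 :> R by case/andP: k01.
  pose D3 : set (pathT R) := D (a + 2 * e) `&` [set x | - a - e <= x (gp n k)].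
  have mD3 : measurable D3.
    apply: measurableI => //.
    have := measurable_ev k01 measurableT (measurable_itv `[(- a - e), +oo[).
    rewrite setTI; congr measurable.
    by apply/seteqP; split=> x /=; rewrite in_itv/= andbT.
  have mE : measurable (fp a n k `&` D3) by apply: measurableI => //; exact: mfp.
  have mE' : measurable (fp a n k `&` ~` D a).
    by apply: measurableI; [exact: mfp|exact: measurableC].
  apply: (@le_trans _ _ (pr (fp a n k `&` D3))).
    apply: le_pr => //; first by apply: measurableI => //; exact: mfp.
    move=> w [fw [Dw ow]]; split=> //; split=> //=.
    (* At index 0 the bound holds since the path starts at 0 and [a] is nonnegative; otherwise the
       previous grid value is at least [- a] and the last step loses at most [e]. *)
    have [k0|k0] := posnP k; first by rewrite k0 gp0 X0; lra.
    have [h _] := fw; have km : (k.-1 < k)%N by rewrite prednK.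
    have := h _ km; have : - e <= inc n k.-1 (X w).
      rewrite leNgt; apply/negP => h'; apply: ow; exists k.-1 => //.
      exact: leq_trans k2.
    by rewrite /inc prednK//; lra.
  rewrite /pr (reflect_path_law k2 mE); apply: le_prob; [|exact: mpre|].
    exact: mreflect_pre.
  move=> w /= [/(reflect_fp k2) h [h' h'']]; split=> //=; apply/negP; rewrite -leNgt.
  move: h' h''; rewrite /D /= reflect_pathE2// /reflect_path lexx; lra.
have := prD a mB.
have -> : pr (below_grid a n `&` D a) = pr (D a).
  congr (fine (P _)); apply/seteqP; split=> w /=; first by case.
  by move=> Dw; split=> //; exists (2 ^ n)%N => //; rewrite gp_full.
lra.
Qed.

(** The grid is refined first: uniform continuity of each path makes [osc] negligible. Then [e]
    tends to 0. *)
Lemma reflection_principle a : 0 <= a ->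
  fine (P (X @^-1` (\bigcup_n below_grid a n))) = 2 * fine (P [set w | X w 1 < - a]).
Proof.
move=> a0; pose r := fine (P (X @^-1` (\bigcup_n below_grid a n))).
have cr : pr (below_grid a n) @[n --> \oo] --> r.
  rewrite /r preimage_bigcup; apply: cvg_prob_nd.
    by move=> n; apply: mpre; exact: measurable_below_grid.
  move=> n m nm; apply/subsetPset => w /=.
  by have /subsetPset := below_grid_nd a nm; apply.
apply/eqP; rewrite eq_le; apply/andP; split.
  by apply: (cvgr_to_le cr); near=> n; exact: below_upper.
have h e : 0 < e -> pr (D (a + 2 * e)) + pr (D a) <= r.
  move=> e0.
  have co : pr (osc e n) @[n --> \oo] --> 0.
    apply: cvg_prob_limsup0; first by move=> n; exact: mpre.
    move=> w; have [dl dl0 K] := unif_continuous_itv (@cX w) e0.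
    near=> n; move=> [k k2]; rewrite /inc.
    have : `|X w (gp n k.+1) - X w (gp n k)| < e.
      apply: K; [exact: gp01|apply: gp01; exact: ltnW|].
      rewrite gp_step ger0_norm ?invr_ge0 ?exprn_ge0//.
      by near: n; exact: near_expV2_lt.
    by rewrite ltr_norml; lra.
  have cro : pr (below_grid a n) + pr (osc e n) @[n --> \oo] --> r.
    by rewrite -[r]addr0; exact: cvgD cr co.
  apply: (cvgr_to_ge cro); near=> n; exact: below_lower.
(* The strict inequality in [D] makes [D a] the increasing union of these events, so continuity from
   below is enough. *)
have cD : pr (D (a + 2 * n.+1%:R^-1)) @[n --> \oo] --> pr (D a).
  have -> : D a = \bigcup_n D (a + 2 * n.+1%:R^-1).
    apply/seteqP; split=> x; rewrite /D /=; last first.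
      move=> [n _] /lt_trans; apply.
      have : 0 < n.+1%:R^-1 :> R by rewrite invr_gt0.
      by move: (n.+1%:R^-1) => v; lra.
    move=> xa; have h0 : 0 < (- a - x 1) / 2 by lra.
    have [n _ /(_ n (leqnn n)) /= hn] := near_infty_natSinv_lt (PosNum h0).
    have {}hn : n.+1%:R^-1 < (- a - x 1) / 2 by exact: hn.
    by exists n => //=; move: hn; move: (n.+1%:R^-1) => v; lra.
  rewrite /pr preimage_bigcup; apply: cvg_prob_nd; first by move=> n; exact: mpre.
  move=> n m nm; apply/subsetPset => w; rewrite /D /= => /lt_le_trans; apply.
  have : m.+1%:R^-1 <= n.+1%:R^-1 :> R by rewrite lef_pV2 ?posrE// ler_nat.
  by move: (n.+1%:R^-1) (m.+1%:R^-1) => v v'; lra.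
have cD2 : pr (D (a + 2 * n.+1%:R^-1)) + pr (D a) @[n --> \oo] --> pr (D a) + pr (D a).
  by apply: cvgD => //; exact: cvg_cst.
have -> : 2 * fine (P [set w | X w 1 < - a]) = pr (D a) + pr (D a).
  by rewrite mulr_natl mulr2n.
by apply: (cvgr_to_le cD2); near=> n; apply: h; rewrite invr_gt0.
Unshelve. all: end_near. Qed.

End Reflection.

End PathBM.

(** * Probability that Brownian motion stays above a level *)

Section Survival.
Context {R : realType}.
Notation leb := (@lebesgue_measure R).
Notation N01 := (@normal_prob R 0 1).

(** By [path_bm_survival], the probability that a Brownian motion stays above [- a] on [0,1]; it
    vanishes for negative [a] because the path starts at 0. *)
Definition survival (a : R) : R :=
  if 0 <= a then 1 - 2 * fine (N01 `]-oo, (- a)[) else 0.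

Lemma path_bm_one d (Om : measurableType d) (mu : set Om -> \bar R) X (A : set R) :
  path_bm mu X -> measurable A -> mu [set w | A (X w 1)] = N01 A.
Proof.
move=> [_ _ X0 gX] mA; have := gX 0%N (fun=> A) (fun=> mA).
rewrite expn0 big_ord1 expr0 invr1 sqrtr1 => <-; congr (mu _).
apply/seteqP; split=> w /=.
  move=> Aw i; rewrite ltnS leqn0 => /eqP ->.
  by rewrite /inc gp0 X0 subr0 /gp expr0 divr1.
by move=> /(_ 0%N isT); rewrite /inc gp0 X0 subr0 /gp expr0 divr1.
Qed.

Lemma path_bm_survival d (Om : measurableType d) (P : probability Om R) X (a : R) :
  path_bm P X -> fine (P (X @^-1` above_dy a)) = survival a.
Proof.
move=> bX; have [mX cX X0 gX] := bX.
rewrite /survival; case: ifPn => [a0|].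
  have mU : measurable (X @^-1` \bigcup_n below_grid a n).
    rewrite -[X in measurable X]setTI; apply: mX => //.
    by apply: bigcupT_measurable => n; exact: measurable_below_grid.
  rewrite /above_dy preimage_setC probability_setC//.
  have := reflection_principle bX a0.
  rewrite (_ : [set w | X w 1 < - a] = [set w | `]-oo, (- a)[%classic (X w 1)]); last first.
    by apply/seteqP; split=> w /=; rewrite in_itv.
  rewrite (path_bm_one bX)// => <-.
  by rewrite fineB// fin_num_measure.
rewrite -ltNge => a0; rewrite (_ : X @^-1` _ = set0) ?measure0//.
apply/seteqP; split=> // w /(above_dyP _ (@cX w)) /(_ 0); rewrite X0; lra.
Qed.

Lemma normal_itv_bounds (a b : R) : 0 <= a -> a <= b ->
  normal_peak 1 * expR (- b ^+ 2 / 2) * (b - a) <= fine (N01 `[(- b), (- a)[) /\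
  fine (N01 `[(- b), (- a)[) <= normal_peak 1 * (b - a).
Proof.
move=> a0 ab.
have pdfE x : normal_pdf 0 1 x = normal_peak 1 * expR (- x ^+ 2 / 2) :> R.
  by rewrite normal_pdfE//= /normal_fun subr0 expr1n.
have lE : leb `[(- b), (- a)[ = (b - a)%:E.
  rewrite lebesgue_measure_itv/= lte_fin; case: ifPn => [_|].
    by rewrite -EFinB opprK addrC.
  rewrite -leNgt => ba; have -> : b = a by lra.
  by rewrite subrr.
have h0 := normal_peak_ge0 (1 : R).
have mpdf : measurable_fun (`[(- b), (- a)[ : set R) (fun x => (normal_pdf 0 1 x)%:E).
  by apply: measurable_funTS; apply/measurable_EFinP; exact: measurable_normal_pdf.
split; rewrite -lee_fin prob_fineK// EFinM -lE.
- rewrite -integral_cst//; apply: ge0_le_integral => //=.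
    by move=> x _; rewrite lee_fin mulr_ge0// expR_ge0.
  move=> x; rewrite in_itv/= => /andP[x1 x2]; rewrite lee_fin pdfE.
  by rewrite ler_wpM2l// ler_expR ler_pM2r ?invr_gt0// lerN2; nra.
- rewrite -integral_cst//; apply: ge0_le_integral => //=.
    by move=> x _; rewrite lee_fin normal_pdf_ge0.
  move=> x _; rewrite lee_fin pdfE -[leRHS]mulr1 ler_wpM2l//.
  by rewrite -[leRHS]expR0 ler_expR; have := sqr_ge0 x; lra.
Qed.

Lemma survivalD (a b : R) : 0 <= a -> a <= b ->
  survival b - survival a = 2 * fine (N01 `[(- b), (- a)[).
Proof.
move=> a0 ab; rewrite /survival a0 (le_trans a0 ab).
have -> : fine (N01 `]-oo, (- a)[) =
    fine (N01 `]-oo, (- b)[) + fine (N01 `[(- b), (- a)[).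
  apply/EFin_inj; rewrite EFinD !prob_fineK//.
  rewrite -measureU//; first by rewrite -itv_bndbnd_setU// bnd_simp; lra.
  apply/seteqP; split=> // x [] /=; rewrite !in_itv/=; lra.
ring.
Qed.

(** The two open half-lines have equal mass by symmetry and the point 0 has none. This rules out a
    jump of [survival] at 0. *)
Lemma survival0 : survival 0 = 0.
Proof.
rewrite /survival lexx oppr0.
have h : N01 `]-oo, 0[ = N01 `]0, +oo[.
  rewrite -(normal_prob_opp (oner_neq0 _))//; congr (N01 _).
  by apply/seteqP; split=> x /=; rewrite !in_itv/= andbT; lra.
have h1 : N01 [set 0] = 0%E.
  by rewrite /normal_prob integral_set1.
have : (N01 setT = N01 `]-oo, 0%R[ + N01 `]0%R, +oo[)%E.
  have -> : [set: R] = (`]-oo, 0[ `|` [set 0]) `|` `]0, +oo[.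
    apply/seteqP; split=> // x _ /=; rewrite !in_itv/= andbT.
    by have [h'|h'|->] := ltgtP x 0; [left; left|right|left; right].
  rewrite measureU//=; last 2 first.
  - by apply: measurableU.
  - apply/seteqP; split=> // x [[]] /=; rewrite !in_itv/= ?andbT; lra.
  rewrite measureU//=; last first.
    apply/seteqP; split=> // x [] /=; rewrite !in_itv/=; lra.
  by rewrite h1 adde0.
rewrite probability_setT -h => /(congr1 fine).
rewrite fineD ?fin_num_measure//=; lra.
Qed.

(** The right derivative of [survival] at 0: twice the standard Gaussian density there, which is
    also its largest slope. *)
Let L : R := 2 * normal_peak 1.

Lemma survival_lip (a b : R) : a <= b ->
  0 <= survival b - survival a <= L * (b - a).
Proof.
have p0 := normal_peak_ge0 (1 : R).
have h a' b' : 0 <= a' -> a' <= b' -> 0 <= survival b' - survival a' <= L * (b' - a').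
  move=> a0 ab; rewrite survivalD// /L; have [_ h2] := normal_itv_bounds a0 ab.
  by have := fine_ge0 (measure_ge0 N01 `[(- b'), (- a')[); lra.
move=> ab; have [a0|a0] := leP 0 a; first exact: h.
have Ea : survival a = 0 by rewrite /survival leNgt a0.
have [b0|b0] := leP 0 b; last first.
  have -> : survival b = 0 by rewrite /survival leNgt b0.
  by rewrite Ea subrr lexx/= /L mulr_ge0//; lra.
have := h 0 b (lexx _) b0; rewrite survival0 Ea !subr0 => /andP[-> /=].
by move=> /le_trans; apply; rewrite /L ler_wpM2l//; lra.
Qed.

Lemma survival_bounds (a : R) : 0 <= a ->
  L * expR (- a ^+ 2 / 2) * a <= survival a <= L * a.
Proof.
move=> a0; have := survivalD (lexx 0) a0; rewrite survival0 !subr0 => ->.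
have := normal_itv_bounds (lexx 0) a0; rewrite subr0 /L; lra.
Qed.

Lemma survival_gt0 (a : R) : 0 < a -> 0 < survival a.
Proof.
move=> a0; have /andP[h _] := survival_bounds (ltW a0); apply: lt_le_trans h.
by rewrite !mulr_gt0// ?expR_gt0// normal_peak_gt0.
Qed.

(** By [survival_bounds], [survival e] is [L * e] up to a factor between [expR (- e ^+ 2 / 2)] and
    1. With [c] equal to the inverse of sqrt 2 this limit is the source of the factor sqrt 2 in the
    decomposition of the meander. *)
Lemma survival_ratio (c : R) : 0 < c ->
  survival (c * e) / survival e @[e --> 0^'+] --> c.
Proof.
move=> c0.
have L0 : 0 < L by rewrite /L mulr_gt0// normal_peak_gt0.
have e1 k : (expR (k * e ^+ 2) : R) @[e --> (0:R)^'+] --> (1 : R).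
  suff h : (expR (k * e ^+ 2) : R) @[e --> (0 : R)] --> expR (k * 0 ^+ 2).
    by apply: cvg_at_right_filter; move: h; rewrite expr0n mulr0 expR0.
  apply: (cvg_comp (fun e => k * e ^+ 2) expR); last exact: continuous_expR.
  by apply: cvgMr; exact: exprn_continuous.
have l1 : c * expR (- c ^+ 2 / 2 * e ^+ 2) @[e --> (0:R)^'+] --> c.
  by rewrite -[X in _ @[_ --> _] --> X]mulr1; apply: cvgMr; exact: e1.
have l2 : c * expR (1 / 2 * e ^+ 2) @[e --> (0:R)^'+] --> c.
  by rewrite -[X in _ @[_ --> _] --> X]mulr1; apply: cvgMr; exact: e1.
apply: (squeeze_cvgr _ l1 l2); near=> e.
have e0 : 0 < e by near: e; exact: nbhs_right_gt.
have ce0 : 0 < c * e by exact: mulr_gt0.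
have /andP[h1 h2] := survival_bounds (ltW e0).
have /andP[h3 h4] := survival_bounds (ltW ce0).
have s0 := survival_gt0 e0.
apply/andP; split.
  rewrite ler_pdivlMr//; apply: le_trans h3.
  have -> : - (c * e) ^+ 2 / 2 = - c ^+ 2 / 2 * e ^+ 2 by ring.
  rewrite (_ : L * _ * _ = c * expR (- c ^+ 2 / 2 * e ^+ 2) * (L * e)); last ring.
  by rewrite ler_wpM2l// mulr_ge0// ?expR_ge0// ltW.
rewrite ler_pdivrMr//; apply: (le_trans h4).
have -> : L * (c * e) = c * expR (1 / 2 * e ^+ 2) * (L * expR (- e ^+ 2 / 2) * e).
  have : expR (1 / 2 * e ^+ 2) * expR (- e ^+ 2 / 2) = 1.
    by rewrite -expRD -[RHS]expR0; congr expR; ring.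
  move: (expR (1 / 2 * e ^+ 2)) (expR (- e ^+ 2 / 2)) => u v uv.
  transitivity (L * c * e * (u * v)); last ring.
  by rewrite uv; ring.
by rewrite ler_wpM2l// mulr_ge0// ?expR_ge0// ltW.
Unshelve. all: end_near. Qed.

End Survival.

(** * Cameron-Martin formula *)

Section ProductExpectation.
Context d (Om : measurableType d) (R : realType) (P : probability Om R).
Variables (nu : probability (measurableTypeR R) R) (xi : nat -> Om -> R) (N : nat).
Hypothesis mxi : forall i, (i < N)%N -> measurable_fun [set: Om] (xi i).
Hypothesis indep : forall A : nat -> set R, (forall i, measurable (A i)) ->
  (P [set w | forall i, (i < N)%N -> A i (xi i w)] = \prod_(i < N) nu (A i))%E.
Variable g : nat -> R -> R.
Hypothesis mg : forall i, measurable_fun [set: R] (g i).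
Hypothesis g0 : forall i x, 0 <= g i x.
Hypothesis gfin : forall i, (\int[nu]_x (g i x)%:E)%E \is a fin_num.

Let mprod k : (k <= N)%N -> measurable_fun [set: Om] (fun w => \prod_(i < k) g i (xi i w)).
Proof.
elim: k => [|k IH] kN; first by under eq_fun do rewrite big_ord0; exact: measurable_cst.
under eq_fun do rewrite big_ord_recr/=.
apply: measurable_funM; first exact/IH/ltnW.
exact: (measurableT_comp (mg k) (mxi kN)).
Qed.

Let prod0 k w : 0 <= \prod_(i < k) g i (xi i w).
Proof. exact: prodr_ge0. Qed.

Let tail k (A : nat -> set R) : set Om :=
  [set w | forall i, (k <= i < N)%N -> A i (xi i w)].

Let mtail k A : (forall i, measurable (A i)) -> measurable (tail k A).
Proof.
move=> mA; rewrite (_ : tail k A =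
    \bigcap_(i in [set i | (k <= i < N)%N]) (xi i @^-1` A i)) //.
apply: fin_bigcap_measurable.
  by apply: sub_finite_set (finite_II N) => i /= /andP[].
move=> i /= /andP[_ iN]; rewrite -[X in measurable X]setTI; exact: mxi.
Qed.

(** Independence is given on events only. Induction on [k] replaces the events of the first [k]
    coordinates by the functions [g i], one coordinate at a time, keeping events on the others. *)
Lemma product_expectation :
  (\int[P]_w (\prod_(i < N) g i (xi i w))%:E = \prod_(i < N) \int[nu]_x (g i x)%:E)%E.
Proof.
suff H k : (k <= N)%N -> forall A : nat -> set R, (forall i, measurable (A i)) ->
    (\int[P]_(w in tail k A) (\prod_(i < k) g i (xi i w))%:E =
     (\prod_(i < k) \int[nu]_x (g i x)%:E) * \prod_(k <= i < N) nu (A i))%E.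
  have := H N (leqnn N) (fun=> setT) (fun=> measurableT).
  rewrite big_geq// mule1 (_ : tail N _ = setT)//.
  by apply/seteqP; split.
elim: k => [_ A mA|k IH kN A mA].
  rewrite big_ord0 mul1e.
  under eq_integral do rewrite big_ord0.
  rewrite integral_cst ?mul1e; last exact: mtail.
  rewrite big_mkord -indep//; congr (P _).
have {}IH := IH (ltnW kN).
(* All coordinates but the [k]-th are put into a weight. Under it the law of [xi k] is the multiple
   [C] of [nu]: the induction hypothesis says so on events, hence it holds against [g k]. *)
pose w0 w := \prod_(i < k) g i (xi i w) * \1_(tail k.+1 A) w.
have mw0 : measurable_fun [set: Om] w0.
  apply: measurable_funM; first exact: mprod (ltnW kN).
  by apply: measurable_indic; exact: mtail.
have w00 w : 0 <= w0 w by rewrite mulr_ge0.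
pose mu1 := @law _ _ Om (measurableTypeR R) R (dens P mw0 w00) (xi k) (mxi kN).
pose C := (\prod_(i < k) \int[nu]_x (g i x)%:E * \prod_(k.+1 <= i < N) nu (A i))%E.
have Cfin : C \is a fin_num.
  rewrite /C; apply: fin_numM; apply: prode_fin_num => i _ //.
  by apply: fin_num_measure; exact: mA.
have C0 : 0 <= fine C.
  apply: fine_ge0; apply: mule_ge0; apply: prode_ge0 => // i _.
  by apply: integral_ge0 => x _; rewrite lee_fin.
have mu1E (S : set R) : measurable S -> mu1 S = mscale (NngNum C0) nu S.
  move=> mS.
  pose A' i := if i == k then S else A i.
  have mA' i : measurable (A' i) by rewrite /A'; case: ifP.
  have A'k : A' k = S by rewrite /A' eqxx.
  have := IH A' mA'; rewrite big_ltn// A'k.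
  rewrite (eq_big_nat _ _ (F2 := fun i => nu (A i))); last first.
    by move=> i /andP[ki _]; rewrite /A' gtn_eqF.
  move=> H; rewrite /mscale/= fineK// /C muleAC -muleA -H.
    have -> : tail k A' = xi k @^-1` S `&` tail k.+1 A.
      apply/seteqP; split=> w /=.
        move=> h; split; first by rewrite /preimage/= -A'k; apply: h; rewrite leqnn.
        move=> i /andP[ki iN]; have := h i.
        by rewrite (ltnW ki) iN /A' gtn_eqF//= => /(_ isT).
      move=> [h1 h2] i /andP[ki iN]; rewrite /A'; case: eqP => [->//|/eqP ik].
      by apply: h2; rewrite iN ltn_neqAle eq_sym ik ki.
    rewrite integral_mkcondr; apply: eq_integral => w _.
    rewrite patchE /w0 indicE.
    by case: ifPn => _; rewrite ?mulr1 ?mulr0.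
have : (\int[mu1]_x (g k x)%:E = C * \int[nu]_x (g k x)%:E)%E.
  transitivity (\int[mscale (NngNum C0) nu]_x (g k x)%:E)%E.
    by apply: eq_measure_integral => S mS _; exact: mu1E.
  rewrite ge0_integral_mscale//=.
  - by rewrite fineK.
  - by apply/measurable_EFinP; exact: mg.
  - by move=> x _; rewrite lee_fin.
rewrite /mu1 ge0_integral_law//; last 2 first.
- by apply/measurable_EFinP; exact: mg.
- by move=> x; rewrite lee_fin.
rewrite ge0_integral_dens; last 2 first.
- by apply/measurable_EFinP; exact: (measurableT_comp (mg k) (mxi kN)).
- by move=> x; rewrite lee_fin.
move=> H; rewrite big_ord_recr/= muleAC -/C -H [LHS]integral_mkcond.
apply: eq_integral => w _; rewrite patchE /w0 indicE big_ord_recr/=.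
case: ifPn => _; last by rewrite mulr0 mule0.
by rewrite mulr1 EFinM muleC.
Qed.

End ProductExpectation.

Lemma min_lip (R : realType) (a b M : R) :
  `|Num.min a M - Num.min b M| <= `|a - b|.
Proof.
by rewrite ler_norml; case: (leP a M) => ?; case: (leP b M) => ?;
  case: (leP a b) => ?; [rewrite ler0_norm|rewrite gtr0_norm|rewrite ler0_norm|
  rewrite gtr0_norm|rewrite ler0_norm|rewrite gtr0_norm|rewrite ler0_norm|
  rewrite gtr0_norm]; lra.
Qed.

Section L2Limit.
Context d (Om : measurableType d) (R : realType) (P : probability Om R).

(** Where [f] exceeds [M] it is at most [f ^+ 2 / M], so truncation at [M] costs at most [C / M]. *)
Lemma integral_trunc (D : set Om) (f : Om -> R) (C M : R) : measurable D ->
  measurable_fun [set: Om] f -> (forall w, 0 <= f w) -> 0 < M ->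
  (\int[P]_w (f w ^+ 2)%:E <= C%:E)%E ->
  (\int[P]_(w in D) (Num.min (f w) M)%:E <= \int[P]_(w in D) (f w)%:E <=
   \int[P]_(w in D) (Num.min (f w) M)%:E + (C / M)%:E)%E.
Proof.
move=> mD mf f0 M0 fC.
have mm : measurable_fun [set: Om] (fun w => Num.min (f w) M).
  exact: measurable_minr.
have m0 w : 0 <= Num.min (f w) M by rewrite le_min f0 ltW.
apply/andP; split.
  apply: ge0_le_integral_fin => // w _; rewrite ge_min lexx//.
have mf2 : measurable_fun [set: Om] (fun w => M^-1 * f w ^+ 2).
  by apply: measurable_funM => //; exact: measurable_funX.
have f20 w : 0 <= M^-1 * f w ^+ 2.
  by rewrite mulr_ge0 ?sqr_ge0// invr_ge0 ltW.
apply: (@le_trans _ _ (\int[P]_(w in D) ((Num.min (f w) M) + (M^-1 * f w ^+ 2))%:E)%E).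
  apply: ge0_le_integral_fin => //; first exact: measurable_funD.
  move=> w _; have [fM|Mf] := leP (f w) M; first by rewrite lerDl.
  rewrite (le_trans (y := M^-1 * f w ^+ 2))//; last by rewrite lerDr ltW.
  by rewrite mulrC ler_pdivlMr// expr2 ler_wpM2l// ltW// (lt_trans M0).
under eq_integral do rewrite EFinD.
rewrite ge0_integralD//; last 4 first.
- by move=> w _; rewrite lee_fin.
- by apply: measurable_funTS; apply/measurable_EFinP.
- by move=> w _; rewrite lee_fin.
- by apply: measurable_funTS; apply/measurable_EFinP.
rewrite leeD2l//; apply: (@le_trans _ _ (\int[P]_w (M^-1 * f w ^+ 2)%:E)%E).
  apply: ge0_subset_integral => //; first by apply/measurable_EFinP.
  by move=> w _; rewrite lee_fin.
under eq_integral do rewrite EFinM.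
rewrite ge0_integralZl//; last 3 first.
- by apply/measurable_EFinP; exact: measurable_funX.
- by move=> w _; rewrite lee_fin sqr_ge0.
- by rewrite lee_fin invr_ge0 ltW.
by rewrite EFinM muleC lee_wpmul2r// lee_fin invr_ge0 ltW.
Qed.

(** A uniform second moment replaces a dominating function: Fatou passes the bound to the limit, and
    bounded convergence handles the truncations. *)
Lemma cvg_integral_L2 (D : set Om) (f_ : nat -> Om -> R) (f : Om -> R) (C c : R) :
  measurable D -> (forall n, measurable_fun [set: Om] (f_ n)) ->
  measurable_fun [set: Om] f ->
  (forall n w, 0 <= f_ n w) -> (forall w, f_ n w @[n --> \oo] --> f w) ->
  (forall n, (\int[P]_w (f_ n w ^+ 2)%:E <= C%:E)%E) ->
  (forall n, (\int[P]_(w in D) (f_ n w)%:E = c%:E)%E) ->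
  (\int[P]_(w in D) (f w)%:E = c%:E)%E.
Proof.
move=> mD mf_ mf f_0 cf f_C f_c.
have f0 w : 0 <= f w by apply: (cvgr_to_ge (cf w)); exact: nearW.
have fC : (\int[P]_w (f w ^+ 2)%:E <= C%:E)%E.
  have cf2 w : (f_ n w ^+ 2)%:E @[n --> \oo] --> (f w ^+ 2)%:E.
    apply: cvg_EFin; first exact: nearW.
    by rewrite /comp/=; under eq_fun do rewrite expr2; rewrite expr2; apply: cvgM.
  have := @fatou _ _ _ P setT measurableT (fun n w => (f_ n w ^+ 2)%:E) _ _.
  rewrite (eq_integral (fun w => (f w ^+ 2)%:E)); last first.
    by move=> w _; have [-> _] := cvg_limn_einf_sup (cf2 w).
  move=> H; apply: le_trans (H _ _) _.
  - by move=> n; apply/measurable_EFinP; exact: measurable_funX.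
  - by move=> n w _; rewrite lee_fin sqr_ge0.
  rewrite limn_einf_lim; apply: lime_le; first exact: is_cvg_einfs.
  apply: nearW => n; apply: le_trans (f_C n); apply: ereal_inf_lbound.
  by exists n => //=.
have C0 : 0 <= C.
  by rewrite -lee_fin; apply: le_trans fC; apply: integral_ge0 => w _; rewrite lee_fin sqr_ge0.
(* [a] is the integral of the limit truncated at [M]; both [c] and the wanted integral lie between
   [a] and [a + C / M]. *)
have key M : 0 < M -> exists a : R, [/\ a <= c, c <= a + C / M,
    (a%:E <= \int[P]_(w in D) (f w)%:E)%E &
    (\int[P]_(w in D) (f w)%:E <= a%:E + (C / M)%:E)%E].
  move=> M0; pose t (g : Om -> R) (w : Om) := Num.min (g w) M.
  have mt g : measurable_fun [set: Om] g -> measurable_fun [set: Om] (t g).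
    by move=> mg; exact: measurable_minr.
  have tb g : (forall w, 0 <= g w) -> forall w, `|t g w| <= M.
    by move=> g0 w; rewrite ger0_norm ?ge_min ?lexx ?orbT// le_min g0 ltW.
  have ct : (\int[P]_(w in D) (t (f_ n) w)%:E)%E @[n --> \oo] -->
      (\int[P]_(w in D) (t f w)%:E)%E.
    apply: (@bounded_cvg_integral _ _ _ P D (fun n => t (f_ n)) (t f) M) => //.
    - by move=> n; exact: mt.
    - exact: mt.
    - by move=> n; exact: tb.
    - move=> w; apply/cvgrPdist_lt => e e0.
      have /cvgrPdist_lt /(_ _ e0) := cf w; apply: filterS => n.
      exact/le_lt_trans/min_lip.
  have fin : (\int[P]_(w in D) (t f w)%:E)%E \is a fin_num.
    apply: integrable_fin_num => //.
    by have := bounded_integrable P mD (mt _ mf) (tb _ f0).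
  have [h1 h2] := andP (integral_trunc mD mf f0 M0 fC).
  have hn n := andP (integral_trunc mD (mf_ n) (f_0 n) M0 (f_C n)).
  exists (fine (\int[P]_(w in D) (t f w)%:E)%E); split.
  - rewrite -lee_fin fineK//; apply: (@cvge_to_le _ _ _ _ _ _ _ ct).
    by apply: nearW => n; have [+ _] := hn n; rewrite f_c.
  - rewrite -lerBlDr -lee_fin fineK//; apply: (@cvge_to_ge _ _ _ _ _ _ _ ct).
    by apply: nearW => n; have [_ +] := hn n; rewrite f_c EFinB leeBlDr.
  - by rewrite fineK.
  - by rewrite fineK.
have vfin : (\int[P]_(w in D) (f w)%:E)%E \is a fin_num.
  have [a [_ _ h1 h2]] := key 1 ltr01; rewrite fin_numElt.
  rewrite (lt_le_trans _ h1) ?ltNyr//= (le_lt_trans h2)//.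
  by rewrite -EFinD ltry.
rewrite -[LHS]fineK//; congr EFin.
have E e : 0 < e -> exists2 M, 0 < M & C / M <= e.
  move=> e0; exists ((C + 1) / e); first by apply: divr_gt0 => //; lra.
  rewrite invf_div mulrCA ler_piMr//; first exact: ltW.
  by rewrite ler_pdivrMr; lra.
apply/eqP; rewrite eq_le; apply/andP; split; apply/ler_addgt0Pl => e /E[M M0 Me];
  have [a [h1 h2 h3 h4]] := key M M0; move: h3 h4;
  rewrite -[X in (_ <= X)%E -> _]fineK// -[X in _ -> (X <= _)%E -> _]fineK//
    -EFinD !lee_fin; lra.
Qed.

End L2Limit.

(** * Dyadic Riemann sums and measurability of the path integral *)

Section Riemann.
Context {R : realType}.
Notation leb := (@lebesgue_measure R).
Implicit Types x y : R -> R.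

Lemma pintE x a b : pint x a b = (\int[leb]_(r in `[a, b]) x r)%R.
Proof. by []. Qed.

Lemma integrable_itv x (a b c d : R) (l r : bool) : {within `[a, b], continuous x} ->
  a <= c -> d <= b ->
  leb.-integrable [set` Interval (BSide l c) (BSide r d)] (EFin \o x).
Proof.
move=> cx ac db.
have := continuous_compact_integrable (@segment_compact _ a b) cx.
apply: integrableS => //.
move=> t /=; rewrite !in_itv/=; case: l; case: r => /=; lra.
Qed.

Lemma pint_step x (a b e : R) : cont01 x -> 0 <= a -> a <= b -> b <= 1 ->
  (forall t, a <= t <= b -> `|x t - x a| <= e) ->
  `|pint x 0 b - pint x 0 a - (b - a) * x a| <= e * (b - a).
Proof.
move=> cx a0 ab b1 H; rewrite !pintE.
have ix c d l r : 0 <= c -> d <= 1 ->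
    leb.-integrable [set` Interval (BSide l c) (BSide r d)] (EFin \o x).
  by move=> c0 d1; exact: (integrable_itv l r cx).
rewrite Rintegral_itvB; last 3 first.
- exact: ix.
- by rewrite bnd_simp.
- by rewrite bnd_simp.
have ic (k : R) : leb.-integrable `]a, b] (EFin \o cst k).
  have := @integrable_itv (cst k) a b a b false false.
  by apply => // t; exact: cvg_cst.
have vol (k : R) : (\int[leb]_(t in `]a, b]) k)%R = k * (b - a).
  rewrite Rintegral_cst//= lebesgue_measure_itv/= lte_fin.
  have [//|ba] := ltP a b.
  have -> : b = a by apply/eqP; rewrite eq_le ba ab.
  by rewrite subrr fine0.
have h1 : (\int[leb]_(t in `]a, b]) x t)%R <= (x a + e) * (b - a).
  rewrite -vol; apply: le_Rintegral => //; [exact: ix|exact: ic|].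
  by move=> t /=; rewrite in_itv/= => /andP[t1 t2]; have := H t; rewrite ltW// t2 ler_norml; lra.
have h2 : (x a - e) * (b - a) <= (\int[leb]_(t in `]a, b]) x t)%R.
  rewrite -vol; apply: le_Rintegral => //; [exact: ic|exact: ix|].
  by move=> t /=; rewrite in_itv/= => /andP[t1 t2]; have := H t; rewrite ltW// t2 ler_norml; lra.
move: h1 h2; move: (Rintegral _ _ _) (x a) => I xa h1 h2; clear -h1 h2.
by rewrite ler_norml; apply/andP; split; lra.
Qed.

Definition riemann n x : R := (2 ^+ n)^-1 * \sum_(j < 2 ^ n) x (gp n j).

Lemma riemann_bound x n e : cont01 x ->
  (forall s t, 0 <= s <= 1 -> 0 <= t <= 1 -> `|s - t| <= (2 ^+ n)^-1 -> `|x s - x t| <= e) ->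
  `|pint x 0 1 - riemann n x| <= e.
Proof.
move=> cx H.
suff K k : (k <= 2 ^ n)%N ->
    `|pint x 0 (gp n k) - (2 ^+ n)^-1 * \sum_(j < k) x (gp n j)| <= e * gp n k.
  by have := K _ (leqnn _); rewrite gp_full mulr1.
elim: k => [_|k IH kn].
  rewrite gp0 big_ord0 !mulr0 subr0 pintE.
  by rewrite set_itv1 Rintegral_set1 normr0.
have := IH (ltnW kn) => {}IH.
have := @pint_step x (gp n k) (gp n k.+1) e cx.
have /andP[k0 _] := gp01 (R := R) (ltnW kn).
have /andP[_ k1] := gp01 (R := R) kn.
have kk : gp n k <= gp n k.+1 :> R by rewrite gp_le.
move=> /(_ k0 kk k1) S.
have {}S := S _; rewrite big_ord_recr/= mulrDr.
have : `|pint x 0 (gp n k.+1) - pint x 0 (gp n k) - (gp n k.+1 - gp n k) * x (gp n k)|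
   <= e * (gp n k.+1 - gp n k).
  apply: S => t /andP[t1 t2]; apply: H; [lra|lra|].
  have := gp_step (R := R) n k; rewrite ger0_norm; lra.
rewrite gp_step => {}S.
have E : gp n k.+1 = gp n k + (2 ^+ n)^-1 :> R by rewrite -(gp_step n k); ring.
move: S IH; rewrite [X in _ -> _ -> _ <= e * X]E.
move: (pint x 0 (gp n k.+1)) (pint x 0 (gp n k)) (x (gp n k)) => p1 p0 xk.
move: (\sum_(j < k) x (gp n j)) ((2 ^+ n)^-1) (gp n k) => s h g S IH.
have := ler_normD (p1 - p0 - h * xk) (p0 - h * s).
rewrite (_ : _ + (p0 - _) = p1 - (h * s + h * xk)); last ring.
by move=> /le_trans; apply; rewrite mulrDr addrC lerD.
Qed.

Lemma cvg_riemann x : cont01 x -> riemann n x @[n --> \oo] --> pint x 0 1.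
Proof.
move=> cx; apply/cvgrPdist_le => e e0.
have [dl dl0 K] := unif_continuous_itv cx e0.
near=> n; apply: riemann_bound => // s t s01 t01 st; apply/ltW/K => //.
by apply: le_lt_trans st _; near: n; exact: near_expV2_lt.
Unshelve. all: end_near. Qed.

Lemma measurable_riemann n :
  measurable_fun [set: pathT R] (riemann n : pathT R -> R).
Proof.
apply: measurable_funM => //.
apply: measurable_sum => j; apply: measurable_ev; apply: gp01; exact: ltnW.
Qed.

Lemma measurable_pint d (Om : measurableType d) (X : Om -> R -> R) :
  measurable_fun [set: Om] (X : Om -> pathT R) -> (forall w, cont01 (X w)) ->
  measurable_fun [set: Om] (fun w => pint (X w) 0 1).
Proof.
move=> mX cX; apply: (@measurable_fun_cvg _ _ _ _ (fun n w => riemann n (X w))).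
- by move=> n; exact: (measurableT_comp (measurable_riemann n) mX).
- by move=> w _; exact: cvg_riemann.
Qed.

End Riemann.

Section CameronMartin.
Context {R : realType}.
Implicit Types (x : R -> R) (y : R).

(* The correction [12 t (2 - t) - 9] of [U_proc] is [3 (2 s - s^2)] with [s = 2 t - 1]. *)
Definition drift y (t : R) : R := y * (2 * t - t ^+ 2).

(** Mean slope of [drift y] on the [j]-th dyadic cell, equal to the derivative at its midpoint
    because [drift] is quadratic. *)
Definition slope n y j : R := y * (2 - (j.*2.+1)%:R / 2 ^+ n).

(** Discrete Cameron-Martin exponent: the integral of [h'] against the path minus half the integral
    of the square of [h'], with [h'] replaced by the cell slopes of [h = drift y]. *)
Definition log_tilt n y x : R :=
  \sum_(j < 2 ^ n) (slope n y j * inc n j x - slope n y j ^+ 2 * (2 ^+ n)^-1 / 2).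

Lemma cont01_drift y : cont01 (drift y).
Proof.
apply: continuous_subspaceT => t; apply: cvgM; first exact: cvg_cst.
apply: cvgB; last exact: exprn_continuous.
by apply: cvgM; [exact: cvg_cst|exact: cvg_id].
Qed.

Lemma drift0 y : drift y 0 = 0.
Proof. by rewrite /drift mulr0 expr0n/= subr0 mulr0. Qed.

Lemma natr_doubleS j : j.*2.+1%:R = 2 * j%:R + 1 :> R.
Proof. by rewrite -[_.+1%:R]natr1 -mul2n natrM. Qed.

Lemma inc_drift n y j : inc n j (drift y) = slope n y j * (2 ^+ n)^-1.
Proof.
rewrite /inc /drift /slope /gp natr_doubleS -[j.+1%:R]natr1.
move: (j%:R : R) (2 ^+ n)^-1 => u v; ring.
Qed.

(** Summation by parts: consecutive slopes differ by the constant [2 * y / 2 ^+ n], so what remains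
    beside the boundary term is a sum of path values. *)
Lemma sum_slope n y x m : x 0 = 0 ->
  \sum_(j < m) slope n y j * inc n j x =
  y * (2 - (m.*2%:R - 1) / 2 ^+ n) * x (gp n m) +
    2 * y / 2 ^+ n * \sum_(j < m) x (gp n j).
Proof.
move=> x0; elim: m => [|m IH]; first by rewrite !big_ord0 gp0 x0 !mulr0 addr0.
rewrite !big_ord_recr/= IH /slope /inc natr_doubleS -!mul2n !natrM -[m.+1%:R]natr1.
move: (m%:R : R) (2 ^+ n)^-1 (x (gp n m.+1)) (x (gp n m)) => u v p q.
ring.
Qed.

Lemma sum_slope2 n y m :
  \sum_(j < m) slope n y j ^+ 2 =
  y ^+ 2 * (4 * m%:R - 4 * m%:R ^+ 2 / 2 ^+ n +
    m%:R * (4 * m%:R ^+ 2 - 1) / 3 * (2 ^+ n)^-1 ^+ 2).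
Proof.
elim: m => [|m IH]; first by rewrite !big_ord0 /=; ring.
rewrite big_ord_recr/= IH /slope natr_doubleS -[m.+1%:R]natr1.
move: (m%:R : R) (2 ^+ n)^-1 => u v.
by field.
Qed.

(** Makes the exponent a function of a Riemann sum, so that it converges path by path to the
    exponent of [cm_density]. *)
Lemma log_tiltE n y x : x 0 = 0 ->
  log_tilt n y x = y * ((2 ^+ n)^-1 * x 1 + 2 * riemann n x) -
    y ^+ 2 * (4 - (2 ^+ n)^-1 ^+ 2) / 6.
Proof.
move=> x0; rewrite /log_tilt sumrB -mulr_suml -mulr_suml sum_slope// sum_slope2.
rewrite gp_full /riemann -muln2 natrM natrX.
have p0 : 2 ^+ n != 0 :> R by rewrite expf_neq0.
move: (2 ^+ n) p0 (\sum_(j < 2 ^ n) x (gp n j)) => u u0 s.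
by field.
Qed.

Section Tilt.
Context d (Om : measurableType d) (P : probability Om R).
Variable X : Om -> R -> R.
Hypothesis bmX : path_bm P X.

Let mX : measurable_fun [set: Om] (X : Om -> pathT R). Proof. by case: bmX. Qed.
Let cX w : cont01 (X w). Proof. by case: bmX. Qed.
Let X0 w : X w 0 = 0. Proof. by case: bmX. Qed.
Let gX n : grid_law P X n. Proof. by case: bmX. Qed.

Let Y y (w : Om) : R -> R := fun t => X w t - drift y t.

Let mXt u : 0 <= u <= 1 -> measurable_fun [set: Om] (fun w => X w u).
Proof. by move=> u01; exact: (measurableT_comp (measurable_ev u01) mX). Qed.

Let mY y : measurable_fun [set: Om] (Y y : Om -> pathT R).
Proof. by apply: measurable_pathP => t t01; apply: measurable_funB => //; exact: mXt. Qed.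

Let minc n j : (j < 2 ^ n)%N -> measurable_fun [set: Om] (fun w => inc n j (X w)).
Proof. by move=> j2; exact: (measurableT_comp (measurable_inc j2) mX). Qed.

Let wn n y (w : Om) : R := expR (log_tilt n y (X w)).

Let mwn n y : measurable_fun [set: Om] (wn n y).
Proof.
apply: measurableT_comp; first exact: measurable_expR.
apply: measurable_sum => j; apply: measurable_funB => //.
by apply: measurable_funM => //; exact: minc.
Qed.

Let wn0 n y w : 0 <= wn n y w. Proof. exact: expR_ge0. Qed.

(** At a fixed level the weight is a product over the increments, and [normal_prob_tilt] applies to
    each factor. *)
Lemma grid_law_tilt n y : grid_law (dens P (mwn n y) (wn0 n y)) (Y y) n.
Proof.
move=> A mA; rewrite densE.
have h0 : 0 < (2 ^+ n)^-1 :> R by rewrite invr_gt0 exprn_gt0.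
pose h : R := (2 ^+ n)^-1.
(* The factor of cell [j]: its exponential weight times the indicator of the shifted increment. *)
pose g j u := expR (slope n y j * u - slope n y j ^+ 2 * h / 2) *
  \1_(A j) (u - slope n y j * h).
have mg j : measurable_fun [set: R] (g j).
  apply: measurable_funM.
    apply: measurableT_comp; first exact: measurable_expR.
    by apply: measurable_funB => //; exact: measurable_funM.
  apply: measurableT_comp; first exact: measurable_indic.
  exact: measurable_funB.
have g0 j u : 0 <= g j u by rewrite mulr_ge0// expR_ge0.
pose nu : probability (measurableTypeR R) R := normal_prob 0 (Num.sqrt h).
have ig j : (\int[nu]_u (g j u)%:E = normal_prob 0 (Num.sqrt h) (A j))%E.
  rewrite -(normal_prob_tilt (slope n y j) h0 (mA j)).
  rewrite ge0_integral_normal_prob; last 2 first.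
  - by apply/measurable_EFinP; exact: mg.
  - by move=> u; rewrite lee_fin.
  by apply: eq_integral => u _; rewrite -EFinM mulrC.
transitivity (\int[P]_w (\prod_(j < 2 ^ n) g j (inc n j (X w)))%:E)%E.
  rewrite integral_mkcond; apply: eq_integral => w _; rewrite patchE.
  rewrite /g big_split/= -expR_sum -/(log_tilt n y (X w)).
  have E (j : 'I_(2 ^ n)) : inc n j (X w) - slope n y j * h = inc n j (Y y w).
    by rewrite -inc_drift /inc /Y; ring.
  have -> : \prod_(j < 2 ^ n) (\1_(A j) (inc n j (X w) - slope n y j * h) : R) =
      \prod_(j < 2 ^ n) \1_(A j) (inc n j (Y y w)).
    by apply: eq_bigr => j _; rewrite E.
  case: ifPn => [|].
    rewrite inE => /= wA; rewrite big1 ?mulr1// => j _.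
    by rewrite indicE mem_set//; exact: wA.
  rewrite notin_setE => wA.
  have [j wj] : exists j : 'I_(2 ^ n), ~ A j (inc n j (Y y w)).
    apply: contrapT => /forallNP H; apply: wA => i i2.
    by apply: contrapT => K; apply: (H (Ordinal i2)).
  rewrite (bigD1 j)//= indicE memNset//.
  by rewrite mul0r mulr0.
rewrite (@product_expectation _ _ R P nu (fun j w => inc n j (X w)) (2 ^ n)%N) //.
- by apply: eq_bigr => j _; exact: ig.
- by move=> j j2; exact: minc.
- by move=> A' mA'; exact: (@gX n A' mA').
- by move=> j; rewrite ig; apply: fin_num_measure; exact: mA.
Qed.

(** With [h = drift y] and [h'(s) = 2 y (1 - s)], integration by parts turns the stochastic integral
    of [h'] into [2 y] times the integral of the path, and half the integral of the square of [h']
    is [2 y^2 / 3]. *)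
Definition cm_density y (w : Om) : R := expR (2 * y * pint (X w) 0 1 - 2 * y ^+ 2 / 3).

Lemma measurable_cm_density y : measurable_fun [set: Om] (cm_density y).
Proof.
apply: measurableT_comp; first exact: measurable_expR.
apply: measurable_funB => //; apply: measurable_funM => //.
exact: measurable_pint.
Qed.

Let cmd0 y w : 0 <= cm_density y w. Proof. exact: expR_ge0. Qed.

(** For a box of level [n], the tilts of all levels [n + k] give one and the same mass; the mass
    under the limiting density follows by letting [k] tend to infinity. *)
Lemma path_bm_tilt y : path_bm (dens P (measurable_cm_density y) (cmd0 y)) (Y y).
Proof.
split; first exact: mY.
- by move=> w t; apply: cvgB; [exact: cX|exact: cont01_drift].
- by move=> w; rewrite /Y X0 drift0 subr0.
move=> n A mA; rewrite densE.
have mD : measurable (Y y @^-1` inc_box n A).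
  by rewrite -[X in measurable X]setTI; apply: mY => //; exact: measurable_inc_box.
set c := (\prod_(i < 2 ^ n) _)%E.
have cfin : c \is a fin_num.
  by apply: prode_fin_num => i _; apply: fin_num_measure; exact: mA.
have limh : (2 ^+ (n + k))^-1 @[k --> \oo] --> (0 : R).
  apply/cvgrPdist_lt => e e0; have [N _ K] := near_expV2_lt e0.
  exists N => // k /= Nk; rewrite sub0r normrN ger0_norm ?invr_ge0 ?exprn_ge0//.
  by apply: K; exact: leq_trans Nk (leq_addl _ _).
have limr w : riemann (n + k) (X w) @[k --> \oo] --> pint (X w) 0 1.
  have := cvg_riemann (@cX w); rewrite -(cvg_shiftn n).
  by under eq_fun do rewrite addnC.
have cL w : log_tilt (n + k) y (X w) @[k --> \oo] -->
    2 * y * pint (X w) 0 1 - 2 * y ^+ 2 / 3.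
  have -> : 2 * y * pint (X w) 0 1 - 2 * y ^+ 2 / 3 =
      y * (0 * X w 1 + 2 * pint (X w) 0 1) - y ^+ 2 * (4 - 0 * 0) / 6 by field.
  rewrite (_ : (fun k => _) = (fun k => y * ((2 ^+ (n + k))^-1 * X w 1 +
    2 * riemann (n + k) (X w)) - y ^+ 2 * (4 - (2 ^+ (n + k))^-1 * (2 ^+ (n + k))^-1) / 6)).
    have c1 : y * ((2 ^+ (n + k))^-1 * X w 1 + 2 * riemann (n + k) (X w)) @[k --> \oo]
        --> y * (0 * X w 1 + 2 * pint (X w) 0 1).
      apply: cvgMr; apply: cvgD; first exact: (cvgMl limh).
      exact: (cvgMr (limr w)).
    have c2 : y ^+ 2 * (4 - (2 ^+ (n + k))^-1 * (2 ^+ (n + k))^-1) / 6 @[k --> \oo]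
        --> y ^+ 2 * (4 - 0 * 0) / 6.
      apply: cvgMl; apply: cvgMr; apply: cvgB; first exact: cvg_cst.
      exact: (cvgM limh limh).
    exact: (cvgB c1 c2).
  by apply/funext => k; rewrite log_tiltE// expr2.
rewrite -(fineK cfin).
apply: (@cvg_integral_L2 _ _ _ P _ (fun k => wn (n + k) y) _ (expR (4 * y ^+ 2 / 3))) => //.
- exact: measurable_cm_density.
- by move=> w; apply: (cvg_comp _ expR (cL w)); exact: continuous_expR.
(* The square of the weight for [y] is at most [expR (4 * y ^+ 2 / 3)] times the weight for [2 * y],
   and the latter has integral 1. *)
- move=> k.
  have m1 := grid_lawT (grid_law_tilt (n + k) (2 * y)); rewrite densE in m1.
  pose K : R := expR (4 * y ^+ 2 / 3).
  have K0 : 0 <= K by exact: expR_ge0.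
  have mK : measurable_fun [set: Om] (EFin \o wn (n + k) (2 * y)).
    by apply/measurable_EFinP; exact: mwn.
  have IK : (\int[P]_w (K * wn (n + k) (2 * y) w)%:E = K%:E)%E.
    under eq_integral do rewrite EFinM.
    etransitivity; first apply: ge0_integralZl => //.
    - by move=> w _; rewrite lee_fin; exact: wn0.
    - by rewrite m1 mule1.
  rewrite -/K -IK; apply: ge0_le_integral_fin => //.
  + by apply: measurable_funX; exact: mwn.
  + by move=> w; exact: sqr_ge0.
  + by apply: measurable_funM => //; exact: mwn.
  move=> w _; rewrite /K /wn expr2 -!expRD ler_expR !log_tiltE//.
  have : 0 <= y ^+ 2 * (2 ^+ (n + k))^-1 ^+ 2 by rewrite mulr_ge0// sqr_ge0.
  move: (riemann _ _) ((2 ^+ (n + k))^-1) (X w 1) => r h p hh.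
  rewrite -subr_ge0 (_ : _ - _ = y ^+ 2 * h ^+ 2 / 3); last by field.
  by rewrite divr_ge0.
(* A box of level [n] is also an event of level [n + k], where the discrete tilt is exact. *)
- move=> k; rewrite fineK//.
  rewrite -[LHS]/(dens P (mwn (n + k) y) (wn0 (n + k) y) (Y y @^-1` inc_box n A)).
  have sI : <<s Inc (n + k) >> (inc_box n A).
    apply: (sub_sigma_Inc (leq_addr k n)); apply: sub_sigma_algebra.
    by exists A.
  rewrite (eq_law_Inc (mY y) mX (grid_law_tilt (n + k) y) (@gX (n + k)) sI).
  exact: (@gX n A mA).
Qed.

Lemma measurable_add_drift y :
  measurable_fun [set: pathT R] (fun x : R -> R => (fun t => x t + drift y t) : pathT R).
Proof.
apply: measurable_pathP => t t01; apply: measurable_funD => //.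
exact: measurable_ev.
Qed.

(** Under the density [X] minus the drift has the law that [X] has under [P]. Applying this to [H]
    precomposed with the shift cancels the drift. *)
Lemma cameron_martin y (H : pathT R -> \bar R) : measurable_fun [set: pathT R] H ->
  (forall x, (0 <= H x)%E) ->
  (\int[P]_w H (fun t => X w t + drift y t)%R = \int[P]_w (H (X w) * (cm_density y w)%:E))%E.
Proof.
move=> mH H0.
pose H' (x : pathT R) := H (fun t => x t + drift y t).
have mH' : measurable_fun [set: pathT R] H'.
  exact: (measurableT_comp mH (measurable_add_drift y)).
have H'0 x : (0 <= H' x)%E by exact: H0.
have [mYy cY Y0 gY] := path_bm_tilt y.
transitivity (\int[law P mX]_x H' x)%E; first by rewrite ge0_integral_law.
transitivity (\int[law (dens P (measurable_cm_density y) (cmd0 y)) mYy]_x H' x)%E.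
  apply: eq_measure_integral => E mE _.
  exact: (@eq_law_path _ 0 _ _ _ _ P (dens P (measurable_cm_density y) (cmd0 y))).
rewrite ge0_integral_law// ge0_integral_dens//.
- apply: eq_integral => w _; congr (H _ * _)%E.
  by apply/funext => t; rewrite /Y subrK.
- exact: (measurableT_comp mH' mYy).
Qed.

End Tilt.
End CameronMartin.

(** * Independence and expectations *)

Section LawProbability.
Context d1 d2 (T1 : measurableType d1) (T2 : measurableType d2) (R : realType).
Variables (P : probability T1 R) (X : T1 -> T2).
Hypothesis mX : measurable_fun [set: T1] X.

Let law_setT : law P mX setT = 1%E.
Proof. rewrite /law /pushforward preimage_setT; exact: probability_setT. Qed.

HB.instance Definition _ := Measure_isProbability.Build _ _ R (law P mX) law_setT.

End LawProbability.

Section Independence.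
Context d d1 d2 (Om : measurableType d) (T1 : measurableType d1)
  (T2 : measurableType d2) (R : realType) (P : probability Om R).
Variables (X : Om -> T1) (Y : Om -> T2).
Hypothesis mX : measurable_fun [set: Om] X.
Hypothesis mY : measurable_fun [set: Om] Y.
Hypothesis XY : forall E1 E2, measurable E1 -> measurable E2 ->
  (P (X @^-1` E1 `&` Y @^-1` E2) = P (X @^-1` E1) * P (Y @^-1` E2))%E.

(** The joint law is the product of the marginals by uniqueness of the product measure; Tonelli then
    separates the variables. *)
Lemma ge0_integral_indep (H : T1 * T2 -> \bar R) :
  measurable_fun [set: T1 * T2] H -> (forall z, (0 <= H z)%E) ->
  (\int[P]_w H (X w, Y w) = \int[P]_w \int[P]_w' H (X w, Y w'))%E.
Proof.
move=> mH H0.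
have mXY : measurable_fun [set: Om] (fun w => (X w, Y w)) by exact: measurable_fun_pair.
pose l1 : probability T1 R := law P mX.
pose l2 : probability T2 R := law P mY.
transitivity (\int[law P mXY]_z H z)%E; first by rewrite ge0_integral_law.
transitivity (\int[(l1 \x l2)%E]_z H z)%E.
  apply: eq_measure_integral => E mE _; symmetry.
  apply: (@product_measure_unique _ _ _ _ R l1 l2 (law P mXY) _ E mE).
  by move=> A B mA mB; exact: XY.
rewrite fubini_tonelli1//.
have F0 x : (0 <= fubini_F l2 H x)%E by apply: integral_ge0.
rewrite ge0_integral_law//; last exact: measurable_fun_fubini_tonelli_F.
apply: eq_integral => w _.
rewrite /fubini_F ge0_integral_law//.
exact: (measurable_fun_pair2 _ mH).
Qed.

End Independence.

Section PathIndependence.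
Context {R : realType} d (Om : measurableType d).

(** Carries the independence hypothesis, which concerns [gen_sigma], over to events of the path
    space, including those of a rescaled process. *)
Lemma gen_sigma_path (X : @process R d Om) (I : set R) (Y : Om -> R -> R) :
  (forall t A, 0 <= t <= 1 -> measurable A ->
     gen_sigma X I ((fun w => Y w t) @^-1` A)) ->
  forall E : set (pathT R), measurable E -> gen_sigma X I (Y @^-1` E).
Proof.
move=> H; pose C := [set E : set (R -> R) | gen_sigma X I (Y @^-1` E)].
suff : <<s cyl01 >> `<=` C by move=> h E; exact: h.
have [s0 sD sU] := @smallest_sigma_algebra _ setT [set S | exists t, exists A : set R,
        I t /\ measurable A /\ S = X t @^-1` A].
apply: smallest_sub; last by move=> _ [t [A [t01 [mA ->]]]]; exact: H.
split.
- by rewrite /C /= preimage_set0; exact: s0.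
- move=> A CA; rewrite /C /= setTD preimage_setC -setTD; exact: sD.
- move=> A CA; rewrite /C /= preimage_bigcup; exact: sU.
Qed.

End PathIndependence.

Section Expectation.
Context d (Om : measurableType d) (R : realType) (P : probability Om R).

Implicit Types f g : Om -> R.

Definition mean (f : Om -> R) : R := fine (\int[P]_w (f w)%:E).

Definition bounded_meas (f : Om -> R) : Prop :=
  measurable_fun [set: Om] f /\ exists M, forall w, `|f w| <= M.

Lemma bounded_meas_integrable f : bounded_meas f -> P.-integrable setT (EFin \o f).
Proof. by move=> [mf [M fM]]; exact: (bounded_integrable P measurableT mf fM). Qed.

Lemma meanE f : bounded_meas f -> (mean f)%:E = (\int[P]_w (f w)%:E)%E.
Proof.
move=> bf; rewrite /mean fineK//; apply: integrable_fin_num => //.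
exact: bounded_meas_integrable.
Qed.

Lemma bounded_meas01 f : measurable_fun [set: Om] f -> (forall w, 0 <= f w <= 1) ->
  bounded_meas f.
Proof. by move=> mf f01; split=> //; exists 1 => w; have := f01 w; rewrite ler_norml; lra. Qed.

Lemma bounded_meas_cst c : bounded_meas (fun=> c).
Proof. by split; [exact: measurable_cst|exists `|c|]. Qed.

Lemma bounded_measD f g : bounded_meas f -> bounded_meas g ->
  bounded_meas (fun w => f w + g w).
Proof.
move=> [mf [M fM]] [mg [N gN]]; split; first exact: measurable_funD.
by exists (M + N) => w; rewrite (le_trans (ler_normD _ _))// lerD.
Qed.

Lemma bounded_measM f g : bounded_meas f -> bounded_meas g ->
  bounded_meas (fun w => f w * g w).
Proof.
move=> [mf [M fM]] [mg [N gN]]; split; first exact: measurable_funM.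
by exists (M * N) => w; rewrite normrM ler_pM.
Qed.

Lemma meanD f g : bounded_meas f -> bounded_meas g ->
  mean (fun w => f w + g w) = mean f + mean g.
Proof.
move=> bf bg; apply: (@RintegralD _ _ _ P setT) => //; exact: bounded_meas_integrable.
Qed.

Lemma le_mean f g : bounded_meas f -> bounded_meas g -> (forall w, f w <= g w) ->
  mean f <= mean g.
Proof.
by move=> bf bg fg; apply: (@le_Rintegral _ _ _ P setT) => //;
  exact: bounded_meas_integrable.
Qed.

Lemma mean_cst c : mean (fun=> c) = c.
Proof.
rewrite /mean integral_cst// [X in (_ * X)%E](_ : _ = 1%E) ?mule1//.
exact: probability_setT.
Qed.

Lemma mean_indic (A : set Om) : measurable A -> mean \1_A = fine (P A).
Proof. by move=> mA; rewrite /mean integral_indic// setIT. Qed.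

Lemma meanZ c f : bounded_meas f -> mean (fun w => c * f w) = c * mean f.
Proof.
move=> bf; apply: (@RintegralZl _ _ _ P setT) => //; exact: bounded_meas_integrable.
Qed.

Lemma mean_ge0 f : (forall w, 0 <= f w) -> 0 <= mean f.
Proof. by move=> f0; apply: fine_ge0; apply: integral_ge0 => w _; rewrite lee_fin. Qed.

Lemma bounded_meas_indic (A : set Om) : measurable A -> bounded_meas (\1_A : Om -> R).
Proof.
move=> mA; apply: bounded_meas01 => [|w]; first exact: measurable_indic.
by rewrite indicE; case: (_ \in _) => /=; lra.
Qed.

End Expectation.

Section Splice.
Context {R : realType}.

Lemma measurable_splice d (Om : measurableType d) (X Y : Om -> R -> R) :
  measurable_fun [set: Om] (X : Om -> pathT R) ->
  measurable_fun [set: Om] (Y : Om -> pathT R) ->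
  measurable_fun [set: Om] ((fun w => splice (X w) (Y w)) : Om -> pathT R).
Proof.
move=> mX mY; apply: measurable_pathP => t t01; rewrite /splice.
have mXt u : 0 <= u <= 1 -> measurable_fun [set: Om] (fun w => X w u).
  by move=> u01; exact: (measurableT_comp (measurable_ev u01) mX).
have mYt u : 0 <= u <= 1 -> measurable_fun [set: Om] (fun w => Y w u).
  by move=> u01; exact: (measurableT_comp (measurable_ev u01) mY).
have [t2|t2] := leP t (1/2).
  by apply: measurable_funM => //; apply: mXt; lra.
apply: measurable_funD; apply: measurable_funM => //; first by apply: mXt; lra.
by apply: mYt; lra.
Qed.

Lemma invsqrt2_01 : 0 < (Num.sqrt 2 : R)^-1 <= 1.
Proof.
rewrite invr_gt0 sqrtr_gt0 ltr0n/= invf_le1 ?sqrtr_gt0//.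
by rewrite -[leLHS]sqrtr1 ler_wsqrtr// ler1n.
Qed.

Lemma splice_dist (x x' y : R -> R) (dl : R) :
  (forall t, 0 <= t <= 1 -> `|x t - x' t| <= dl) ->
  forall t, 0 <= t <= 1 -> `|splice x y t - splice x' y t| <= dl.
Proof.
have /andP[r0 r1] := invsqrt2_01.
move=> H t t01; rewrite /splice.
have K u : 0 <= u <= 1 -> `|(Num.sqrt 2)^-1 * (x u - x' u)| <= dl.
  move=> u01; rewrite normrM (gtr0_norm r0); apply: le_trans (H u u01).
  by rewrite ler_piMl.
have [t2|t2] := leP t (1/2).
  by rewrite -mulrBr; apply: K; lra.
rewrite (_ : _ - _ = (Num.sqrt 2)^-1 * (x 1 - x' 1)); last ring.
by apply: K; rewrite lexx ler01.
Qed.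

(** Moves the level into the path. When the level depends on another path, measurability then
    reduces to the fixed event [above_dy 0]. *)
Lemma above_dy_shift (a : R) (y : R -> R) :
  above_dy a y <-> above_dy 0 (fun t => y t + a).
Proof.
split=> h [n _ [k k2 yk]]; apply: h; exists n => //; exists k => //; move: yk; lra.
Qed.

Lemma above_dy_le (a b : R) : a <= b -> above_dy a `<=` above_dy b.
Proof.
move=> ab y h [n _ [k k2 yk]]; apply: h; exists n => //; exists k => //.
by apply: lt_le_trans yk _; rewrite lerN2.
Qed.

Lemma above_dy_splice (a : R) (x y : R -> R) : cont01 x -> cont01 y -> y 0 = 0 ->
  above_dy ((Num.sqrt 2)^-1 * a) (splice x y) <->
  above_dy a x /\ above_dy (x 1 + a) y.
Proof.
have /andP[r0 r1] := invsqrt2_01.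
move=> cx cy y0; rewrite !above_dyP//; last exact: cont01_splice.
split.
  move=> h; split=> t t01.
    have := h (t / 2) _; rewrite /splice ifT; last lra.
    rewrite mulrCA divff// mulr1 -mulrN ler_pM2l//; apply; lra.
  have := h ((t + 1) / 2) _; rewrite spliceE2//; last lra.
  rewrite mulrCA divff// mulr1 addrK -mulrDr -mulrN ler_pM2l// => h'.
  have : - a <= x 1 + y t by apply: h'; lra.
  lra.
move=> [h1 h2] t t01; have [t2|t2] := leP t (1/2).
  by rewrite /splice t2 -mulrN ler_pM2l//; apply: h1; lra.
rewrite spliceE2//; last exact: ltW.
rewrite -mulrDr -mulrN ler_pM2l//.
have := h2 (2 * t - 1) _; lra.
Qed.

End Splice.

(** * Decomposition of the meander at time 1/2 *)

Section DependsOn01.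
Context {R : realType}.

Lemma cyl01_depends (E : set (R -> R)) : <<s cyl01 >> E ->
  forall x y, (forall t, 0 <= t <= 1 -> x t = y t) -> E x -> E y.
Proof.
pose C := [set E : set (R -> R) | forall x y, (forall t, 0 <= t <= 1 -> x t = y t) ->
  E x -> E y].
suff : <<s cyl01 >> `<=` C by apply.
apply: smallest_sub.
  split.
  - by [].
  - move=> A CA x y xy [_ Ax]; split=> // Ay; apply: Ax; apply: (CA y) => // t t01.
    by rewrite xy.
  - by move=> A CA x y xy [n _ An]; exists n => //; exact: (CA n x).
move=> _ [t [A [t01 [mA ->]]]] x y xy /=.
by rewrite /preimage /= xy.
Qed.

(** A cylinder event cannot separate paths that agree on [0,1]; here the event is the level set of
    [Phi] through [x]. *)
Lemma measurable_depends (Phi : (R -> R) -> R) :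
  measurable_fun [set: pathT R] (Phi : pathT R -> R) -> depends_on_01 Phi.
Proof.
move=> mPhi x y xy.
have := mPhi measurableT _ (measurable_set1 (Phi x)); rewrite setTI => h.
by have /(_ erefl) -> := cyl01_depends h xy.
Qed.

(** Uniformity over paths is essential: [continuation] evaluates the functional at the splices with
    every [b w], and one [dl] must serve them all. *)
Definition unif_sup_continuous (H : (R -> R) -> R) : Prop :=
  forall e, 0 < e -> exists2 dl, 0 < dl & forall x y, cont01 x -> cont01 y ->
    (forall t, 0 <= t <= 1 -> `|x t - y t| <= dl) -> `|H x - H y| <= e.

End DependsOn01.

Section Continuation.
Context {R : realType} d (Om : measurableType d) (P : probability Om R).
Variable b : Om -> R -> R.
Hypothesis bmb : path_bm P b.
Variable H : (R -> R) -> R.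
Hypothesis mH : measurable_fun [set: pathT R] (H : pathT R -> R).
Hypothesis H01 : forall x, 0 <= H x <= 1.

Let mb : measurable_fun [set: Om] (b : Om -> pathT R). Proof. by case: bmb. Qed.
Let cb w : cont01 (b w). Proof. by case: bmb. Qed.
Let b0 w : b w 0 = 0. Proof. by case: bmb. Qed.

(** By [above_dy_splice], once [x] stays above [- c] the indicator says that the splice stays above
    [- c / sqrt 2]. *)
Definition cont_weight (c : R) (x y : R -> R) : R :=
  H (splice x y) * \1_(above_dy (x 1 + c)) y.

Lemma cont_weight01 c x y : 0 <= cont_weight c x y <= 1.
Proof.
rewrite /cont_weight indicE; have /andP[h0 h1] := H01 (splice x y).
by case: (_ \in _); rewrite ?mulr1 ?mulr0 ?h0 ?h1 ?lexx ?ler01.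
Qed.

Lemma measurable_cont_weight c d' (O : measurableType d') (X Y : O -> R -> R) :
  measurable_fun [set: O] (X : O -> pathT R) ->
  measurable_fun [set: O] (Y : O -> pathT R) ->
  measurable_fun [set: O] (fun w => cont_weight c (X w) (Y w)).
Proof.
move=> mX mY; apply: measurable_funM.
  exact: (measurableT_comp mH (measurable_splice mX mY)).
rewrite (_ : (fun w => _) = (fun w => \1_(above_dy 0) (fun t => Y w t + (X w 1 + c)))).
  apply: (@measurableT_comp _ _ _ _ _ _ (\1_(above_dy 0) : pathT R -> R) _
    (fun w => (fun t => Y w t + (X w 1 + c)) : pathT R)).
    by apply: measurable_indic; exact: measurable_above_dy.
  have t1 : 0 <= (1 : R) <= 1 by rewrite lexx ler01.
  apply: measurable_pathP => t t01; apply: measurable_funD.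
    exact: (measurableT_comp (measurable_ev t01) mY).
  apply: measurable_funD => //; exact: (measurableT_comp (measurable_ev t1) mX).
apply/funext => w; rewrite !indicE; congr (_%:R); congr nat_of_bool.
have [h h'] := above_dy_shift (X w 1 + c) (Y w).
by apply/idP/idP; rewrite !inE => k; [exact: h|exact: h'].
Qed.

(** Expectation over the second half with the first half [x] frozen. *)
Definition continuation (c : R) (x : R -> R) : R := mean P (fun w => cont_weight c x (b w)).

Lemma bounded_cont_weight c x : bounded_meas (fun w => cont_weight c x (b w)).
Proof.
apply: bounded_meas01 => [|w]; last exact: cont_weight01.
by apply: measurable_cont_weight => //; exact: measurable_cst.
Qed.

Lemma continuation01 c x : 0 <= continuation c x <= 1.
Proof.
have h w := cont_weight01 c x (b w).
apply/andP; split; first by apply: mean_ge0 => w; have /andP[] := h w.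
rewrite -[leRHS](mean_cst P 1); apply: le_mean.
- exact: bounded_cont_weight.
- exact: bounded_meas_cst.
- by move=> w; have /andP[] := h w.
Qed.

Let above a : set Om := b @^-1` above_dy a.

Let mabove a : measurable (above a).
Proof. by rewrite -[X in measurable X]setTI; apply: mb => //; exact: measurable_above_dy. Qed.

Let mean_above a : mean P \1_(above a) = survival a.
Proof. by rewrite mean_indic//; exact: path_bm_survival. Qed.

Let lip : R := 2 * normal_peak 1.

(** As [H] lies between 0 and 1, the weighted indicator grows by at most as much as the indicator
    itself, whose mean is Lipschitz by [survival_lip]. The comparison is made between sums, so no
    difference appears under [mean]. *)
Lemma continuation_le c x : 0 <= c ->
  continuation 0 x <= continuation c x <= continuation 0 x + lip * c.
Proof.
move=> c0; have sub : above (x 1 + 0) `<=` above (x 1 + c).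
  by move=> w; apply: above_dy_le; rewrite lerD2l.
have ind w : (\1_(above (x 1 + 0)) w : R) <= \1_(above (x 1 + c)) w.
  rewrite !indicE; case: (boolP (w \in above (x 1 + 0))) => [|_ //].
  by rewrite inE => /sub h; rewrite mem_set.
have bw := bounded_cont_weight.
have bi a : bounded_meas (\1_(above a) : Om -> R) by exact: bounded_meas_indic.
apply/andP; split.
  apply: le_mean => // w; rewrite /cont_weight ler_wpM2l//.
    by have /andP[] := H01 (splice x (b w)).
  exact: ind.
have : mean P (fun w => cont_weight c x (b w) + \1_(above (x 1 + 0)) w) <=
    mean P (fun w => cont_weight 0 x (b w) + \1_(above (x 1 + c)) w).
  apply: le_mean; [exact: bounded_measD|exact: bounded_measD|move=> w].
  rewrite /cont_weight; have /andP[h0 h1] := H01 (splice x (b w)).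
  have := ind w.
  have E a : \1_(above a) w = \1_(above_dy a) (b w) :> R by rewrite !indicE.
  rewrite !E; move: (\1_(above_dy (x 1 + 0)) (b w)) (\1_(above_dy (x 1 + c)) (b w)) => u v.
  nra.
rewrite !meanD// !mean_above => h.
have := @survival_lip R (x 1 + 0) (x 1 + c); rewrite lerD2l => /(_ c0) /andP[_].
rewrite /continuation -/lip.
rewrite (_ : x 1 + c - (x 1 + 0) = c); last ring.
lra.
Qed.

(** The ends of [x] and [y] differ by at most [dl], so the event for [x] is contained in that for
    [y] with the level relaxed by [dl]; [continuation_le] bounds the cost. *)
Lemma continuation_near x y e dl : cont01 x -> cont01 y -> 0 <= dl ->
  (forall t, 0 <= t <= 1 -> `|x t - y t| <= dl) ->
  (forall w, `|H (splice x (b w)) - H (splice y (b w))| <= e) ->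
  continuation 0 x <= continuation 0 y + e + lip * dl.
Proof.
move=> cx cy dl0 xy He.
have e0 : 0 <= e.
  rewrite -(mean_cst P e); apply: mean_ge0 => w; exact: le_trans (normr_ge0 _) (He w).
apply: (@le_trans _ _ (continuation dl y + e)).
  rewrite /continuation -[e in leRHS](mean_cst P e) -meanD; last 2 first.
  - exact: bounded_cont_weight.
  - exact: bounded_meas_cst.
  apply: le_mean; [exact: bounded_cont_weight| |].
    by apply: bounded_measD; [exact: bounded_cont_weight|exact: bounded_meas_cst].
  move=> w; rewrite /cont_weight !indicE addr0.
  have /andP[h0 h1] := H01 (splice y (b w)).
  have := He w; rewrite ler_norml => /andP[h2 h3].
  case: (boolP (b w \in above_dy (x 1))) => [|_]; last first.
    by rewrite mulr0 addr_ge0// mulr_ge0.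
  rewrite inE => h; rewrite mem_set; first by rewrite !mulr1; lra.
  apply: above_dy_le h.
  have := xy 1; rewrite lexx ler01 => /(_ isT); rewrite ler_norml; lra.
have := continuation_le y dl0; lra.
Qed.

Hypothesis ucH : unif_sup_continuous H.

(** This admits [continuation] as a test functional in [is_meander]: the indicator is discontinuous
    in [x], but its average over [b] is not. *)
Lemma continuation_sup_continuous : sup_continuous (continuation 0).
Proof.
move=> x cx e e0.
have e4 : 0 < e / 4 by lra.
have [dl dl0 K] := ucH e4.
have lip0 : 0 < lip by rewrite /lip mulr_gt0// normal_peak_gt0.
pose dl' := Num.min dl (e / 4 / lip).
have dl'0 : 0 < dl' by rewrite lt_min dl0/= divr_gt0.
exists dl' => // y cy xy.
have le1 : dl' <= dl by rewrite ge_min lexx.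
have le2 : lip * dl' <= e / 4.
  by rewrite mulrC -ler_pdivlMr// ge_min lexx orbT.
have Hxy w : `|H (splice x (b w)) - H (splice y (b w))| <= e / 4.
  apply: K; [exact: cont01_splice|exact: cont01_splice|].
  apply: splice_dist => t t01; exact: le_trans (xy t t01) le1.
have Hyx w : `|H (splice y (b w)) - H (splice x (b w))| <= e / 4.
  by rewrite distrC.
have yx t : 0 <= t <= 1 -> `|y t - x t| <= dl' by rewrite distrC; exact: xy.
have := continuation_near cx cy (ltW dl'0) xy Hxy.
have := continuation_near cy cx (ltW dl'0) yx Hyx.
rewrite ltr_norml; lra.
Qed.

Lemma continuation_depends : depends_on_01 (continuation 0).
Proof.
move=> x y xy; rewrite /continuation; congr (mean P _); apply/funext => w.
rewrite /cont_weight xy ?lexx ?ler01//; congr (_ * _).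
apply: measurable_depends => // t t01; rewrite /splice.
case: leP => t2; first by rewrite xy//; lra.
by rewrite xy// lexx ler01.
Qed.

End Continuation.

Section MeanEq.
Context d1 d2 (O1 : measurableType d1) (O2 : measurableType d2) (R : realType).

Lemma ge0_integral_eq_law (mu1 : {measure set O1 -> \bar R})
    (mu2 : {measure set O2 -> \bar R}) (X1 : O1 -> R -> R) (X2 : O2 -> R -> R)
    (H : pathT R -> \bar R) :
  measurable_fun [set: O1] (X1 : O1 -> pathT R) ->
  measurable_fun [set: O2] (X2 : O2 -> pathT R) ->
  (forall E : set (pathT R), measurable E -> mu1 (X1 @^-1` E) = mu2 (X2 @^-1` E)) ->
  measurable_fun [set: pathT R] H -> (forall x, (0 <= H x)%E) ->
  (\int[mu1]_w H (X1 w) = \int[mu2]_w H (X2 w))%E.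
Proof.
move=> mX1 mX2 E mH H0.
rewrite -(ge0_integral_law mu1 mX1 mH H0) -(ge0_integral_law mu2 mX2 mH H0).
by apply: eq_measure_integral => A mA _; exact: E.
Qed.

End MeanEq.

Section MeanderSplit.
Context {R : realType} d (Om : measurableType d) (P : probability Om R).
Variables m B : @process R d Om.
Hypothesis mer : is_meander P m.
Hypothesis BM : is_BM P B.
Hypothesis ind : indep_processes P m `[0, 1] B `[0, +oo[.

Let r : R := (Num.sqrt 2)^-1.
Let s2 : R := Num.sqrt 2.
Let s20 : 0 < s2. Proof. by rewrite sqrtr_gt0. Qed.
Let b : Om -> R -> R := bm_scale B s2.

Lemma path_bm_half : path_bm P b. Proof. exact: path_bm_scale. Qed.

Lemma path_bm_traj : path_bm P (traj B).
Proof.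
have -> : traj B = bm_scale B 1.
  by apply/funext => w; apply/funext => t; rewrite /bm_scale mul1r expr1n divr1.
exact: path_bm_scale.
Qed.

Lemma measurable_meander : measurable_fun [set: Om] (traj m : Om -> pathT R).
Proof. by case: mer => mm _ _; apply: measurable_pathP. Qed.

Let mm := measurable_meander.
Let mb : measurable_fun [set: Om] (b : Om -> pathT R). Proof. by case: path_bm_half. Qed.
Let mB : measurable_fun [set: Om] (traj B : Om -> pathT R). Proof. by case: path_bm_traj. Qed.
Let cm w : cont01 (traj m w). Proof. by case: mer => _ + _; apply. Qed.
Let cb w : cont01 (b w). Proof. by case: path_bm_half. Qed.
Let cB w : cont01 (traj B w). Proof. by case: path_bm_traj. Qed.
Let b0 w : b w 0 = 0. Proof. by case: path_bm_half. Qed.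

Lemma meander_indep_path (E1 E2 : set (pathT R)) : measurable E1 -> measurable E2 ->
  (P (traj m @^-1` E1 `&` b @^-1` E2) = P (traj m @^-1` E1) * P (b @^-1` E2))%E.
Proof.
move=> mE1 mE2; apply: ind.
- apply: (@gen_sigma_path _ _ _ m `[0, 1] (traj m)) => // t A t01 mA.
  by apply: sub_sigma_algebra; exists t, A; split; rewrite //= in_itv.
- apply: (@gen_sigma_path _ _ _ B `[0, +oo[ b) => // t A /andP[t0 t1] mA.
  apply: sub_sigma_algebra; exists (t / s2 ^+ 2), ((fun x => s2 * x) @^-1` A).
  split; first by rewrite /= in_itv/= andbT divr_ge0// sqr_ge0.
  by split=> //; rewrite -[X in measurable X]setTI; exact: mulrl_measurable.
Qed.

Section UniformlyContinuous.
Variable H : (R -> R) -> R.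
Hypothesis mH : measurable_fun [set: pathT R] (H : pathT R -> R).
Hypothesis H01 : forall x, 0 <= H x <= 1.

Let mind a : measurable_fun [set: pathT R] (\1_(above_dy a) : pathT R -> R).
Proof. by apply: measurable_indic; exact: measurable_above_dy. Qed.

Lemma mean_continuation_meander :
  mean P (fun w => continuation P b H 0 (traj m w)) =
  mean P (fun w => cont_weight H 0 (traj m w) (b w)).
Proof.
pose K (z : pathT R * pathT R) : \bar R := (cont_weight H 0 z.1 z.2)%:E.
have mK : measurable_fun [set: pathT R * pathT R] K.
  by apply/measurable_EFinP; apply: (measurable_cont_weight mH);
    [exact: measurable_fst|exact: measurable_snd].
have K0 z : (0 <= K z)%E by rewrite lee_fin; have /andP[] := cont_weight01 H01 0 z.1 z.2.
congr fine; rewrite (ge0_integral_indep mm mb meander_indep_path mK K0).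
apply: eq_integral => w _; rewrite /continuation meanE//.
exact: (bounded_cont_weight path_bm_half).
Qed.

(** [traj B] and [b] come from the same Brownian motion, so the independent second half is taken on
    the second factor of a product space. *)
Let Z (w : Om * Om) : R -> R := splice (traj B w.1) (b w.2).

Let mZ : measurable_fun [set: Om * Om] (Z : Om * Om -> pathT R).
Proof.
by apply: measurable_splice; [exact: (measurableT_comp mB measurable_fst)|
  exact: (measurableT_comp mb measurable_snd)].
Qed.

Lemma splice_bm_law (E : set (pathT R)) : measurable E ->
  P (traj B @^-1` E) = (P \x P)%E (Z @^-1` E).
Proof.
have [_ _ B0 gB] := path_bm_traj; have [_ _ _ gb] := path_bm_half.
(* Levels start at 1 because splicing raises the level by one. *)
apply: (@eq_law_path _ 1 _ _ _ _ P (P \x P)%E (traj B) Z mB mZ) => //.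
- by move=> w; exact: cont01_splice.
- by move=> w; rewrite /Z /splice ifT ?mulr0 ?B0 ?mulr0//; lra.
- by case=> // n _; apply: grid_law_splice.
Qed.

(** Markov property at time 1/2 in scaled form: [B] has the law of the splice, and [above_dy_splice]
    factors the event. *)
Lemma mean_continuation_bm e :
  mean P (fun w => continuation P b H e (traj B w) * \1_(above_dy e) (traj B w)) =
  mean P (fun w => H (traj B w) * \1_(above_dy (r * e)) (traj B w)).
Proof.
pose K (x : pathT R) : \bar R := (H x * \1_(above_dy (r * e)) x)%:E.
have mK : measurable_fun [set: pathT R] K.
  by apply/measurable_EFinP; apply: measurable_funM.
have K0 x : (0 <= K x)%E by rewrite lee_fin mulr_ge0//; have /andP[] := H01 x.
apply/esym; congr fine; rewrite -/(K _).
rewrite (ge0_integral_eq_law mB mZ splice_bm_law mK K0).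
rewrite fubini_tonelli1//; last exact: (measurableT_comp mK mZ).
apply: eq_integral => w _; rewrite /fubini_F.
rewrite mulrC -meanZ; last exact: (bounded_cont_weight path_bm_half).
rewrite meanE; last first.
  apply: bounded_measM; first exact: bounded_meas_cst.
  exact: (bounded_cont_weight path_bm_half).
apply: eq_integral => w' _; rewrite /K /cont_weight /=; congr EFin.
have [h h'] := above_dy_splice e (@cB w) (@cb w') (b0 w').
rewrite /Z /= mulrCA; congr (_ * _).
rewrite !indicE -natrM mulnb; congr (_%:R); congr nat_of_bool.
apply/idP/andP; rewrite !inE => k; [exact: h|exact: h'].
Qed.

Hypothesis ucH : unif_sup_continuous H.

Lemma above_preimage e : above B e = traj B @^-1` above_dy e.
Proof.
by apply/seteqP; split=> w /=; have [h h'] := above_dyP e (@cB w); [exact: h'|exact: h].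
Qed.

Lemma measurable_continuation c :
  measurable_fun [set: pathT R] (continuation P b H c : pathT R -> R).
Proof.
pose K (z : pathT R * Om) : \bar R := (cont_weight H c z.1 (b z.2))%:E.
have mK : measurable_fun [set: pathT R * Om] K.
  apply/measurable_EFinP; apply: (measurable_cont_weight mH).
    exact: measurable_fst.
  exact: (measurableT_comp mb measurable_snd).
have K0 z : (0 <= K z)%E.
  by rewrite lee_fin; have /andP[] := cont_weight01 H01 c z.1 (b z.2).
rewrite (_ : (continuation P b H c : pathT R -> R) = fine \o fubini_F P K)//.
apply: measurableT_comp; first exact: fine_measurable.
exact: measurable_fun_fubini_tonelli_F.
Qed.

Let lip : R := 2 * normal_peak 1.

(** The level of the second half moves only on an event of probability [survival e], at a cost of at
    most [lip * e] there. After division by [survival e] the error still tends to 0. *)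
Lemma continuation_bm_error e : 0 < e ->
  `|mean P (fun w => H (traj B w) * \1_(above_dy (r * e)) (traj B w)) -
    mean P (fun w => continuation P b H 0 (traj B w) * \1_(above_dy e) (traj B w))|
  <= lip * e * survival e.
Proof.
move=> e0; rewrite -mean_continuation_bm.
have mA : measurable (traj B @^-1` above_dy e).
  by rewrite -[X in measurable X]setTI; apply: mB => //; exact: measurable_above_dy.
have IA : (fun w => \1_(above_dy e) (traj B w) : R) = \1_(traj B @^-1` above_dy e).
  by apply/funext => w; rewrite !indicE.
have bI : bounded_meas (fun w => \1_(above_dy e) (traj B w) : R).
  by rewrite IA; exact: bounded_meas_indic.
have bC c : bounded_meas (fun w => continuation P b H c (traj B w)).
  apply: bounded_meas01; first exact: (measurableT_comp (measurable_continuation c) mB).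
  by move=> w; exact: (continuation01 path_bm_half).
have bCI c : bounded_meas (fun w => continuation P b H c (traj B w) *
    \1_(above_dy e) (traj B w)) by exact: bounded_measM.
have i0 w : 0 <= (\1_(above_dy e) (traj B w) : R) by [].
have h1 : mean P (fun w => continuation P b H 0 (traj B w) * \1_(above_dy e) (traj B w)) <=
    mean P (fun w => continuation P b H e (traj B w) * \1_(above_dy e) (traj B w)).
  apply: le_mean => // w; rewrite ler_wpM2r//.
  by have /andP[] := continuation_le path_bm_half mH H01 (traj B w) (ltW e0).
have bLI : bounded_meas (fun w => lip * e * (\1_(above_dy e) (traj B w))).
  by apply: bounded_measM => //; exact: bounded_meas_cst.
have h2 : mean P (fun w => continuation P b H e (traj B w) * \1_(above_dy e) (traj B w)) <=
    mean P (fun w => continuation P b H 0 (traj B w) * \1_(above_dy e) (traj B w) +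
       lip * e * (\1_(above_dy e) (traj B w))).
  apply: le_mean => //; first exact: bounded_measD.
  move=> w; rewrite -mulrDl ler_wpM2r//.
  by have /andP[] := continuation_le path_bm_half mH H01 (traj B w) (ltW e0).
have E : mean P (fun w => \1_(above_dy e) (traj B w)) = survival e.
  by rewrite -(path_bm_survival e path_bm_traj) IA mean_indic.
rewrite meanD// meanZ// E in h2.
by rewrite ger0_norm ?subr_ge0// lerBlDl.
Qed.

Lemma cvg_scale_at_right0 (k : R) : 0 < k -> k * e @[e --> 0^'+] --> 0^'+.
Proof.
move=> k0 U /nbhs_ballP [dl /= dl0 HU]; apply/nbhs_ballP.
exists (dl / k) => /=; first exact: divr_gt0.
move=> e; rewrite /ball/= sub0r normrN => ek e0.
apply: HU => /=; last exact: mulr_gt0.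
by rewrite /ball/= sub0r normrN normrM (gtr0_norm k0) mulrC -ltr_pdivlMr.
Qed.

(** [N (r * e) / survival e] has two limits, [c3] and [c6], which must coincide. *)
Lemma mean_above_meander :
  mean P (fun w => cont_weight H 0 (traj m w) (b w)) = r * mean P (fun w => H (traj m w)).
Proof.
have [_ _ /(_ B BM) lim] := mer.
have /andP[r0 r1] := invsqrt2_01 (R := R).
have PE e : fine (P (above B e)) = survival e.
  by rewrite above_preimage; exact: (path_bm_survival e path_bm_traj).
have IE e w : \1_(above B e) w = \1_(above_dy e) (traj B w) :> R.
  by rewrite above_preimage !indicE.
pose N e := mean P (fun w => H (traj B w) * \1_(above_dy e) (traj B w)).
pose M e := mean P (fun w => continuation P b H 0 (traj B w) * \1_(above_dy e) (traj B w)).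
have c1 : N e / survival e @[e --> 0^'+] --> mean P (fun w => H (traj m w)).
  have := lim H.
  have bH : bounded_fun_on H by exists 1 => x; have := H01 x; rewrite ler_norml; lra.
  have sH : sup_continuous H.
    move=> x cx e e0; have e20 : 0 < e / 2 by lra.
    have [dl dl0 K] := ucH e20; exists dl => // y cy xy.
    by apply: le_lt_trans (K x y cx cy xy) _; lra.
  move=> /(_ bH sH (measurable_depends mH)).
  rewrite (_ : (fun eps : R => _) = (fun e => N e / survival e))//.
  apply/funext => e; rewrite PE /N /mean; congr (fine _ / _).
  by apply: eq_integral => w _; rewrite IE.
have c2 : M e / survival e @[e --> 0^'+] -->
    mean P (fun w => cont_weight H 0 (traj m w) (b w)).
  rewrite -mean_continuation_meander.
  have := lim (continuation P b H 0).
  have bH : bounded_fun_on (continuation P b H 0).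
    exists 1 => x; have := continuation01 path_bm_half mH H01 0 x; rewrite ler_norml; lra.
  move=> /(_ bH (continuation_sup_continuous path_bm_half mH H01 ucH)
    (continuation_depends P b mH)).
  rewrite (_ : (fun eps : R => _) = (fun e => M e / survival e))//.
  apply/funext => e; rewrite PE /M /mean; congr (fine _ / _).
  by apply: eq_integral => w _; rewrite IE.
(* Conditioning at level [r * e] gives the meander, and [survival_ratio] accounts for dividing by
   [survival e] instead. *)
have c3 : N (r * e) / survival e @[e --> 0^'+] --> r * mean P (fun w => H (traj m w)).
  have c4 := cvg_comp (fun e => r * e) (fun e => N e / survival e)
    (cvg_scale_at_right0 r0) c1.
  have c5 : survival (r * e) / survival e * (N (r * e) / survival (r * e))
      @[e --> 0^'+] --> r * mean P (fun w => H (traj m w)).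
    exact: (cvgM (survival_ratio r0) c4).
  apply: cvg_trans; last exact: c5.
  apply: near_eq_cvg; near=> e.
  have e0 : 0 < e by near: e; exact: nbhs_right_gt.
  have re0 : 0 < r * e by exact: mulr_gt0.
  move: (survival_gt0 re0) (survival_gt0 e0) => /=.
  move: (N _) (survival (r * e)) (survival e) => n p q p0 q0.
  by field; rewrite !gt_eqF.
(* Splitting at time 1/2 replaces the numerator by [M e], a conditioning of the first half alone at
   level [e]. *)
have c6 : N (r * e) / survival e @[e --> 0^'+] -->
    mean P (fun w => cont_weight H 0 (traj m w) (b w)).
  have c7 : lip * e @[e --> 0^'+] --> (0 : R).
    rewrite -[X in _ --> X](mulr0 lip); apply: cvgMr.
    by apply: cvg_at_right_filter; exact: cvg_id.
  have c8 : N (r * e) / survival e - M e / survival e @[e --> 0^'+] --> (0 : R).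
    apply/cvgrPdist_le => k k0; near=> e.
    have e0 : 0 < e by near: e; exact: nbhs_right_gt.
    have s0 := survival_gt0 e0.
    rewrite sub0r normrN -mulrBl normrM [X in _ * X]gtr0_norm ?invr_gt0//.
    rewrite ler_pdivrMr//; apply: le_trans (continuation_bm_error e0) _.
    rewrite ler_wpM2r//; first exact: ltW.
    apply: (le_trans (ler_norm _)); near: e.
    have /cvgrPdist_le /(_ _ k0) := c7.
    by apply: filterS => e; rewrite sub0r normrN.
  have c9 : N (r * e) / survival e - M e / survival e + M e / survival e @[e --> 0^'+]
      --> 0 + mean P (fun w => cont_weight H 0 (traj m w) (b w)).
    exact: (cvgD c8 c2).
  rewrite add0r in c9; rewrite (_ : (fun e => N (r * e) / survival e) =
    (fun e => N (r * e) / survival e - M e / survival e + M e / survival e))//.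
  by apply/funext => e; rewrite subrK.
exact: (cvg_unique _ c6 c3).
Unshelve. all: end_near. Qed.

End UniformlyContinuous.
End MeanderSplit.

(** * From continuous functionals to the law of the meander *)

Section Approximable.
Context {R : realType}.

(* The limit defining the meander only tests continuous functionals, so its law is first
   identified on this pi-system of events. *)
Definition approximable : set (set (R -> R)) := [set E | exists g : nat -> (R -> R) -> R,
  [/\ forall j, measurable_fun [set: pathT R] (g j : pathT R -> R),
      forall j x, 0 <= g j x <= 1, forall j, unif_sup_continuous (g j) &
      forall x, g j x @[j --> \oo] --> (\1_E x : R)]].

Lemma approximable_setI : setI_closed approximable.
Proof.
move=> E F [g [mg g01 ug cg]] [h [mh h01 uh ch]].
exists (fun j x => g j x * h j x); split.
- by move=> j; exact: measurable_funM.
- move=> j x; have := g01 j x; have := h01 j x; nra.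
- move=> j e e0; have e20 : 0 < e / 2 by lra.
  have [d1 d10 K1] := ug j _ e20; have [d2 d20 K2] := uh j _ e20.
  exists (Num.min d1 d2); first by rewrite lt_min d10.
  move=> x y cx cy xy.
  have := K1 x y cx cy; have := K2 x y cx cy.
  have h1 t : 0 <= t <= 1 -> `|x t - y t| <= d1.
    by move=> /xy /le_trans; apply; rewrite ge_min lexx.
  have h2 t : 0 <= t <= 1 -> `|x t - y t| <= d2.
    by move=> /xy /le_trans; apply; rewrite ge_min lexx orbT.
  move=> /(_ h2) k2 /(_ h1) k1.
  rewrite (_ : _ - _ = g j x * (h j x - h j y) + (g j x - g j y) * h j y); last ring.
  apply: (le_trans (ler_normD _ _)); rewrite !normrM.
  have a1 : `|g j x| <= 1 by rewrite ler_norml; have := g01 j x; lra.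
  have a2 : `|h j y| <= 1 by rewrite ler_norml; have := h01 j y; lra.
  have b1 : `|g j x| * `|h j x - h j y| <= 1 * (e / 2) by rewrite ler_pM.
  have b2 : `|g j x - g j y| * `|h j y| <= e / 2 * 1 by rewrite ler_pM.
  lra.
- move=> x; rewrite indicI; exact: cvgM.
Qed.

Lemma approximable_setT : approximable setT.
Proof.
exists (fun _ _ => 1); split.
- by move=> j; exact: measurable_cst.
- by move=> j x; lra.
- by move=> j e e0; exists 1 => // x y *; rewrite subrr normr0 ltW.
- by move=> x; rewrite indicT; exact: cvg_cst.
Qed.

Lemma approximable_measurable : approximable `<=` @measurable _ (pathT R).
Proof.
move=> E [g [mg _ _ cg]].
have mE : measurable_fun [set: pathT R] (\1_E : pathT R -> R).
  by apply: (measurable_fun_cvg mg) => x _; exact: cg.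
have := mE measurableT _ (measurable_set1 1); rewrite setTI.
congr measurable; apply/seteqP; split=> x /=; rewrite indicE.
  by case: (boolP (x \in E)) => [/set_mem//|_ /eqP]; rewrite eq_sym oner_eq0.
by move=> Ex; rewrite mem_set.
Qed.

Definition clamp (v : R) : R := Num.max 0 (Num.min 1 v).

Lemma clamp01 v : 0 <= clamp v <= 1.
Proof. by rewrite /clamp le_max lexx/= ge_max ler01 ge_min lexx. Qed.

Lemma clamp_lip u v : `|clamp u - clamp v| <= `|u - v|.
Proof.
rewrite /clamp; apply: (@le_trans _ _ `|Num.min u 1 - Num.min v 1|); last exact: min_lip.
rewrite ![Num.min 1 _]minC; move: (Num.min u 1) (Num.min v 1) => {}u {}v.
by rewrite ler_norml; case: (leP 0 u) => ?; case: (leP 0 v) => ?;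
  case: (leP u v) => ?; [rewrite ler0_norm|rewrite gtr0_norm|rewrite ler0_norm|
  rewrite gtr0_norm|rewrite ler0_norm|rewrite gtr0_norm|rewrite ler0_norm|
  rewrite gtr0_norm]; lra.
Qed.

(** The clamped functions equal 1 on the ray, its end point included, and are eventually 0 off it;
    the ray has to be closed for this choice. *)
Lemma approximable_ray t a : 0 <= t <= 1 -> approximable [set x | a <= x t].
Proof.
move=> t01; exists (fun j x => clamp (1 + j%:R * (x t - a))); split.
- move=> j; apply: measurable_maxr => //; apply: measurable_minr => //.
  apply: measurable_funD => //; apply: measurable_funM => //.
  by apply: measurable_funB => //; exact: measurable_ev.
- by move=> j x; exact: clamp01.
- move=> j e e0; exists (e / (j%:R + 1)); first by rewrite divr_gt0// ltr_wpDl.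
  move=> x y cx cy /(_ t t01) xy; apply: le_trans (clamp_lip _ _) _.
  have -> : 1 + j%:R * (x t - a) - (1 + j%:R * (y t - a)) = j%:R * (x t - y t) by ring.
  rewrite normrM normr_nat; apply: (@le_trans _ _ ((j%:R + 1) * `|x t - y t|)).
    by rewrite ler_wpM2r// lerDl.
  by rewrite mulrC -ler_pdivlMr// ltr_wpDl.
- move=> x; rewrite indicE; case: (boolP (x \in _)) => [/set_mem/= ax|].
    rewrite (_ : (fun j => _) = cst 1); first exact: cvg_cst.
    apply/funext => j; rewrite /clamp/=.
    have : 1 <= 1 + j%:R * (x t - a) by rewrite lerDl mulr_ge0// subr_ge0.
    by move=> /min_idPl ->; apply/max_idPr.
  rewrite notin_setE/= => /negP; rewrite -ltNge => ax.
  have ax' : 0 < a - x t by rewrite subr_gt0.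
  apply: cvg_near_cst; near=> j; rewrite /clamp.
  have : 1 + j%:R * (x t - a) <= 0.
    have : (a - x t)^-1 <= j%:R by near: j; exact: nbhs_infty_ger.
    by rewrite -[X in X <= _]div1r ler_pdivrMr//; lra.
  move=> h; apply/max_idPl; rewrite ge_min h orbT//.
Unshelve. all: end_near. Qed.

Lemma cyl01_approximable : <<s cyl01 >> `<=` <<s approximable >>.
Proof.
apply: smallest_sub; first exact: smallest_sigma_algebra.
move=> _ [t [A [t01 [mA ->]]]].
have h : measurable_fun [set: g_sigma_algebraType approximable] (fun x : R -> R => x t).
  apply: (@measurability _ _ _ _ _ _ (@RGenCInfty.G R)).
    exact: RGenCInfty.measurableE.
  move=> _ [_ [a ->] <-]; rewrite setTI; apply: sub_sigma_algebra.
  have := approximable_ray a t01; congr approximable.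
  by apply/seteqP; split=> x /=; rewrite in_itv/= andbT.
by have := h measurableT A mA; rewrite setTI.
Qed.

End Approximable.

Section MeanderLaw.
Context {R : realType} d (Om : measurableType d) (P : probability Om R).
Variables m B : @process R d Om.
Hypothesis mer : is_meander P m.
Hypothesis BM : is_BM P B.
Hypothesis ind : indep_processes P m `[0, 1] B `[0, +oo[.

Let s2 : R := Num.sqrt 2.
Let s20 : 0 < s2. Proof. by rewrite sqrtr_gt0. Qed.
Let b : Om -> R -> R := bm_scale B s2.
Let u (w : Om) : R -> R := splice (traj m w) (b w).

Let mm : measurable_fun [set: Om] (traj m : Om -> pathT R).
Proof. exact: (measurable_meander mer). Qed.
Let mb : measurable_fun [set: Om] (b : Om -> pathT R).
Proof. by case: (path_bm_half BM). Qed.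
Let mu : measurable_fun [set: Om] (u : Om -> pathT R).
Proof. exact: measurable_splice. Qed.
Let cm w : cont01 (traj m w). Proof. by case: mer => _ + _; apply. Qed.
Let cb w : cont01 (b w). Proof. by case: (path_bm_half BM). Qed.
Let b0 w : b w 0 = 0. Proof. by case: (path_bm_half BM). Qed.

(** Constrains the second half only. That the meander is nonnegative on the first half is an almost
    sure property, recovered in [meander_ge0_ae]. *)
Let wt (w : Om) : R := s2 * cont_weight (fun=> 1) 0 (traj m w) (b w).

Let mwt : measurable_fun [set: Om] wt.
Proof.
by apply: measurable_funM => //; apply: measurable_cont_weight.
Qed.

Let cw01 w : 0 <= cont_weight (fun=> 1) 0 (traj m w) (b w) <= 1.
Proof. by apply: cont_weight01 => x; rewrite ler01 lexx. Qed.

Let wt0 w : 0 <= wt w.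
Proof. by have /andP[h _] := cw01 w; apply: mulr_ge0 => //; exact: ltW. Qed.

Let wt_le w : wt w <= s2.
Proof. by have /andP[_ h] := cw01 w; rewrite /wt ler_piMr//; exact: ltW. Qed.

Let Q := dens P mwt wt0.

(** On the pi-system of approximable events, [mean_above_meander] holds for the approximating
    functionals and bounded convergence passes to the indicator. *)
Lemma meander_law (E : set (pathT R)) : measurable E ->
  P (traj m @^-1` E) = Q (u @^-1` E).
Proof.
move=> mE; apply: (@g_sigma_algebra_measure_unique _ R (pathT R) approximable _
  (fun=> setT) _ _ (law P mm) (law Q mu)) => //.
- exact: approximable_measurable.
- by move=> _; exact: approximable_setT.
- exact: bigcup_const.
- exact: approximable_setI.
- move=> F aF; have mF := approximable_measurable aF.
  have [g [mg g01 ug cg]] := aF; rewrite /= /law /pushforward.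
  have bg j x : `|g j x| <= 1 by rewrite ler_norml; have := g01 j x; lra.
  have E1 j : (\int[P]_w (g j (traj m w))%:E = \int[P]_w (g j (u w) * wt w)%:E)%E.
    have h := mean_above_meander mer BM ind (mg j) (g01 j) (ug j).
    have bgm : bounded_meas (fun w => g j (traj m w)).
      by apply: bounded_meas01 => // ; exact: (measurableT_comp (mg j) mm).
    have bcw : bounded_meas (fun w => cont_weight (g j) 0 (traj m w) (b w)).
      apply: bounded_meas01; first exact: measurable_cont_weight.
      by move=> w; exact: cont_weight01.
    rewrite -meanE//; transitivity (s2 * mean P (fun w => cont_weight (g j) 0 (traj m w) (b w)))%:E.
      by rewrite h mulVKf// gt_eqF.
    rewrite -meanZ// meanE.
      by apply: eq_integral => w _; rewrite /wt /cont_weight mul1r mulrCA.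
    by apply: bounded_measM => //; exact: bounded_meas_cst.
  have mgu j : measurable_fun [set: Om] (fun w => g j (u w)).
    exact: (measurableT_comp (mg j) mu).
  have c1 : (\int[P]_w (g j (traj m w))%:E)%E @[j --> \oo] -->
      (\int[P]_w (\1_F (traj m w))%:E)%E.
    apply: (@bounded_cvg_integral _ _ _ P setT _ _ 1) => //.
    + by move=> j; exact: (measurableT_comp (mg j) mm).
    + apply: (@measurableT_comp _ _ _ _ _ _ (\1_F : pathT R -> R)) => //.
  have c2 : (\int[P]_w (g j (u w) * wt w)%:E)%E @[j --> \oo] -->
      (\int[P]_w (\1_F (u w) * wt w)%:E)%E.
    apply: (@bounded_cvg_integral _ _ _ P setT _ _ s2) => //.
    + by move=> j; apply: measurable_funM.
    + apply: measurable_funM => //.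
      by apply: (@measurableT_comp _ _ _ _ _ _ (\1_F : pathT R -> R)) => //.
    + move=> j w; rewrite normrM -[leRHS]mul1r ler_pM// ger0_norm//.
    + by move=> w; apply: cvgMl; exact: cg.
  have mFm : measurable (traj m @^-1` F).
    by rewrite -[X in measurable X]setTI; exact: mm.
  transitivity (\int[P]_w (\1_F (traj m w))%:E)%E.
    transitivity (\int[P]_w (\1_(traj m @^-1` F) w)%:E)%E.
      by rewrite integral_indic// setIT.
    by apply: eq_integral => w _; rewrite !indicE.
  transitivity (\int[P]_w (\1_F (u w) * wt w)%:E)%E.
    rewrite (funext E1) in c1.
    exact: (cvg_unique _ c1 c2).
  rewrite /Q densE [RHS]integral_mkcond; apply: eq_integral => w _.
  rewrite patchE indicE -[w \in _]/(u w \in F).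
  by case: (u w \in F); rewrite ?mul1r ?mul0r.
- move=> _; rewrite /= /law /pushforward preimage_setT.
  by rewrite (le_lt_trans (probability_le1 _ _))// ltry.
- exact: cyl01_approximable.
Qed.

(** Nonnegativity is drawn from the self-similarity in [meander_law]: it is visible on [1/2,1] and
    spreads towards 0 by halving the time. *)
Lemma meander_ge0_ae : P (traj m @^-1` ~` above_dy 0) = 0%E.
Proof.
have mt t : 0 <= t <= 1 -> measurable [set x : pathT R | x t < 0].
  move=> t01; have := measurable_ev t01 measurableT (measurable_itv `]-oo, 0[).
  by rewrite setTI; congr measurable; apply/seteqP; split=> x /=; rewrite in_itv.
have mtm t : 0 <= t <= 1 -> measurable (traj m @^-1` [set x : pathT R | x t < 0]).
  by move=> /mt h; rewrite -[X in measurable X]setTI; exact: mm.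
(* After time 1/2 the weight vanishes wherever [u] is negative. *)
have Hhi t : 1 / 2 <= t <= 1 -> P (traj m @^-1` [set x | x t < 0]) = 0%E.
  move=> /andP[t2 t1]; rewrite meander_law; last by apply: mt; lra.
  rewrite /Q densE; apply: integral0_eq => w /=.
  rewrite /u spliceE2// -mulrDr pmulr_rlt0// => neg; congr EFin.
  rewrite /wt /cont_weight indicE memNset ?mulr0//.
  move/(above_dyP _ (@cb w)) => /(_ (2 * t - 1)) h.
  have : - (traj m w 1 + 0) <= b w (2 * t - 1) by apply: h; lra.
  by move: neg; lra.
have H k t : (2 ^+ k)^-1 <= t <= 1 -> P (traj m @^-1` [set x | x t < 0]) = 0%E.
  elim: k t => [|k IH] t /andP[kt t1].
    by apply: Hhi; move: kt; rewrite expr0 invr1; lra.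
  have k0 : 0 < (2 ^+ k)^-1 :> R by rewrite invr_gt0 exprn_gt0.
  move: kt; rewrite exprS invfM => kt.
  have [t2|t2] := leP (1 / 2) t; first by apply: Hhi; lra.
  rewrite meander_law; last by apply: mt; lra.
  rewrite /Q densE.
  (* Before 1/2 the sign of [u] at [t] is that of the meander at [2 * t], whose negativity is null
     by induction, and a density keeps null sets null. *)
  have -> : u @^-1` [set x | x t < 0] = traj m @^-1` [set x | x (2 * t) < 0].
    by apply/seteqP; split=> w /=; rewrite /u /splice (ltW t2) pmulr_rlt0.
  apply: null_set_integral.
  - by apply: mtm; lra.
  - by apply: measurable_funTS; apply/measurable_EFinP.
  - by apply: IH; lra.
have mA : measurable (traj m @^-1` ~` above_dy 0).
  rewrite -[X in measurable X]setTI; apply: mm => //.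
  by apply: measurableC; exact: measurable_above_dy.
apply: (measure_negligible mA).
(* Index 0 is excluded because [H] says nothing about time 0. By continuity, a path negative at 0 is
   negative at the first grid point of some fine level. *)
pose F n k := if (0 < k <= 2 ^ n)%N then traj m @^-1` [set x | x (gp n k) < 0] else set0.
apply: (@negligibleS _ _ _ P (\bigcup_n \bigcup_k F n k)).
  move=> w /= /contrapT[n _ [k k2 neg]].
  rewrite oppr0 in neg.
  have [k0|k0] := posnP k; last by exists n => //; exists k => //; rewrite /F k0 k2.
  rewrite k0 gp0 in neg; have neg' : 0 < - traj m w 0 by rewrite oppr_gt0.
  have [dl dl0 K] := unif_continuous_itv (@cm w) neg'.
  have [N _ /(_ N (leqnn _)) /= hN] := near_expV2_lt dl0.
  exists N => //; exists 1%N => //; rewrite /F expn_gt0/=.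
  have g1 : gp N 1 = (2 ^+ N)^-1 :> R by rewrite /gp div1r.
  have := K 0 (gp N 1); rewrite lexx ler01 => /(_ isT).
  rewrite gp01 ?expn_gt0// => /(_ isT); rewrite sub0r normrN g1.
  by rewrite ger0_norm ?invr_ge0 ?exprn_ge0// => /(_ hN); rewrite -g1 ltr_norml/=; lra.
apply: negligible_bigcup => n; apply: negligible_bigcup => k; rewrite /F.
case: ifPn => [/andP[k0 k2]|_]; last exact: negligible_set0.
apply/negligibleP; first by apply: mtm; exact: gp01.
apply: (H n); have /andP[_ ->] := gp01 (R := R) k2.
by rewrite andbT (_ : (2 ^+ n)^-1 = gp n 1) ?gp_le// /gp div1r.
Qed.

(** Multiplying [H] by an indicator that is almost surely 1 for the meander adds the constraint on
    the first half; with the weight of [meander_law] it says that the whole splice is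
    nonnegative. *)
Lemma meander_integral (H : pathT R -> \bar R) : measurable_fun [set: pathT R] H ->
  (forall x, (0 <= H x)%E) ->
  (\int[P]_w H (traj m w) = \int[P]_w (H (u w) * (s2 * \1_(above_dy 0) (u w))%:E))%E.
Proof.
move=> mH H0.
pose I : pathT R -> \bar R := EFin \o \1_(above_dy 0).
have mI : measurable_fun [set: pathT R] I.
  by apply/measurable_EFinP; apply: measurable_indic; exact: measurable_above_dy.
have I0 x : (0 <= I x)%E by rewrite lee_fin.
pose H' x := (H x * I x)%E.
have mH' : measurable_fun [set: pathT R] H' by exact: emeasurable_funM.
have H'0 x : (0 <= H' x)%E by exact: mule_ge0.
transitivity (\int[P]_w H' (traj m w))%E.
  apply: ge0_ae_eq_integral => //.
  - exact: (measurableT_comp mH mm).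
  - exact: (measurableT_comp mH' mm).
  exists (traj m @^-1` ~` above_dy 0); split.
  - rewrite -[X in measurable X]setTI; apply: mm => //.
    by apply: measurableC; exact: measurable_above_dy.
  - exact: meander_ge0_ae.
  move=> w /= + aw; apply => _; rewrite /H' /I /=.
  by rewrite indicE mem_set// mule1.
rewrite (ge0_integral_eq_law mm mu meander_law mH' H'0) /Q ge0_integral_dens//; last first.
  exact: (measurableT_comp mH' mu).
apply: eq_integral => w _; rewrite /H' -muleA; congr (_ * _)%E.
rewrite /I /= -EFinM; congr EFin; rewrite /wt /cont_weight mul1r mulrCA; congr (_ * _).
rewrite !indicE -natrM mulnb; congr (_%:R); congr nat_of_bool.
have [h h'] := above_dy_splice 0 (@cm w) (@cb w) (b0 w); rewrite mulr0 in h h'.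
apply/andP/idP; rewrite !inE; first by case.
by move=> k; split=> //; have [] := h k.
Qed.

End MeanderLaw.

(** * Integrals of spliced and shifted paths *)

Section PathIntegral.
Context {R : realType}.
Implicit Types x y : R -> R.

(** On left sums, cutting at 1/2 is a reindexing. The constant is 1/2 from the time change times the
    spatial factor of [splice]. *)
Lemma riemann_splice n x y : y 0 = 0 ->
  riemann n.+1 (splice x y) =
  (2 * Num.sqrt 2)^-1 * (riemann n x + (x 1 + riemann n y)).
Proof.
move=> y0; have h k : (k <= 2 ^ n)%N -> gp n.+1 k <= 1/2 :> R.
  move=> /gp01 => /(_ R); rewrite -gp_half; lra.
have h2 k : 1/2 <= gp n.+1 (2 ^ n + k) :> R.
  have := gp_shift (R := R) n k; have : 0 <= gp n k :> R.
    by rewrite /gp divr_ge0// exprn_ge0.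
  lra.
rewrite /riemann (_ : (2 ^ n.+1 = 2 ^ n + 2 ^ n)%N); last by rewrite expnS mul2n addnn.
rewrite big_split_ord/=.
have -> : \sum_(i < 2 ^ n) splice x y (gp n.+1 i) =
    (Num.sqrt 2)^-1 * \sum_(i < 2 ^ n) x (gp n i).
  by rewrite mulr_sumr; apply: eq_bigr => i _; rewrite /splice h ?gp_half// ltnW.
have -> : \sum_(i < 2 ^ n) splice x y (gp n.+1 (2 ^ n + i)) =
    (Num.sqrt 2)^-1 * (2 ^+ n * x 1 + \sum_(i < 2 ^ n) y (gp n i)).
  have -> : 2 ^+ n * x 1 = \sum_(i < 2 ^ n) x 1.
    by rewrite sumr_const card_ord -[RHS]mulr_natl natrX.
  rewrite -big_split/= mulr_sumr; apply: eq_bigr => i _.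
  by rewrite spliceE2// gp_shift mulrDr.
rewrite exprS !invfM -mulrDr.
have p0 : 2 ^+ n != 0 :> R by rewrite expf_neq0.
move: (\sum_(_ < _) _) (\sum_(_ < _) _) p0 => s1 s2' p0.
have s0 : Num.sqrt 2 != 0 :> R by rewrite gt_eqF// sqrtr_gt0.
by field; rewrite p0 s0.
Qed.

Lemma pint_splice x y : cont01 x -> cont01 y -> y 0 = 0 ->
  pint (splice x y) 0 1 = (2 * Num.sqrt 2)^-1 * (pint x 0 1 + (x 1 + pint y 0 1)).
Proof.
move=> cx cy y0.
have := cvg_riemann (cont01_splice cx cy y0); rewrite -cvg_shiftS => h1.
have h2 : riemann n.+1 (splice x y) @[n --> \oo] -->
    (2 * Num.sqrt 2)^-1 * (pint x 0 1 + (x 1 + pint y 0 1)).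
  rewrite (_ : (fun n => _) = (fun n => (2 * Num.sqrt 2)^-1 *
    (riemann n x + (x 1 + riemann n y)))).
    apply: cvgMr; apply: cvgD; first exact: cvg_riemann.
    by apply: cvgD; [exact: cvg_cst|exact: cvg_riemann].
  by apply/funext => n; rewrite riemann_splice.
exact: (cvg_unique _ h1 h2).
Qed.

Lemma pintD x y : cont01 x -> cont01 y ->
  pint (fun t => x t + y t) 0 1 = pint x 0 1 + pint y 0 1.
Proof.
move=> cx cy; rewrite !pintE (@RintegralD _ _ R)//; exact: integrable_itv.
Qed.

Lemma pint_cst (k : R) : pint (fun=> k) 0 1 = k.
Proof.
by rewrite pintE Rintegral_cst//= lebesgue_measure_itv/= lte_fin ltr01 oppr0 addr0 mulr1.
Qed.

Lemma riemann_drift n (v : R) :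
  riemann n (drift v) = v * (2 / 3 - (2 ^+ n)^-1 / 2 - (2 ^+ n)^-1 ^+ 2 / 6).
Proof.
(* Sums of [j] and of [j ^+ 2] in closed form, for partial sums so that induction applies. *)
have sumE k : (2 ^+ n)^-1 * \sum_(j < k) drift v (gp n j) =
    v * ((k%:R / 2 ^+ n) ^+ 2 - (k%:R / 2 ^+ n) * (2 ^+ n)^-1
     - ((k%:R / 2 ^+ n) * (k%:R / 2 ^+ n - (2 ^+ n)^-1) * (2 * (k%:R / 2 ^+ n) - (2 ^+ n)^-1)) / 6).
  elim: k => [|k IH]; first by rewrite big_ord0 !mul0r; ring.
  rewrite big_ord_recr/= mulrDr IH /drift /gp -[k.+1%:R]natr1.
  by move: (k%:R) ((2 ^+ n)^-1) => a h; field.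
rewrite /riemann sumE natrX divff ?expf_neq0//.
by move: ((2 ^+ n)^-1) => h; field.
Qed.

Lemma pint_drift (v : R) : pint (drift v) 0 1 = 2 * v / 3.
Proof.
have h1 := cvg_riemann (@cont01_drift R v).
have h2 : riemann n (drift v) @[n --> \oo] --> v * (2 / 3 - 0 / 2 - 0 ^+ 2 / 6).
  rewrite (_ : (fun n => _) = (fun n => v * (2 / 3 - (2 ^+ n)^-1 / 2 - (2 ^+ n)^-1 ^+ 2 / 6))).
    have c0 : (2 ^+ n)^-1 @[n --> \oo] --> (0 : R).
      apply/cvgrPdist_lt => e e0; have [N _ H] := near_expV2_lt e0.
      by exists N => // n Nn /=; rewrite sub0r normrN ger0_norm ?invr_ge0 ?exprn_ge0//; exact: H.
    apply: cvgMr; apply: cvgB; first by apply: cvgB; [exact: cvg_cst|exact: cvgMl].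
    by apply: cvgMl; rewrite expr2; apply: cvgM.
  by apply/funext => n; exact: riemann_drift.
transitivity (v * (2 / 3 - 0 / 2 - 0 ^+ 2 / 6)); first exact: (cvg_unique _ h1 h2).
by field.
Qed.

(** The value does not involve [y], so a shift of the second half leaves this area unchanged. *)
Lemma pint_half x y : cont01 x -> y 0 = 0 ->
  pint (fun r => splice x y r + splice x y (1 / 2)) 0 (1 / 2) =
  (2 * Num.sqrt 2)^-1 * (pint x 0 1 + x 1).
Proof.
move=> cx y0.
have cc (k : R) : cont01 (fun=> k) by move=> t; exact: cvg_cst.
pose x' t := x t + x 1.
(* [z] is the integrand on [0,1/2] and constant on [1/2,1], so [pint_splice] applies. *)
pose z := splice x' (fun=> 0).
have cx' : cont01 x' by move=> t; apply: cvgD; [exact: cx|exact: cvg_cst].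
have cz : cont01 z by exact: cont01_splice.
have zl t : 1 / 2 <= t <= 1 -> z t = z (1 / 2).
  by move=> /andP[t2 t1]; rewrite /z !spliceE2.
have -> : pint (fun r => splice x y r + splice x y (1 / 2)) 0 (1 / 2) = pint z 0 (1 / 2).
  rewrite !pintE; apply: eq_Rintegral => t; rewrite inE/= in_itv/= => /andP[t0 t1].
  rewrite /z /splice t1 lexx /x' (_ : 2 * (1 / 2) = 1); last by field.
  by ring.
(* [z] is constant on [1/2,1], so the step estimate holds with error 0 and gives the exact integral
   over that half. *)
have := @pint_step _ z (1/2) 1 0 cz.
have H : forall t, 1 / 2 <= t <= 1 -> `|z t - z (1 / 2)| <= 0.
  by move=> t /zl ->; rewrite subrr normr0.
move=> /(_ ltac:(lra) ltac:(lra) ltac:(lra) H); rewrite mul0r normr_le0 subr_eq0 => /eqP.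
rewrite {1}/z pint_splice// pintD// !pint_cst.
rewrite /z spliceE2//= mulr0 addr0 /x'.
have s0 : Num.sqrt 2 != 0 :> R by rewrite gt_eqF// sqrtr_gt0.
move: (pint x 0 1) (x 1) => q k.
set p := pint _ _ _; clearbody p => E.
transitivity ((2 * Num.sqrt 2)^-1 * (q + k + (k + k)) -
  ((2 * Num.sqrt 2)^-1 * (q + k + (k + k)) - p)); first by ring.
by rewrite E; field.
Qed.

(* A [cyl01]-measurable version of [pint x 0 1]; meaningful only when [x] is continuous
   on [0,1]. *)
Definition path_int (x : pathT R) : R := fine (limn_esup (fun n => (riemann n x)%:E)).

Lemma measurable_path_int : measurable_fun [set: pathT R] path_int.
Proof.
apply: (measurableT_comp (@fine_measurable R setT measurableT)).
apply: measurable_fun_limn_esup => n; apply/measurable_EFinP.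
exact: measurable_riemann.
Qed.

Lemma path_intE x : cont01 x -> path_int x = pint x 0 1.
Proof.
move=> cx; have c : (riemann n x)%:E @[n --> \oo] --> (pint x 0 1)%:E.
  by apply: cvg_EFin; [exact: nearW|exact: cvg_riemann].
by rewrite /path_int is_cvg_limn_esupE; [rewrite (cvg_lim _ c)|apply/cvg_ex; exists (pint x 0 1)%:E].
Qed.

End PathIntegral.

(** * Disintegration along the area *)

(** A Gaussian density of variance 1/24, the variance of the integral of a Brownian motion over
    [0,1/2]. *)
Lemma gaussian_kernel (R : realType) (g : R) :
  (\int[@lebesgue_measure R]_x (Num.sqrt (12 / pi) * expR (- 12 * (x - g) ^+ 2))%:E = 1)%E.
Proof.
pose s : R := Num.sqrt (24^-1).
have s0 : s != 0 by rewrite gt_eqF// sqrtr_gt0 invr_gt0.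
have sE : s ^+ 2 = 24^-1 by rewrite sqr_sqrtr// invr_ge0.
rewrite -(integral_normal_pdf g s); apply: eq_integral => x _; congr EFin.
rewrite /normal_pdf (negbTE s0) /normal_peak /normal_fun sE; congr (_ * expR _).
  rewrite -sqrtrV ?mulrn_wge0 ?mulr_ge0 ?invr_ge0 ?pi_ge0//; congr Num.sqrt.
  have p0 : (pi : R) != 0 by rewrite gt_eqF// pi_gt0.
  rewrite -[24^-1 * pi *+ 2]mulr_natr; move: p0; move: (pi : R) => q q0.
  by field; rewrite q0.
by rewrite -[24^-1 *+ 2]mulr_natr; field.
Qed.

Section Bridge.
Context {R : realType} d (Om : measurableType d) (P : probability Om R).
Variables m B : @process R d Om.
Hypothesis mer : is_meander P m.
Hypothesis BM : is_BM P B.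
Hypothesis ind : indep_processes P m `[0, 1] B `[0, +oo[.
Notation leb := (@lebesgue_measure R).

Let s2 : R := Num.sqrt 2.
Let s20 : 0 < s2. Proof. by rewrite sqrtr_gt0. Qed.
Let s2n0 : s2 != 0. Proof. by rewrite gt_eqF. Qed.
Let s2K : s2 * s2 = 2. Proof. by rewrite -expr2 sqr_sqrtr. Qed.
Let b : Om -> R -> R := bm_scale B s2.
Let u (w : Om) : R -> R := splice (traj m w) (b w).

Let mm : measurable_fun [set: Om] (traj m : Om -> pathT R).
Proof. exact: (measurable_meander mer). Qed.
Let mb : measurable_fun [set: Om] (b : Om -> pathT R).
Proof. by case: (path_bm_half BM). Qed.
Let cm w : cont01 (traj m w). Proof. by case: mer => _ + _; apply. Qed.
Let cb w : cont01 (b w). Proof. by case: (path_bm_half BM). Qed.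
Let b0 w : b w 0 = 0. Proof. by case: (path_bm_half BM). Qed.
Let cu w : cont01 (u w). Proof. exact: cont01_splice. Qed.

Let tilt (v : R) (y : R -> R) : R -> R := fun t => y t + drift v t.

Let tilt_cont v y : cont01 y -> cont01 (tilt v y).
Proof. by move=> cy t; apply: cvgD; [exact: cy|exact: cont01_drift]. Qed.

Let tilt0 v y : y 0 = 0 -> tilt v y 0 = 0.
Proof. by move=> y0; rewrite /tilt y0 drift0 addr0. Qed.

Let pint_tilt v y : cont01 y -> pint (tilt v y) 0 1 = pint y 0 1 + 2 * v / 3.
Proof. by move=> cy; rewrite pintD ?pint_drift//; exact: cont01_drift. Qed.

Let G (w : Om) : R := (2 * s2)^-1 * pint (b w) 0 1.
(** The drift [3 * s2 * x] adds [2 * s2 * x] to the integral of [b], hence exactly [x] to that of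
    the splice. *)
Let V (x : R) (w : Om) : R -> R := splice (traj m w) (tilt (3 * s2 * x) (b w)).

Let pint_V x w : pint (V x w) 0 1 = pint (u w) 0 1 + x.
Proof.
rewrite /V /u !pint_splice// ?pint_tilt//; [|exact: tilt_cont|exact: tilt0].
rewrite -/s2; field; exact: s2n0.
Qed.

(** By independence the first half is frozen and [cameron_martin] is applied to [b] alone. *)
Lemma tilt_splice (H : pathT R -> \bar R) (x : R) : measurable_fun [set: pathT R] H ->
  (forall p, (0 <= H p)%E) ->
  (\int[P]_w (H (u w) * (expR (- 12 * (x - G w) ^+ 2))%:E) =
   \int[P]_w (H (V x w) * (expR (- 12 * (x + G w) ^+ 2))%:E))%E.
Proof.
move=> mH H0; pose v := 3 * s2 * x.
pose g (q : pathT R) := (2 * s2)^-1 * path_int q.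
have mg : measurable_fun [set: pathT R] g.
  by apply: measurable_funM => //; exact: measurable_path_int.
have mexp (h : pathT R -> R) : measurable_fun [set: pathT R] h ->
    measurable_fun [set: pathT R] (fun q => (expR (- 12 * (h q) ^+ 2))%:E).
  move=> mh; apply/measurable_EFinP; apply: measurableT_comp; first exact: measurable_expR.
  by apply: measurable_funM => //; exact: measurable_funX.
pose e1 (q : pathT R) := (expR (- 12 * (x - g q) ^+ 2))%:E.
have me1 : measurable_fun [set: pathT R] e1 by apply: mexp; exact: measurable_funB.
(* The weight before the shift; along the drift [v] the functional [g] grows by [x], which gives the
   square of [x + G]. *)
pose e2 (q : pathT R) := (expR (- 12 * g q ^+ 2))%:E.
have me2 : measurable_fun [set: pathT R] e2 by exact: mexp.
pose K e (z : pathT R * pathT R) := (H (splice z.1 z.2) * e z.2)%E.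
have mK e : measurable_fun [set: pathT R] e -> measurable_fun setT (K e).
  move=> me; apply: emeasurable_funM.
    apply: (measurableT_comp mH (measurable_splice _ _)); first exact: measurable_fst.
    exact: measurable_snd.
  exact: (measurableT_comp me measurable_snd).
have K0 e : (forall q, (0 <= e q)%E) -> forall z, (0 <= K e z)%E.
  by move=> h z; exact: mule_ge0.
have e10 q : (0 <= e1 q)%E by rewrite lee_fin expR_ge0.
have e20 q : (0 <= e2 q)%E by rewrite lee_fin expR_ge0.
have IJ := meander_indep_path ind.
transitivity (\int[P]_w K e1 (traj m w : pathT R, b w : pathT R))%E.
  by apply: eq_integral => w _; rewrite /K /e1 /g/= path_intE.
rewrite (ge0_integral_indep mm mb IJ (mK _ me1) (K0 _ e10)).
pose sh (z : pathT R * pathT R) : pathT R * pathT R := (z.1, tilt v z.2).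
have msh : measurable_fun setT sh.
  apply: measurable_fun_pair; first exact: measurable_fst.
  exact: (measurableT_comp (measurable_add_drift v) measurable_snd).
transitivity (\int[P]_w \int[P]_w' (K e2 \o sh) (traj m w : pathT R, b w' : pathT R))%E.
  apply: eq_integral => w _.
  pose Kw (q : pathT R) := K e2 (traj m w : pathT R, q).
  have mKw : measurable_fun [set: pathT R] Kw by exact: (measurable_fun_pair2 _ (mK _ me2)).
  have := cameron_martin (path_bm_half BM) v mKw (fun q => K0 _ e20 _).
  rewrite /Kw => ->; apply: eq_integral => w' _.
  rewrite /K /= -muleA; congr (_ * _)%E; rewrite /e1 /e2 -EFinM; congr EFin.
  rewrite /cm_density -expRD; congr expR; rewrite /g path_intE// /v.
  have -> : pint (b w') 0 1 = 2 * s2 * ((2 * s2)^-1 * pint (b w') 0 1).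
    by field; exact: s2n0.
  rewrite mulKf ?mulf_neq0//; move: (_^-1 * _) => k.
  (* As [s2 * s2 = 2], the density contributes [24 x k - 12 x^2], which completes [- 12 k^2] to
     [- 12 (x - k)^2]. *)
  transitivity (- 12 * k ^+ 2 + (12 * (s2 * s2) * x * k - 6 * (s2 * s2) * x ^+ 2)).
    by rewrite s2K; ring.
  by field.
transitivity (\int[P]_w (K e2 \o sh) (traj m w : pathT R, b w : pathT R))%E.
  apply: esym.
  have mKs : measurable_fun setT (K e2 \o sh) := measurableT_comp (mK _ me2) msh.
  exact: (ge0_integral_indep mm mb IJ mKs (fun z => K0 _ e20 (sh z))).
apply: eq_integral => w _; rewrite /K /= /V -/v; congr (_ * _)%E.
rewrite /e2 /g path_intE; last exact: tilt_cont.
rewrite pint_tilt//; congr (expR _)%:E; congr (_ * _ ^+ 2); rewrite /G /v.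
by field; exact: s2n0.
Qed.

(** By [pint_splice], [A + G] is the integral of [u]. *)
Let A (w : Om) : R := (2 * s2)^-1 * (pint (traj m w) 0 1 + traj m w 1).
Let W (c : R) (w : Om) : R -> R :=
  splice (traj m w) (tilt (3 * s2 * (c - pint (u w) 0 1)) (b w)).

Let mI : measurable_fun [set: Om] (fun w => pint (u w) 0 1).
Proof. by apply: measurable_pint => //; exact: measurable_splice. Qed.

Let measurable_tilt_splice d' (T : measurableType d') (X : T -> Om) (k : T -> R) :
  measurable_fun [set: T] X -> measurable_fun [set: T] k ->
  measurable_fun [set: T] (fun z => splice (traj m (X z)) (tilt (k z) (b (X z))) : pathT R).
Proof.
move=> mX mk; apply: measurable_splice; first exact: (measurableT_comp mm mX).
apply: measurable_pathP => t t01; apply: measurable_funD.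
  exact: (measurableT_comp (measurable_ev t01) (measurableT_comp mb mX)).
exact: measurable_funM.
Qed.

Let kern (x : R) : \bar R := (Num.sqrt (12 / pi) * expR (- 12 * x ^+ 2))%:E.

Let mkern d' (T : measurableType d') (k : T -> R) : measurable_fun [set: T] k ->
  measurable_fun [set: T] (fun z => kern (k z)).
Proof.
move=> mk; apply/measurable_EFinP; apply: measurable_funM => //.
apply: measurableT_comp; first exact: measurable_expR.
by apply: measurable_funM => //; exact: measurable_funX.
Qed.

Let kern0 x : (0 <= kern x)%E.
Proof. by rewrite lee_fin mulr_ge0 ?sqrtr_ge0 ?expR_ge0. Qed.

Let mA : measurable_fun [set: Om] A.
Proof.
apply: measurable_funM => //; apply: measurable_funD; first exact: measurable_pint.
by apply: (measurableT_comp (measurable_ev _) mm); rewrite ler01 lexx.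
Qed.

Let mW : measurable_fun setT (fun z : Om * R => W z.2 z.1 : pathT R).
Proof.
apply: measurable_tilt_splice => //.
apply: measurable_funM => //; apply: measurable_funB; first exact: measurable_snd.
exact: (measurableT_comp mI measurable_fst).
Qed.

Let mWc c : measurable_fun setT (fun w : Om => W c w : pathT R).
Proof.
exact: (measurableT_comp mW (pair2_measurable c)).
Qed.

(** The order of integration alternates: the Cameron-Martin step needs [x] fixed outside the
    expectation, while the translation of [x] depends on the path and needs the path fixed. *)
Lemma bridge_disintegration (H : pathT R -> \bar R) : measurable_fun [set: pathT R] H ->
  (forall p, (0 <= H p)%E) ->
  (\int[P]_w H (u w) = \int[leb]_c \int[P]_w (H (W c w) * kern (A w - c)))%E.
Proof.
move=> mH H0.
have mu : measurable_fun [set: Om] (u : Om -> pathT R) by exact: measurable_splice.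
have mG : measurable_fun [set: Om] G.
  by apply: measurable_funM => //; exact: measurable_pint.
transitivity (\int[P]_w \int[leb]_x (H (u w) * kern (x - G w)))%E.
  apply: eq_integral => w _.
  rewrite ge0_integralZl//; first by rewrite gaussian_kernel mule1.
  by apply: mkern; exact: measurable_funB.
pose F1 (z : Om * R) := (H (u z.1) * kern (z.2 - G z.1))%E.
have mF1 : measurable_fun setT F1.
  apply: emeasurable_funM.
    exact: (measurableT_comp mH (measurableT_comp mu measurable_fst)).
  apply: mkern; apply: measurable_funB => //.
  exact: (measurableT_comp mG measurable_fst).
rewrite (@fubini_tonelli _ _ _ _ R P leb F1 mF1); last first.
  by move=> z; exact: mule_ge0.
transitivity (\int[leb]_x \int[P]_w (H (V x w) * kern (x + G w)))%E.
  apply: eq_integral => x _.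
  have k0 : (0 <= (Num.sqrt (12 / pi))%:E :> \bar R)%E by rewrite lee_fin sqrtr_ge0.
  pose H' p := (H p * (Num.sqrt (12 / pi))%:E)%E.
  have mH' : measurable_fun [set: pathT R] H' by exact: emeasurable_funM.
  have H'0 p : (0 <= H' p)%E by exact: mule_ge0.
  have := tilt_splice x mH' H'0; rewrite /H' => E.
  transitivity (\int[P]_w (H (u w) * (Num.sqrt (12 / pi))%:E *
      (expR (- 12 * (x - G w) ^+ 2))%:E))%E.
    by apply: eq_integral => w _; rewrite /F1 /kern/= EFinM muleA.
  by rewrite E; apply: eq_integral => w _; rewrite /kern EFinM muleA.
pose F2 (z : Om * R) := (H (V z.2 z.1) * kern (z.2 + G z.1))%E.
have mF2 : measurable_fun setT F2.
  apply: emeasurable_funM.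
    apply: (measurableT_comp mH); apply: measurable_tilt_splice => //.
    by apply: measurable_funM => //; exact: measurable_snd.
  apply: mkern; apply: measurable_funD => //.
  exact: (measurableT_comp mG measurable_fst).
have F20 z : (0 <= F2 z)%E by exact: mule_ge0.
transitivity (\int[P]_w \int[leb]_x F2 (w, x))%E.
  by rewrite (@fubini_tonelli _ _ _ _ R P leb F2 mF2).
pose F3 (z : Om * R) := (H (W z.2 z.1) * kern (A z.1 - z.2))%E.
have mF3 : measurable_fun setT F3.
  apply: emeasurable_funM.
    exact: (measurableT_comp mH mW).
  apply: mkern; apply: measurable_funB; last exact: measurable_snd.
  exact: (measurableT_comp mA measurable_fst).
have F30 z : (0 <= F3 z)%E by exact: mule_ge0.
transitivity (\int[P]_w \int[leb]_c F3 (w, c))%E; last first.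
  by rewrite (@fubini_tonelli _ _ _ _ R P leb F3 mF3).
apply: eq_integral => w _.
have mF2w : measurable_fun [set: R] (fun x => F2 (w, x)) by exact: (measurable_fun_pair2 _ mF2).
rewrite (ge0_integral_affine (- pint (u w) 0 1) (oner_neq0 R) mF2w)//.
rewrite normr1 mul1e; apply: eq_integral => c _.
rewrite /F2 /F3 /= /V /W mul1r; congr (_ * _)%E.
(* The substitution yields [c - A]; the square hides the sign. *)
rewrite /kern -[(A w - c) ^+ 2]sqrrN; congr (_ * expR (_ * _ ^+ 2))%:E.
by rewrite /A /G /u pint_splice//; ring.
Qed.

Let wgt (c : R) (w : Om) : R :=
  \1_(above_dy 0) (W c w) * (Num.sqrt (24 / pi) * expR (- 12 * (A w - c) ^+ 2)).

Let wgt01 c w : 0 <= wgt c w <= Num.sqrt (24 / pi).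
Proof.
have e1 : expR (- 12 * (A w - c) ^+ 2) <= 1.
  by rewrite expR_le1 mulNr oppr_le0 mulr_ge0 ?sqr_ge0.
have k0 : 0 <= Num.sqrt (24 / pi) * expR (- 12 * (A w - c) ^+ 2) :> R.
  by rewrite mulr_ge0 ?sqrtr_ge0 ?expR_ge0.
rewrite /wgt indicE; case: (_ \in _); rewrite ?mul0r ?mul1r ?lexx ?sqrtr_ge0// k0/=.
by rewrite ler_piMr ?sqrtr_ge0.
Qed.

Let mwgt : measurable_fun setT (fun z : Om * R => wgt z.2 z.1).
Proof.
apply: measurable_funM.
  apply: (@measurableT_comp _ _ _ _ _ _ (\1_(above_dy 0) : pathT R -> R)) => //.
  by apply: measurable_indic; exact: measurable_above_dy.
apply: measurable_funM => //; apply: measurableT_comp; first exact: measurable_expR.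
apply: measurable_funM => //; apply: measurable_funX; apply: measurable_funB.
  exact: (measurableT_comp mA measurable_fst).
exact: measurable_snd.
Qed.

Let mwgtc c : measurable_fun [set: Om] (wgt c).
Proof. exact: (measurable_fun_pair1 c mwgt). Qed.

Lemma ge0_meander_disintegration (H : pathT R -> \bar R) :
  measurable_fun [set: pathT R] H -> (forall p, (0 <= H p)%E) ->
  (\int[P]_w H (traj m w) = \int[leb]_c \int[P]_w (H (W c w) * (wgt c w)%:E))%E.
Proof.
move=> mH H0; rewrite (meander_integral mer BM ind mH H0).
pose H' (p : pathT R) := (H p * (s2 * \1_(above_dy 0) p)%:E)%E.
have mH' : measurable_fun [set: pathT R] H'.
  apply: emeasurable_funM => //; apply/measurable_EFinP; apply: measurable_funM => //.
  by apply: measurable_indic; exact: measurable_above_dy.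
have H'0 p : (0 <= H' p)%E by rewrite mule_ge0// lee_fin mulr_ge0// ltW.
rewrite (bridge_disintegration mH' H'0); apply: eq_integral => c _.
apply: eq_integral => w _; rewrite /H' /kern /wgt -muleA -EFinM; congr (_ * _%:E)%E.
(* The factor [s2] comes from [meander_integral], the other one from the Gaussian kernel. *)
have -> : Num.sqrt (24 / pi) = s2 * Num.sqrt (12 / pi) :> R.
  by rewrite -sqrtrM//; congr Num.sqrt; rewrite mulrA -natrM.
by ring.
Qed.

(** A signed [h] is written as [h + M] minus [M], both nonnegative. Lebesgue measure in [c] being
    infinite, integrability over [c] is read off the nonnegative identity, whose other side is a
    bounded mean. *)
Lemma meander_disintegration (h : pathT R -> R) (M : R) :
  measurable_fun [set: pathT R] h -> (forall p, `|h p| <= M) ->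
  (\int[P]_w (h (traj m w))%:E = \int[leb]_c \int[P]_w (h (W c w) * wgt c w)%:E)%E.
Proof.
move=> mh hM.
have M0 : 0 <= M := le_trans (normr_ge0 _) (hM (fun=> 0)).
pose F (k : pathT R -> R) (z : Om * R) : \bar R := (k (W z.2 z.1) * wgt z.2 z.1)%:E.
have mF k : measurable_fun [set: pathT R] k -> measurable_fun setT (F k).
  move=> mk; apply/measurable_EFinP; apply: measurable_funM => //.
  exact: (measurableT_comp mk mW).
(* The common bound [M + M] serves both [h + M] and the constant [M]. *)
have key (k : pathT R -> R) : measurable_fun [set: pathT R] k ->
    (forall p, 0 <= k p <= M + M) ->
    leb.-integrable setT (fun c => \int[P]_w (k (W c w) * wgt c w)%:E)%E /\
    (\int[P]_w (k (traj m w))%:E = \int[leb]_c \int[P]_w (k (W c w) * wgt c w)%:E)%E.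
  move=> mk k01; have k0 p : 0 <= k p by case/andP: (k01 p).
  have E : (\int[P]_w (k (traj m w))%:E = \int[leb]_c \int[P]_w (k (W c w) * wgt c w)%:E)%E.
    rewrite (@ge0_meander_disintegration (fun p => (k p)%:E))//; exact/measurable_EFinP.
  split=> //; apply/integrableP; split.
    apply: (@measurable_fun_fubini_tonelli_G _ _ _ _ R P (F k)) => //; first exact: mF.
    by move=> z; rewrite lee_fin mulr_ge0//; case/andP: (wgt01 z.2 z.1).
  under eq_integral => c _.
    rewrite gee0_abs; last first.
      by apply: integral_ge0 => w _; rewrite lee_fin mulr_ge0//; case/andP: (wgt01 c w).
    over.
  rewrite -E.
  have bk : P.-integrable setT (EFin \o (fun w => k (traj m w))).
    apply: (@bounded_integrable _ _ _ P setT _ (M + M)) => //.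
      exact: (measurableT_comp mk mm).
    by move=> w; case/andP: (k01 (traj m w)) => h1 h2; rewrite ger0_norm.
  have /integrableP[_] := bk.
  by under eq_integral do rewrite /= ger0_norm//.
have mk1 : measurable_fun [set: pathT R] (fun p => h p + M) by exact: measurable_funD.
have mk2 : measurable_fun [set: pathT R] (fun=> M) by [].
have hM2 p : `|h p + M| <= M + M.
  by rewrite (le_trans (ler_normD _ _))// lerD// ger0_norm.
have k1M p : 0 <= h p + M <= M + M.
  by have := hM p; rewrite ler_norml; move: (h p) => v; lra.
have k2M (p : pathT R) : 0 <= M <= M + M by lra.
have [i1 E1] := key _ mk1 k1M.
have [i2 E2] := key _ mk2 k2M.
have sub (k k' : Om -> R) (N N' : R) : measurable_fun [set: Om] k ->
    measurable_fun [set: Om] k' ->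
    (forall w, `|k w| <= N) -> (forall w, `|k' w| <= N') ->
    (\int[P]_w (k w - k' w)%:E = \int[P]_w (k w)%:E - \int[P]_w (k' w)%:E)%E.
  move=> mk mk' kN kN'; rewrite -integralB//.
  - exact: (@bounded_integrable _ _ _ P setT _ N).
  - exact: (@bounded_integrable _ _ _ P setT _ N').
transitivity (\int[P]_w (h (traj m w) + M)%:E - \int[P]_w (M)%:E)%E.
  rewrite -(sub _ _ (M + M) M)//.
  - by apply: eq_integral => w _; rewrite addrK.
  - exact: (measurableT_comp mk1 mm).
  - by move=> w; rewrite ger0_norm.
rewrite E1 E2; apply: etrans (esym (integralB measurableT i1 i2)) _.
apply: eq_integral => c _.
have hk (k : pathT R -> R) (N : R) : 0 <= N -> (forall p, `|k p| <= N) ->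
    forall w, `|k (W c w) * wgt c w| <= N * Num.sqrt (24 / pi).
  move=> N0 kN w; have /andP[w0 w1] := wgt01 c w.
  by rewrite normrM ler_pM// ger0_norm.
rewrite -(sub _ _ ((M + M) * Num.sqrt (24 / pi)) (M * Num.sqrt (24 / pi))).
- by apply: eq_integral => w _; rewrite mulrDl addrK.
- apply: measurable_funM => //; exact: (measurableT_comp mk1 (mWc c)).
- exact: measurable_funM.
- exact: (hk (fun p => h p + M) (M + M) (addr_ge0 M0 M0) hM2).
- by apply: (hk (fun=> M) M) => // p; rewrite ger0_norm.
Qed.

Lemma traj_u_proc w : traj (u_proc m B) w = u w.
Proof.
apply/funext => t; rewrite /traj /u_proc /u /splice; case: ifP => // _; congr (_ + _).
rewrite /b /bm_scale (mulKf s2n0) expr2 s2K; congr (B _ w).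
by field.
Qed.

Lemma traj_U_proc c w : traj (U_proc m B c) w = W c w.
Proof.
apply/funext => t; rewrite {1}/traj /U_proc traj_u_proc.
have /(congr1 (@^~ t)) := traj_u_proc w; rewrite /traj => ->.
rewrite /W; move: (pint (u w) 0 1) => I; rewrite /u /splice; case: (t <= 1 / 2) => //.
by rewrite /tilt /drift -/s2; field; exact: s2n0.
Qed.

Lemma pint_U_proc c w : pint (traj (U_proc m B c) w) 0 1 = c.
Proof. by rewrite traj_U_proc (pint_V (c - pint (u w) 0 1)); ring. Qed.

Lemma pint_U_proc_half c w :
  pint (fun r => U_proc m B c r w + U_proc m B c (1 / 2) w) 0 (1 / 2) = A w.
Proof.
have E t : U_proc m B c t w = W c w t by have /(congr1 (@^~ t)) := traj_U_proc c w.
rewrite (_ : (fun r => _) = (fun r => W c w r + W c w (1 / 2))); last first.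
  by apply/funext => r; rewrite !E.
by rewrite /W pint_half//; exact: tilt0.
Qed.

Lemma measurable_U_proc c :
  measurable_fun [set: Om] (traj (U_proc m B c) : Om -> pathT R).
Proof. by rewrite (funext (traj_U_proc c)). Qed.

Lemma cont01_U_proc c w : cont01 (traj (U_proc m B c) w).
Proof.
by rewrite traj_U_proc; apply: cont01_splice => //; [exact: tilt_cont|exact: tilt0].
Qed.

Definition half_area c w : R :=
  pint (fun r => U_proc m B c r w + U_proc m B c (1 / 2) w) 0 (1 / 2).

Lemma measurable_half_area c : measurable_fun [set: Om] (half_area c).
Proof. by rewrite /half_area (funext (pint_U_proc_half c)). Qed.

Lemma meander_disintegration_U_proc (h : pathT R -> R) (M : R) :
  measurable_fun [set: pathT R] h -> (forall p, `|h p| <= M) ->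
  (\int[P]_w (h (traj m w))%:E =
   \int[leb]_c \int[P]_w (h (traj (U_proc m B c) w) *
     (\1_(above_dy 0) (traj (U_proc m B c) w) *
      (Num.sqrt (24 / pi) * expR (- 12 * (half_area c w - c) ^+ 2))))%:E)%E.
Proof.
move=> mh hM; rewrite (meander_disintegration mh hM); apply: eq_integral => c _.
by apply: eq_integral => w _; rewrite traj_U_proc /half_area pint_U_proc_half.
Qed.

End Bridge.

Theorem theorem1p1 (R : realType) (d : measure_display) (Omega : measurableType d)
  (P : probability Omega R) (m B : @process R d Omega) :
  is_meander P m -> is_BM P B ->
  indep_processes P m `[0, 1] B `[0, +oo[ ->
  forall (Phi : (R -> R) -> R) (f : R -> R),
    path_borel Phi -> bounded_fun_on Phi ->
    measurable_fun setT f -> bounded_fun_on f ->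
    (\int[P]_w (Phi (traj m w) * f (pint (traj m w) 0 1))%R%:E =
     \int[lebesgue_measure]_(c in `[0%R, +oo[%classic)
        ((Num.sqrt (24 / pi))%R%:E *
         \int[P]_w (Phi (traj (U_proc m B c) w)
                    * expR (- 12 * (pint (fun r => U_proc m B c r w
                                                   + U_proc m B c (1/2) w) 0 (1/2)
                                    - c) ^+ 2)
                    * \1_[set w' | forall t : R, (0 <= t <= 1)%R -> (0 <= U_proc m B c t w')%R] w)%R%:E
         * (f c)%:E))%E.
Proof.
move=> mer BM ind Phi f bPhi [M1 hM1] mf [M2 hM2].
have mPhi : measurable_fun [set: pathT R] Phi by exact: path_borel_measurable.
(* [path_int] makes the second factor measurable on the path space; on [U_proc m B c] it equals [c],
   so that factor becomes [f c]. *)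
pose h (p : pathT R) := Phi p * f (path_int p).
have mh : measurable_fun [set: pathT R] h.
  by apply: measurable_funM => //; exact: (measurableT_comp mf measurable_path_int).
have hM p : `|h p| <= M1 * M2 by rewrite normrM ler_pM.
have cU c w : cont01 (traj (U_proc m B c) w) := @cont01_U_proc _ _ _ P m B mer BM c w.
have intU c w : pint (traj (U_proc m B c) w) 0 1 = c := pint_U_proc mer BM c w.
have aboveU c w : \1_[set w' | forall t : R, 0 <= t <= 1 -> 0 <= U_proc m B c t w'] w =
    \1_(above_dy 0) (traj (U_proc m B c) w) :> R.
  rewrite !indicE; congr (_%:R); congr nat_of_bool; apply/idP/idP; rewrite !inE/=.
    by move=> pos; apply/(above_dyP _ (@cU c w)) => t t01; rewrite oppr0; exact: pos.
  by move=> /(above_dyP _ (@cU c w)) pos t /pos; rewrite oppr0.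
transitivity (\int[P]_w (h (traj m w))%:E)%E.
  apply: eq_integral => w _; rewrite /h path_intE//.
  by case: mer => _ + _; apply.
rewrite (meander_disintegration_U_proc mer BM ind mh hM) [RHS]integral_mkcond.
apply: eq_integral => c _.
have hU w : h (traj (U_proc m B c) w) = Phi (traj (U_proc m B c) w) * f c.
  by rewrite /h path_intE// intU.
(* For negative [c] the indicator vanishes: a nonnegative path has a nonnegative integral, while the
   integral of [U_proc m B c] is [c]. *)
rewrite patchE; case: ifPn => [c0|]; last first.
  rewrite notin_setE/= in_itv/= andbT => /negP; rewrite -ltNge => c0.
  apply: integral0_eq => w _; rewrite [\1_(above_dy 0) _]indicE memNset ?mul0r ?mulr0//.
  move=> /(above_dyP _ (@cU c w)) pos.
  have : 0 <= pint (traj (U_proc m B c) w) 0 1.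
    rewrite pintE; apply: Rintegral_ge0 => t; rewrite /= in_itv/= => /pos.
    by rewrite oppr0.
  by rewrite intU leNgt c0.
pose k w := Phi (traj (U_proc m B c) w) *
  (expR (- 12 * (half_area m B c w - c) ^+ 2) * \1_(above_dy 0) (traj (U_proc m B c) w)).
have mU := measurable_U_proc mer BM c.
have mk : measurable_fun [set: Omega] k.
  apply: measurable_funM; first exact: (measurableT_comp mPhi mU).
  apply: measurable_funM.
    apply: measurableT_comp; first exact: measurable_expR.
    apply: measurable_funM => //; apply: measurable_funX; apply: measurable_funB => //.
    exact: (measurable_half_area mer BM).
  apply: (@measurableT_comp _ _ _ _ _ _ (\1_(above_dy 0) : pathT R -> R)) => //.
  by apply: measurable_indic; exact: measurable_above_dy.
have bk : P.-integrable setT (EFin \o k).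
  apply: (@bounded_integrable _ _ _ P setT _ M1) => // w.
  rewrite normrM -[leRHS]mulr1 ler_pM// ger0_norm ?mulr_ge0 ?expR_ge0 ?indicE//.
  apply: mulr_ile1; rewrite ?expR_ge0 ?ler0n//; last by rewrite lern1 leq_b1.
  by rewrite expR_le1 mulNr oppr_le0 mulr_ge0 ?sqr_ge0.
transitivity (\int[P]_w ((Num.sqrt (24 / pi) * f c)%:E * (k w)%:E))%E.
  by apply: eq_integral => w _; rewrite hU -EFinM /k; congr EFin; ring.
rewrite integralZl// EFinM muleAC; congr (_ * _ * _)%E.
by apply: eq_integral => w _; rewrite aboveU /k mulrA.
Qed.
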